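(* Let $(M,g_M)$ be a complete Riemannian manifold on which a compact Lie group $G$ acts by isometries, and let $g_{\mathrm{bi}}$ be a bi-invariant metric on $G$. Let $M^{\mathrm{reg}}\subset M$ be the union of the principal orbits, and for $l>0$ let $\tilde g_l$ be the metric on $M^{\mathrm{reg}}$ obtained from the Cheeger deformation $g_l$ of $g_M$ by rescaling $g_l$ by the factor $1/l^2$ along the orbits. For any non-negative integer $p$ and any $G$-invariant, pre-compact open subset $\mathcal U\subset M^{\mathrm{reg}}$ (that is, the closure of $\mathcal U$ in $M^{\mathrm{reg}}$ is compact), as $l\to 0$ the one-parameter family $\{\tilde g_l|_{\mathcal U}\}_{l>0}$ converges in the $C^p$-topology to a $G$-invariant metric $\tilde g$ on $\mathcal U$ such that the Riemannian submersion $(\mathcal U,\tilde g)\to\mathcal U/G$ has totally geodesic, normal homogeneous fibers.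
   Context: Cheeger deformation: for $l>0$ the group $G$ acts freely and isometrically on $(G\times M,\ l^2g_{\mathrm{bi}}+g_M)$ by $g(p,m)=(pg^{-1},gm)$. The quotient map of this action is identified with $q:G\times M\to M$, $q(p,m)=pm$, and $g_l$ denotes the Riemannian metric on $M\cong(G\times M)/G$ for which $q:(G\times M,\ l^2g_{\mathrm{bi}}+g_M)\to(M,g_l)$ is a Riemannian submersion. For $x\in M^{\mathrm{reg}}$, $G(x)$ is the orbit of $x$, $T_xG(x)$ is its tangent space and $T_xG(x)^{\perp}$ its orthogonal complement (it is the same for $g_l$ and $g_M$). The rescaled metric is $$\tilde g_l\equiv\frac1{l^2}\,g_l|_{T_xG(x)}+g_l|_{T_xG(x)^{\perp}}.$$ A homogeneous space $G/H$ is normal homogeneous if its metric is the one making the quotient map $(G,g_{\mathrm{bi}})\to G/H$ a Riemannian submersion for a bi-invariant metric $g_{\mathrm{bi}}$ on $G$; a fiber (an orbit of $G$) is normal homogeneous if, with its induced Riemannian metric, it is $G$-equivariantly isometric (in the sense of Riemannian metrics) to such a space. Convergence in the $C^p$-topology means uniform convergence of the values and of all partial derivatives up to order $p$ of the components of the tensors, with respect to a fixed finite atlas. *)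

(* Defs.v *)
From HB Require Import structures.
From mathcomp Require Import all_boot all_order all_algebra.
From mathcomp Require Import all_classical all_reals all_analysis.

Set Implicit Arguments.
Unset Strict Implicit.
Unset Printing Implicit Defensive.
Import Order.TTheory GRing.Theory Num.Theory.
Import numFieldNormedType.Exports.
Local Open Scope classical_set_scope.
Local Open Scope ring_scope.

(* No compatibility between the two structures is built in: smoothness of the
   group operations is required separately in [lie_group]. *)
HB.structure Definition TopologicalSpaceWithGroup :=
  { G of Group G & Topological G }.
Notation topGroupType := TopologicalSpaceWithGroup.type.

Lemma open_setX (T U : topologicalType) (A : set T) (B : set U) :
  open A -> open B -> open (A `*` B).
Proof.
rewrite !openE => oA oB [x y] [/= /oA nA /oB nB].
by exists (A, B).
Qed.

Section Smooth.
Variable R : realType.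

(* For finite-dimensional V this is the usual notion of a C^k map on an open
   set D; it is only ever used for such V. *)
Fixpoint Ck (k : nat) (V W : normedModType R) (D : set V) (f : V -> W) : Prop :=
  if k is k'.+1 then
    (forall x, D x -> differentiable f x) /\
    (forall v, Ck k' D (fun x => 'd f x v))
  else forall x, D x -> {for x, continuous f}.

Definition smooth (V W : normedModType R) (D : set V) (f : V -> W) : Prop :=
  forall k, Ck k D f.

End Smooth.

Section Manifold.
Variable R : realType.

(* [cmap] and [cinv] are total; only their values on [cdom] and [ccod] matter. *)
Record chart (M : topologicalType) (E : normedModType R) := Chart {
  cdom : set M;
  ccod : set E;
  cmap : M -> E;
  cinv : E -> M;
  cdom_open : open cdom;
  ccod_open : open ccod;
  cmap_ccod : forall x, cdom x -> ccod (cmap x);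
  cinv_cdom : forall u, ccod u -> cdom (cinv u);
  cmapK : forall x, cdom x -> cinv (cmap x) = x;
  cinvK : forall u, ccod u -> cmap (cinv u) = u;
  cmap_continuous : forall x, cdom x -> {for x, continuous cmap};
  cinv_continuous : forall u, ccod u -> {for u, continuous cinv}
}.

(* Besides the atlas, a preferred chart around each point is recorded, so that
   the tangent space T_x M can be represented by E: a vector of E stands for
   the tangent vector with these components in [chart_at x]. *)
Record charted (M : topologicalType) (E : normedModType R) := Charted {
  atlas : set (chart M E);
  chart_at : M -> chart M E;
  chart_at_atlas : forall x, atlas (chart_at x);
  chart_at_cdom : forall x, cdom (chart_at x) x
}.

Definition smooth_manifold (M : topologicalType) (E : normedModType R)
    (C : charted M E) : Prop :=
  [/\ hausdorff_space M, @second_countable M &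
    forall a b, atlas C a -> atlas C b ->
      smooth (ccod a `&` cinv a @^-1` cdom b) (cmap b \o cinv a)].

Definition smooth_map (M N : topologicalType) (E F : normedModType R)
    (C : charted M E) (C' : charted N F) (D : set M) (f : M -> N) : Prop :=
  (forall x, D x -> {for x, continuous f}) /\
  (forall a b, atlas C a -> atlas C' b ->
    smooth (ccod a `&` cinv a @^-1` (D `&` f @^-1` cdom b))
           (cmap b \o f \o cinv a)).

(* The differential T_x M -> T_(f x) N in the preferred charts. *)
Definition mdiff (M N : topologicalType) (E F : normedModType R)
    (C : charted M E) (C' : charted N F) (f : M -> N) (x : M) : E -> F :=
  'd (cmap (chart_at C' (f x)) \o f \o cinv (chart_at C x))
     (cmap (chart_at C x) x).

Section Product.
Variables (M N : topologicalType) (E F : normedModType R).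

Program Definition prod_chart (a : chart M E) (b : chart N F) :
    chart (M * N)%type (E * F)%type :=
  @Chart _ _ (cdom a `*` cdom b) (ccod a `*` ccod b)
    (fun z => (cmap a z.1, cmap b z.2)) (fun u => (cinv a u.1, cinv b u.2))
    _ _ _ _ _ _ _ _.
Next Obligation. by move=> a b; apply: open_setX; exact: cdom_open. Qed.
Next Obligation. by move=> a b; apply: open_setX; exact: ccod_open. Qed.
Next Obligation. by move=> a b z [? ?]; split; exact: cmap_ccod. Qed.
Next Obligation. by move=> a b u [? ?]; split; exact: cinv_cdom. Qed.
Next Obligation. by move=> a b [x y] [? ?] /=; rewrite !cmapK. Qed.
Next Obligation. by move=> a b [u v] [? ?] /=; rewrite !cinvK. Qed.
Next Obligation.
move=> a b z [? ?]; apply: (@cvg_pair _ _ _ (nbhs z)) => /=.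
  apply: (@cvg_comp _ _ _ fst (cmap a)); first exact: cvg_fst.
  exact: cmap_continuous.
apply: (@cvg_comp _ _ _ snd (cmap b)); first exact: cvg_snd.
exact: cmap_continuous.
Qed.
Next Obligation.
move=> a b z [? ?]; apply: (@cvg_pair _ _ _ (nbhs z)) => /=.
  apply: (@cvg_comp _ _ _ fst (cinv a)); first exact: cvg_fst.
  exact: cinv_continuous.
apply: (@cvg_comp _ _ _ snd (cinv b)); first exact: cvg_snd.
exact: cinv_continuous.
Qed.

Program Definition prod_charted (C : charted M E) (C' : charted N F) :
    charted (M * N)%type (E * F)%type :=
  @Charted _ _
    [set c | exists a b, [/\ atlas C a, atlas C' b & c = prod_chart a b]]
    (fun z => prod_chart (chart_at C z.1) (chart_at C' z.2)) _ _.
Next Obligation.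
move=> C C' z; exists (chart_at C z.1), (chart_at C' z.2).
by split => //; exact: chart_at_atlas.
Qed.
Next Obligation. by move=> C C' z; split; exact: chart_at_cdom. Qed.

End Product.

End Manifold.

Section Riemannian.
Variable R : realType.

(* Fields of bilinear forms, evaluated on tangent vectors in preferred charts. *)
Definition tensor (M : topologicalType) (E : normedModType R) :=
  M -> E -> E -> R.

Section Metric.
Variables (M : topologicalType) (E : normedModType R) (C : charted M E).
Implicit Types (a : chart M E) (g : tensor M E).

(* The tangent vector at [cinv a u] whose components in the chart a are v. *)
Definition push a (u v : E) : E :=
  'd (cmap (chart_at C (cinv a u)) \o cinv a) u v.

(* The components of g in the chart a. *)
Definition comp g a (u v w : E) : R :=
  g (cinv a u) (push a u v) (push a u w).

Definition riemannian_metric (U : set M) g : Prop :=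
  [/\ forall x, U x -> forall (r : R) v v' w,
        g x (r *: v + v') w = r * g x v w + g x v' w,
      forall x, U x -> forall v w, g x v w = g x w v,
      forall x, U x -> forall v, v != 0 -> 0 < g x v v &
      forall a, atlas C a -> forall v w,
        smooth (ccod a `&` cinv a @^-1` U) (fun u => comp g a u v w)].

Definition preserves_metric (U : set M) g (f : M -> M) : Prop :=
  forall x, U x -> forall v w,
    g (f x) (mdiff C C f x v) (mdiff C C f x w) = g x v w.

End Metric.

Definition horizontal (M N : topologicalType) (E F : normedModType R)
    (C : charted M E) (C' : charted N F) (g : tensor M E) (f : M -> N)
    (x : M) (v : E) : Prop :=
  forall k, mdiff C C' f x k = 0 -> g x v k = 0.

(* f : (D, g) -> (S, g'|_S) is a Riemannian submersion, where S is a submanifold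
   of N with tangent spaces TS y (all of N when S and TS y are full). *)
Definition riemannian_submersion_onto (M N : topologicalType)
    (E F : normedModType R) (C : charted M E) (C' : charted N F)
    (D : set M) (g : tensor M E) (f : M -> N)
    (S : set N) (TS : N -> set F) (g' : tensor N F) : Prop :=
  [/\ smooth_map C C' D f, f @` D = S,
      forall x, D x -> range (mdiff C C' f x) = TS (f x) &
      forall x, D x -> forall v w,
        horizontal C C' g f x v -> horizontal C C' g f x w ->
        g' (f x) (mdiff C C' f x v) (mdiff C C' f x w) = g x v w].

Definition riemannian_submersion (M N : topologicalType)
    (E F : normedModType R) (C : charted M E) (C' : charted N F)
    (D : set M) (g : tensor M E) (f : M -> N) (g' : tensor N F) : Prop :=
  riemannian_submersion_onto C C' D g f setT (fun=> setT) g'.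

Section LeviCivita.
Variables (n : nat) (M : topologicalType) (C : charted M 'rV[R]_n).
Implicit Types (a : chart M 'rV[R]_n) (g : tensor M 'rV[R]_n).

Definition ebase (i : 'I_n) : 'rV[R]_n := delta_mx 0 i.

Definition gij g a (i j : 'I_n) (u : 'rV[R]_n) : R :=
  comp C g a u (ebase i) (ebase j).

(* \sum_(i, j) Gamma^k_(ij) v_i w_j, as a row vector indexed by k. *)
Definition christoffel g a (u v w : 'rV[R]_n) : 'rV[R]_n :=
  \row_k \sum_(m < n) \sum_(i < n) \sum_(j < n)
    2^-1 * invmx (\matrix_(r, s) gij g a r s u) k m
    * ('D_(ebase i) (gij g a j m) u + 'D_(ebase j) (gij g a i m) u
       - 'D_(ebase m) (gij g a i j) u)
    * v 0 i * w 0 j.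

(* The components in the chart a of the covariant derivative of Y along X. *)
Definition nabla g a (X Y : 'rV[R]_n -> 'rV[R]_n) (u : 'rV[R]_n) : 'rV[R]_n :=
  'D_(X u) Y u + christoffel g a u (X u) (Y u).

Definition geodesic g (c : R -> M) : Prop :=
  continuous c /\
  forall a, atlas C a -> let u := cmap a \o c in
    smooth (c @^-1` cdom a) u /\
    forall t, cdom a (c t) ->
      derive1 (derive1 u) t
        + christoffel g a (u t) (derive1 u t) (derive1 u t) = 0.

(* Geodesic completeness. *)
Definition complete_metric g : Prop :=
  forall (x : M) (v : 'rV[R]_n), exists c : R -> M,
    [/\ geodesic g c, c 0 = x & derive1 (cmap (chart_at C x) \o c) 0 = v].

(* Vanishing of the second fundamental form (nabla_X Y)^perp of the submanifold
   S of (U, g) with tangent spaces TS x; X and Y are the components in a chart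
   of local vector fields of U whose restrictions to S are tangent to S. *)
Definition totally_geodesic (U : set M) g (S : set M)
    (TS : M -> set 'rV[R]_n) : Prop :=
  forall a, atlas C a ->
  forall W : set 'rV[R]_n, open W -> W `<=` ccod a `&` cinv a @^-1` U ->
  forall X Y : 'rV[R]_n -> 'rV[R]_n, smooth W X -> smooth W Y ->
    (forall u, W u -> S (cinv a u) -> TS (cinv a u) (push C a u (X u))) ->
    (forall u, W u -> S (cinv a u) -> TS (cinv a u) (push C a u (Y u))) ->
  forall u, W u -> S (cinv a u) -> TS (cinv a u) (push C a u (nabla g a X Y u)).

Fixpoint pderive (s : seq 'I_n) (f : 'rV[R]_n -> R) : 'rV[R]_n -> R :=
  if s is i :: s' then fun u => 'D_(ebase i) (pderive s' f) u else f.

(* Uniform convergence on U of all partial derivatives up to order p of the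
   components. Compact subsets of the chart domains are used, as the coordinates
   of a chart may degenerate at the boundary of its domain; when the closure of
   U is compact, finitely many pairs (a, K) cover it, and the condition on such
   a finite atlas implies the condition on all pairs. *)
Definition Cp_converges (p : nat) (U : set M) (gl : R -> tensor M 'rV[R]_n) g :
    Prop :=
  forall a (K : set M), atlas C a -> compact K -> K `<=` cdom a ->
  forall (i j : 'I_n) (s : seq 'I_n), (size s <= p)%N ->
  forall e : R, 0 < e -> \forall l \near 0^'+, forall x, K x -> U x ->
    `|pderive s (gij (gl l) a i j) (cmap a x)
      - pderive s (gij g a i j) (cmap a x)| < e.

End LeviCivita.

Section LieGroup.
Variables (d : nat) (G : topGroupType) (CG : charted G 'rV[R]_d).
Local Open Scope group_scope.

Definition lie_group : Prop :=
  [/\ smooth_manifold CG,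
      smooth_map (prod_charted CG CG) CG setT (fun z : G * G => z.1 * z.2) &
      smooth_map CG CG setT (fun h : G => h^-1)].

Definition bi_invariant_metric (b : tensor G 'rV[R]_d) : Prop :=
  [/\ riemannian_metric CG setT b,
      forall h : G, preserves_metric CG setT b (fun p => h * p) &
      forall h : G, preserves_metric CG setT b (fun p => p * h)].

Definition closed_subgroup (H : set G) : Prop :=
  [/\ closed H, H 1, forall h k, H h -> H k -> H (h * k) &
      forall h, H h -> H h^-1].

End LieGroup.

Section Action.
Variables (d n : nat) (G : topGroupType) (M : topologicalType).
Variables (CG : charted G 'rV[R]_d) (CM : charted M 'rV[R]_n).
Variable act : G -> M -> M.

Definition smooth_action : Prop :=
  [/\ smooth_map (prod_charted CG CM) CM setT (fun z : G * M => act z.1 z.2),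
      forall x, act 1%g x = x &
      forall h k x, act (h * k)%g x = act h (act k x)].

Definition invariant_metric (U : set M) (g : tensor M 'rV[R]_n) : Prop :=
  forall h, preserves_metric CM U g (act h).

Definition act_orbit (x : M) : set M := range (act^~ x).

(* T_x G(x); note act 1 x = x. *)
Definition orbit_tangent (x : M) : set 'rV[R]_n :=
  range (mdiff CG CM (act^~ x) 1%g).

(* G(x) is principal: all y near x satisfy G_x \subset G_(h y) = h G_y h^-1
   for some h. *)
Definition Mreg : set M :=
  [set x | \forall y \near x, exists h : G,
     forall k : G, act k x = x -> act k (act h y) = act h y].

Definition product_metric (l : R) (b : tensor G 'rV[R]_d)
    (g : tensor M 'rV[R]_n) : tensor (G * M)%type ('rV[R]_d * 'rV[R]_n)%type :=
  fun z v w => l ^+ 2 * b z.1 v.1 w.1 + g z.2 v.2 w.2.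

Definition cheeger_metric (l : R) (b : tensor G 'rV[R]_d)
    (g gl : tensor M 'rV[R]_n) : Prop :=
  riemannian_metric CM setT gl /\
  riemannian_submersion (prod_charted CG CM) CM setT (product_metric l b g)
    (fun z : G * M => act z.1 z.2) gl.

(* The g-orthogonal projection of v onto T_x G(x). *)
Definition orbit_proj (g : tensor M 'rV[R]_n) (x : M) (v : 'rV[R]_n) :
    'rV[R]_n :=
  xget 0 [set t | orbit_tangent x t /\
                  forall s, orbit_tangent x s -> g x (v - t) s = 0].

Definition rescaled_metric (l : R) (gl : tensor M 'rV[R]_n) :
    tensor M 'rV[R]_n :=
  fun x v w =>
    (l ^+ 2)^-1 * gl x (orbit_proj gl x v) (orbit_proj gl x w)
    + gl x (v - orbit_proj gl x v) (w - orbit_proj gl x w).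

(* The orbit G(x) with the metric induced by g is G-equivariantly isometric to
   a normal homogeneous space G/H. The isometry G/H -> G(x) is represented by
   its composite f with the quotient map G -> G/H: f is constant exactly on the
   cosets pH, and is a Riemannian submersion onto G(x) because G -> G/H is one
   and G/H -> G(x) is an isometry. *)
Definition normal_homogeneous_orbit (g : tensor M 'rV[R]_n) (x : M) : Prop :=
  exists (b : tensor G 'rV[R]_d) (H : set G) (f : G -> M),
  [/\ bi_invariant_metric CG b,
      closed_subgroup H,
      forall p p', f p = f p' <-> H (p^-1 * p')%g,
      forall h p, f (h * p)%g = act h (f p) &
      riemannian_submersion_onto CG CM setT b f (act_orbit x) orbit_tangent g].

(* pi : U -> B exhibits the smooth manifold B as the orbit space U/G. *)
Definition smooth_orbit_space (m : nat) (U : set M) (B : topologicalType)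
    (CB : charted B 'rV[R]_m) (pi : M -> B) : Prop :=
  [/\ smooth_manifold CB, smooth_map CM CB U pi, pi @` U = setT,
      forall x, U x -> range (mdiff CM CB pi x) = setT &
      forall x y, U x -> U y -> (pi x = pi y <-> act_orbit x = act_orbit y)].

End Action.

End Riemannian.

(* Main.v *)
Require Import Defs.
From HB Require Import structures.
From mathcomp Require Import all_boot all_order all_algebra.
From mathcomp Require Import all_classical all_reals all_analysis.
From mathcomp Require Import ring lra zify.
Import Order.TTheory GRing.Theory Num.Theory.
Import numFieldNormedType.Exports.
Local Open Scope classical_set_scope.
Local Open Scope ring_scope.
Set Implicit Arguments.
Unset Strict Implicit.
Unset Printing Implicit Defensive.

(** Let [K x : xi |-> X_xi(x)] be the infinitesimal action at [x], [B] the inner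
    product on the Lie algebra given by the bi-invariant metric, and let [T] be a
    basis of the orbit tangent space, with Gram matrix [S = T A T^t] for [A = g_M].
    With [V = (T A K^t) B^-1 (T A K^t)^t] the rescaled metric is
    [A T^t (l^2 S + V)^-1 T A] on the orbit directions and [A] on their
    complement: it is smooth in [l^2] up to [l = 0], which gives the C^p limit.
    Smoothness in [x] needs the orbit dimension to be locally constant on
    principal orbits: if [xi] vanishes at [x], the stabilizer of [x] contains a
    curve tangent to [xi] (limits of powers of group elements close to 1), and it
    fixes a point of every nearby orbit.
    At [l = 0] the metric satisfies [g(X_xi, X_eta) = B(xi, eta)] as soon as [xi] is
    orthogonal to the isotropy algebra at [x]: the orbit is normal homogeneous.
    In general [g(X_xi, X_xi) <= B(xi, xi)], so for such [xi] the function
    [g(X_xi, X_xi)] is maximal at [x], hence critical there; by the Killing equation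
    [nabla_(X_xi) X_xi = 0] at [x]. Polarizing, and since brackets of action fields
    are tangent to the orbits, the orbits are totally geodesic. *)

(** * Germs of smooth maps *)

(** Put [N = 1 + l^-2 A K^T B^-1 K]. The submersion property amounts to [N g_l = A]; hence [g_l]
    agrees with [g_M] on horizontal vectors, and on the frame [T] it is [l^2 S (l^2 S + V)^-1 S].
    The factor [l^-2] cancels exactly what degenerates, and [V] alone is invertible because the rows
    of [T] lie in the row space of [K]. The obstacle is the frame: the formula does not depend on
    the basis, so near a point it may be computed with action fields of constant Lie algebra
    elements, once the rank of [K] is constant there. For that, only the first order of
    one-parameter subgroups matters, so powers are controlled by strict differentiability and no
    differential equation is solved. Preferred charts jump from point to point; whatever has to be
    differentiated is rewritten in one fixed chart, and since charts are total maps, the analysis is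
    done on germs. For total geodesy, a field [Y] is tangent only along one orbit and orthogonality
    to the isotropy holds at one point; there [Y] is compared with the action field of a constant
    [eta]. *)

Section Germs.
Context {R : realType}.
Implicit Types (V W : normedModType R) (k : nat).

(** Identities between chart expressions hold only near a point, charts being arbitrary outside
    their domains; this transfers differentials along such identities. *)
Lemma near_eq_diff V W (f g : V -> W) (x : V) :
  {near x, f =1 g} -> differentiable f x ->
  differentiable g x /\ 'd g x = 'd f x :> (V -> W).
Proof.
move=> fg df; have fgx : f x = g x by exact: (nbhs_singleton fg).
have E : g \o shift x = cst (g x) + 'd f x +o_ 0 id.
  rewrite -fgx; apply/eqaddoP => _/posnumP[e].
  have /eqaddoP/(_ e%:num (gt0 e)) := diff_locally df.
  apply: filter_app; near=> h => /=; rewrite !fctE /=.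
  have -> // : f (h + x) = g (h + x).
  near: h; have := fg; rewrite (near_shift 0 x)/= subr0 => H.
  by apply: filterS H => h.
have D : 'd g x = 'd f x :> (V -> W).
  by apply: diff_unique E; exact: diff_continuous.
split => //; apply/diff_locallyP; rewrite D; split=> //.
exact: diff_continuous.
Unshelve. all: by end_near. Qed.

(* Unlike [Ck], a property of the germ of [f] at [x]. *)
Fixpoint ck k V W (f : V -> W) (x : V) : Prop :=
  if k is k'.+1 then
    (\forall y \near x, differentiable f y) /\
    forall v, ck k' (fun y => 'd f y v) x
  else {for x, continuous f}.

Definition sm V W (f : V -> W) (x : V) : Prop := forall k, ck k f x.

Lemma ck_open k V W (D : set V) (f : V -> W) x :
  open D -> D x -> Ck k D f -> ck k f x.
Proof.
move=> oD Dx; elim: k f => [|k IH] f /=; first by move=> /(_ x Dx).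
move=> [df cf]; split; last by move=> v; apply: IH.
by near=> y; apply: df; near: y; exact: open_nbhs_nbhs.
Unshelve. all: by end_near. Qed.

Lemma ck_Ck k V W (D : set V) (f : V -> W) :
  (forall x, D x -> ck k f x) -> Ck k D f.
Proof.
elim: k f => [|k IH] f H /=; first by [].
split; first by move=> x /H [/nbhs_singleton].
by move=> v; apply: IH => x /H [_ cf]; exact: cf.
Qed.

Lemma smooth_sm V W (D : set V) (f : V -> W) x :
  open D -> D x -> smooth D f -> sm f x.
Proof. by move=> oD Dx sf k; apply: ck_open (sf k). Qed.

Lemma sm_smooth V W (D : set V) (f : V -> W) :
  (forall x, D x -> sm f x) -> smooth D f.
Proof. by move=> H k; apply: ck_Ck => x /H. Qed.

Lemma ck_eq k V W (f g : V -> W) x :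
  {near x, f =1 g} -> ck k f x -> ck k g x.
Proof.
elim: k f g => [|k IH] f g fg /=.
  rewrite /prop_for /continuous_at => cf.
  rewrite -(nbhs_singleton fg); apply: cvg_trans cf.
  exact: near_eq_cvg.
move=> [df cf]; have ffg := near_join fg.
split.
  near=> y; have [||dg _ //] := @near_eq_diff _ _ f g y; by near: y.
move=> v; apply: IH (cf v); near=> y.
have [_ ->//] : differentiable g y /\ 'd g y = 'd f y :> (V -> W).
by apply: near_eq_diff; near: y.
Unshelve. all: by end_near. Qed.

Lemma sm_eq V W (f g : V -> W) x : {near x, f =1 g} -> sm f x -> sm g x.
Proof. by move=> fg sf k; apply: ck_eq (sf k). Qed.

Lemma ck_continuous k V W (f : V -> W) x : ck k f x -> {for x, continuous f}.
Proof.
by case: k => [//|k [/nbhs_singleton df _]]; exact: differentiable_continuous.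
Qed.

Lemma ck_differentiable k V W (f : V -> W) x : ck k.+1 f x -> differentiable f x.
Proof. by move=> [/nbhs_singleton]. Qed.

Lemma ck_pred k V W (f : V -> W) x : ck k.+1 f x -> ck k f x.
Proof.
elim: k f => [|k IH] f; first exact: (@ck_continuous 1).
by move=> [df cf]; split => // v; apply: IH.
Qed.

Lemma sm_continuous V W (f : V -> W) x : sm f x -> {for x, continuous f}.
Proof. by move=> /(_ 0%N). Qed.

Lemma sm_differentiable V W (f : V -> W) x : sm f x -> differentiable f x.
Proof. by move=> /(_ 1%N)/ck_differentiable. Qed.

Lemma sm_near_differentiable V W (f : V -> W) x :
  sm f x -> \forall y \near x, differentiable f y.
Proof. by move=> /(_ 1%N)[]. Qed.

Lemma sm_diff V W (f : V -> W) v x : sm f x -> sm (fun y => 'd f y v) x.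
Proof. by move=> sf k; have [_ cf] := sf k.+1; exact: cf. Qed.

Lemma ck_cst k V W (w : W) x : ck k (fun _ : V => w) x.
Proof.
elim: k w => [|k IH] w; first exact: cvg_cst.
split; first by near=> y; exact: differentiable_cst.
move=> v; rewrite (_ : (fun y => _) = (fun _ => 0)) //.
by apply/funext => y; rewrite diff_cst.
Unshelve. all: by end_near. Qed.

Lemma ck_lin k V W (f : {linear V -> W}) x : continuous f -> ck k f x.
Proof.
move=> cf; case: k => [|k]; first exact: cf.
split; first by near=> y; exact: linear_differentiable.
move=> v; rewrite (_ : (fun y => _) = (fun _ => f v)); first exact: ck_cst.
by apply/funext => y; rewrite diff_lin.
Unshelve. all: by end_near. Qed.

Lemma sm_lin V W (f : V -> W) x : linear f -> continuous f -> sm f x.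
Proof.
move=> lf cf k; pose fL : {linear V -> W} :=
  HB.pack f (GRing.isLinear.Build _ _ _ _ _ lf).
by apply: (@ck_lin _ _ _ fL).
Qed.

Lemma ckD k V W (f g : V -> W) x :
  ck k f x -> ck k g x -> ck k (fun y => f y + g y) x.
Proof.
elim: k f g => [|k IH] f g /=; first by move=> cf cg; apply: cvgD.
move=> [df cf] [dg cg]; split.
  by near=> y; apply: differentiableD; near: y.
move=> v; apply: ck_eq (IH _ _ (cf v) (cg v)).
by near=> y; rewrite (@diffD _ _ _ f g)//; near: y.
Unshelve. all: by end_near. Qed.

Lemma ckN k V W (f : V -> W) x : ck k f x -> ck k (fun y => - f y) x.
Proof.
elim: k f => [|k IH] f /=; first by move=> cf; apply: cvgN.
move=> [df cf]; split.
  by near=> y; apply: differentiableN; near: y.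
move=> v; apply: ck_eq (IH _ (cf v)).
by near=> y; rewrite (@diffN _ _ _ f)//; near: y.
Unshelve. all: by end_near. Qed.

Lemma ckM k V (f g : V -> R) x :
  ck k f x -> ck k g x -> ck k (fun y => f y * g y) x.
Proof.
elim: k f g => [|k IH] f g; first by move=> cf cg; apply: cvgM.
move=> /[dup] /ck_pred cf' [df cf] /[dup] /ck_pred cg' [dg cg]; split.
  by near=> y; apply: differentiableM; near: y.
move=> v; apply: ck_eq (ckD (IH _ _ cf' (cg v)) (IH _ _ cg' (cf v))).
by near=> y; rewrite (@diffM _ _ f g)//; near: y.
Unshelve. all: by end_near. Qed.

Lemma ckZ k V W (f : V -> R) (w : W) x : ck k f x -> ck k (fun y => f y *: w) x.
Proof.
elim: k f => [|k IH] f; first by move=> cf; apply: cvgZr_tmp.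
move=> [df cf]; split.
  by near=> y; apply: differentiableZl; near: y.
move=> v; apply: ck_eq (IH _ (cf v)).
by near=> y; rewrite diffZl//; near: y.
Unshelve. all: by end_near. Qed.

Lemma ckV k V (f : V -> R) x :
  f x != 0 -> ck k f x -> ck k (fun y => (f y)^-1) x.
Proof.
move=> fx0; elim: k f fx0 => [|k IH] f fx0; first by move=> cf; apply: cvgV.
move=> /[dup] cf [df dcf].
have fN0 : \forall y \near x, f y != 0.
  by have /cvgr_neq0 := ck_continuous cf; apply.
split; first by near=> y; apply: differentiableV; near: y.
move=> v; have cV := IH _ fx0 (ck_pred cf).
apply: ck_eq (ckN (ckM (ckM cV cV) (dcf v))).
near=> y; rewrite diffV ?(near fN0)//; last by near: y.
by rewrite /= -mulNr -exprVn expr2.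
Unshelve. all: by end_near. Qed.

Lemma ck_sum k V W I (r : seq I) (P : pred I) (f : I -> V -> W) x :
  (forall i, P i -> ck k (f i) x) -> ck k (fun y => \sum_(i <- r | P i) f i y) x.
Proof.
move=> H; elim: r => [|i r IH].
  by rewrite (_ : (fun y => _) = fun=> 0); [exact: ck_cst|apply/funext => y; rewrite big_nil].
rewrite (_ : (fun y => _) =
  fun y => if P i then f i y + \sum_(i <- r | P i) f i y
           else \sum_(i <- r | P i) f i y).
  by case Pi: (P i) => //; apply: ckD => //; apply: H.
by apply/funext => y; rewrite big_cons.
Qed.

Lemma ck_prod k V I (r : seq I) (P : pred I) (f : I -> V -> R) x :
  (forall i, P i -> ck k (f i) x) ->
  ck k (fun y => \prod_(i <- r | P i) f i y) x.
Proof.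
move=> H; elim: r => [|i r IH].
  by rewrite (_ : (fun y => _) = fun=> 1); [exact: ck_cst|apply/funext => y; rewrite big_nil].
rewrite (_ : (fun y => _) =
  fun y => if P i then f i y * \prod_(i <- r | P i) f i y
           else \prod_(i <- r | P i) f i y).
  by case Pi: (P i) => //; apply: ckM => //; apply: H.
by apply/funext => y; rewrite big_cons.
Qed.

Lemma ck_pair k V W W' (f : V -> W) (g : V -> W') x :
  ck k f x -> ck k g x -> ck k (fun y => (f y, g y)) x.
Proof.
elim: k f g => [|k IH] f g; first by move=> cf cg; apply: (@cvg_pair _ _ _ (nbhs x)).
move=> [df cf] [dg cg]; split.
  by near=> y; apply: differentiable_pair; near: y.
move=> v; apply: ck_eq (IH _ _ (cf v) (cg v)).
by near=> y; rewrite diff_pair//; near: y.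
Unshelve. all: by end_near. Qed.

Lemma ck_mx k V m n (f : V -> 'M[R]_(m, n)) x :
  (forall i j, ck k (fun y => f y i j) x) -> ck k f x.
Proof.
move=> H; rewrite (_ : f = fun y => \sum_i \sum_j f y i j *: delta_mx i j).
  by apply: ck_sum => i _; apply: ck_sum => j _; apply: ckZ.
by apply/funext => y; rewrite -matrix_sum_delta.
Qed.

Definition fdim V := exists (N : nat) (e : 'I_N -> V) (c : 'I_N -> {linear V -> R}),
  (forall i, continuous (c i)) /\ forall v, v = \sum_i c i v *: e i.

Lemma ck_comp_lin k (U : normedModType R) V W (f : U -> V) (c : {linear V -> W}) x : continuous c ->
  ck k f x -> ck k (fun y => c (f y)) x.
Proof.
move=> cc; elim: k f => [|k IH] f fc.
  by apply: continuous_comp fc _; exact: cc.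
case: fc => df cf; split.
  near=> y; apply: (@differentiable_comp _ _ _ _ f c); first by near: y.
  exact: linear_differentiable.
move=> w; apply: ck_eq (IH _ (cf w)); near=> y.
rewrite (@diff_comp _ _ _ _ f c); first by rewrite /= diff_lin.
  by near: y.
exact: linear_differentiable.
Unshelve. all: by end_near. Qed.

(** The chain rule evaluates ['d g (f y)] at the direction ['d f y v], which moves with [y].
    Expanding it over the finite family leaves products of coefficients with differentials in
    constant directions, and these are covered by induction. *)
Lemma ck_compR k (U : normedModType R) V (f : U -> V) (g : V -> R) x : fdim V ->
  ck k f x -> ck k g (f x) -> ck k (fun y => g (f y)) x.
Proof.
move=> [N [e [c [cc ce]]]].
elim: k f g => [|k IH] f g; first by move=> cf cg; apply: continuous_comp cf cg.
move=> /[dup] cfS [df cf] [dg cg].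
have {}dg : \forall y \near x, differentiable g (f y).
  have cfx : f @ x --> f x by exact: ck_continuous cfS.
  by move: dg => /cfx.
split; first by near=> y; apply: differentiable_comp; near: y.
move=> v.
have cc' i : ck k (fun y => c i ('d f y v)) x.
  exact: (@ck_comp_lin k U V R (fun y => 'd f y v) (c i) x (cc i) (cf v)).
have H : ck k (fun y => \sum_i (c i ('d f y v) * 'd g (f y) (e i))) x.
  apply: ck_sum => i _; apply: ckM; first exact: cc'.
  by apply: IH (cg _); exact: ck_pred.
apply: ck_eq H; near=> y; rewrite (@diff_comp _ _ _ _ f g); [|by near: y..].
rewrite /= [in RHS](ce ('d f y v)) linear_sum; apply: eq_bigr => i _.
by rewrite linearZ.
Unshelve. all: by end_near. Qed.

Lemma sm_comp_lin (U : normedModType R) V W (f : U -> V) (c : V -> W) x : linear c -> continuous c ->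
  sm f x -> sm (fun y => c (f y)) x.
Proof.
move=> lf cc sf k; pose cL : {linear V -> W} :=
  HB.pack c (GRing.isLinear.Build _ _ _ _ _ lf).
by apply: (@ck_comp_lin _ _ _ _ _ cL).
Qed.

Lemma linear_coord m n i j : linear (fun M : 'M[R]_(m, n) => M i j).
Proof. by move=> a A B; rewrite !mxE. Qed.

Lemma sm_coord (U : normedModType R) m n (f : U -> 'M[R]_(m, n)) i j x :
  sm f x -> sm (fun y => f y i j) x.
Proof.
apply: (@sm_comp_lin _ _ _ f (fun M : 'M[R]_(m, n) => M i j)).
  exact: linear_coord.
exact: coord_continuous.
Qed.

Lemma sm_mx (U : normedModType R) m n (f : U -> 'M[R]_(m, n)) x :
  (forall i j, sm (fun y => f y i j) x) -> sm f x.
Proof. by move=> H k; apply: ck_mx => i j; exact: H. Qed.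

Lemma sm_compR (U : normedModType R) V (f : U -> V) (g : V -> R) x : fdim V ->
  sm f x -> sm g (f x) -> sm (fun y => g (f y)) x.
Proof. by move=> fV sf sg k; apply: ck_compR. Qed.

Lemma sm_comp (U : normedModType R) V m n (f : U -> V) (g : V -> 'M[R]_(m, n)) x : fdim V ->
  sm f x -> sm g (f x) -> sm (fun y => g (f y)) x.
Proof.
move=> fV sf sg; apply: sm_mx => i j.
exact: (@sm_compR _ _ f (fun z => g z i j)) (sm_coord _ _ sg).
Qed.

Lemma smD V W (f g : V -> W) x : sm f x -> sm g x -> sm (fun y => f y + g y) x.
Proof. by move=> sf sg k; apply: ckD. Qed.
Lemma smN V W (f : V -> W) x : sm f x -> sm (fun y => - f y) x.
Proof. by move=> sf k; apply: ckN. Qed.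
Lemma smB V W (f g : V -> W) x : sm f x -> sm g x -> sm (fun y => f y - g y) x.
Proof. by move=> sf sg; apply: smD => //; apply: smN. Qed.
Lemma smM V (f g : V -> R) x : sm f x -> sm g x -> sm (fun y => f y * g y) x.
Proof. by move=> sf sg k; apply: ckM. Qed.
Lemma smV V (f : V -> R) x : f x != 0 -> sm f x -> sm (fun y => (f y)^-1) x.
Proof. by move=> f0 sf k; apply: ckV. Qed.
Lemma sm_cst V W (w : W) x : sm (fun _ : V => w) x.
Proof. by move=> k; apply: ck_cst. Qed.
Lemma sm_sum V W I (r : seq I) (P : pred I) (f : I -> V -> W) x :
  (forall i, P i -> sm (f i) x) -> sm (fun y => \sum_(i <- r | P i) f i y) x.
Proof. by move=> H k; apply: ck_sum => i Pi; apply: H. Qed.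
Lemma sm_prod V I (r : seq I) (P : pred I) (f : I -> V -> R) x :
  (forall i, P i -> sm (f i) x) -> sm (fun y => \prod_(i <- r | P i) f i y) x.
Proof. by move=> H k; apply: ck_prod => i Pi; apply: H. Qed.
Lemma sm_pair V W W' (f : V -> W) (g : V -> W') x :
  sm f x -> sm g x -> sm (fun y => (f y, g y)) x.
Proof. by move=> sf sg k; apply: ck_pair. Qed.

Lemma sm_id V (x : V) : sm (fun y => y) x.
Proof. by apply: sm_lin => // y; exact: cvg_id. Qed.

Lemma sm_fst V W (x : V * W) : sm fst x.
Proof. by apply: sm_lin => // y; exact: cvg_fst. Qed.

Lemma sm_snd V W (x : V * W) : sm snd x.
Proof. by apply: sm_lin => // y; exact: cvg_snd. Qed.

Lemma smZ V m n (f : V -> R) (g : V -> 'M[R]_(m, n)) x :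
  sm f x -> sm g x -> sm (fun y => f y *: g y) x.
Proof.
move=> sf sg; apply: sm_mx => i j.
under eq_fun do rewrite mxE; apply: smM => //; exact: sm_coord.
Qed.

Lemma sm_mul V m n p (f : V -> 'M[R]_(m, n)) (g : V -> 'M[R]_(n, p)) x :
  sm f x -> sm g x -> sm (fun y => f y *m g y) x.
Proof.
move=> sf sg; apply: sm_mx => i j; under eq_fun do rewrite mxE.
by apply: sm_sum => l _; apply: smM; exact: sm_coord.
Qed.

Lemma sm_tr V m n (f : V -> 'M[R]_(m, n)) x : sm f x -> sm (fun y => (f y)^T) x.
Proof.
by move=> sf; apply: sm_mx => i j; under eq_fun do rewrite mxE; exact: sm_coord.
Qed.

Lemma sm_det V n (f : V -> 'M[R]_n) x : sm f x -> sm (fun y => \det (f y)) x.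
Proof.
move=> sf; rewrite /determinant; apply: sm_sum => s _; apply: smM.
  exact: sm_cst.
by apply: sm_prod => i _; exact: sm_coord.
Qed.

(** Cramer's formula, valid near [x] because the determinant stays nonzero; the adjugate is
    polynomial in the entries. *)
Lemma sm_inv V n (f : V -> 'M[R]_n) x : f x \in unitmx ->
  sm f x -> sm (fun y => invmx (f y)) x.
Proof.
move=> ux sf; have dx : \det (f x) != 0 by rewrite -unitfE.
apply: (@sm_eq _ _ (fun y => (\det (f y))^-1 *: \adj (f y))).
  have : \forall y \near x, \det (f y) != 0.
    have := sm_continuous (sm_det sf); rewrite /prop_for /continuous_at => /cvgr_neq0.
    by apply.
  apply: filterS => y dy; rewrite /invmx unitmxE unitfE dy //.
apply: smZ; first by apply: smV => //; exact: sm_det.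
apply: sm_mx => i j; under eq_fun do rewrite mxE /cofactor.
apply: smM; first exact: sm_cst.
apply: sm_det; apply: sm_mx => a b; under eq_fun do rewrite !mxE.
exact: sm_coord.
Qed.

Lemma fdim_rV n : fdim 'rV[R]_n.
Proof.
pose c i : {linear 'rV[R]_n -> R} := HB.pack (fun v : 'rV[R]_n => v 0 i)
  (GRing.isLinear.Build _ _ _ _ (fun v : 'rV[R]_n => v 0 i) (linear_coord 0 i)).
exists n, (fun i => delta_mx 0 i), c; split.
  by move=> i; exact: coord_continuous.
by move=> v; exact: row_sum_delta.
Qed.

Lemma fdim_R : fdim R.
Proof.
exists 1%N, (fun=> 1), (fun=> idfun); split; first by move=> _ y; exact: cvg_id.
by move=> v; rewrite big_ord1 /= [_ *: _]mulr1.
Qed.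

Lemma fdim_prod V W : fdim V -> fdim W -> fdim (V * W)%type.
Proof.
move=> [N [e [c [cc ce]]]] [N' [e' [c' [cc' ce']]]].
pose E (i : 'I_(N + N')) : V * W :=
  match fintype.split i with inl j => (e j, 0) | inr j => (0, e' j) end.
pose C0 (i : 'I_(N + N')) (v : V * W) :=
  match fintype.split i with inl j => c j v.1 | inr j => c' j v.2 end.
have lC i : linear (C0 i).
  by move=> a u v; rewrite /C0; case: fintype.split => j; rewrite linearP.
pose C i : {linear (V * W)%type -> R} := HB.pack (C0 i)
  (GRing.isLinear.Build _ _ _ _ (C0 i) (lC i)).
exists (N + N')%N, E, C; split.
  move=> i v; rewrite /= /C0; case: (fintype.split i) => j.
    apply: (@continuous_comp _ _ _ fst (c j)); first exact: cvg_fst.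
    exact: cc.
  apply: (@continuous_comp _ _ _ snd (c' j)); first exact: cvg_snd.
  exact: cc'.
move=> [v w]; rewrite big_split_ord /= /C0 /E.
under eq_bigr do rewrite (unsplitK (inl _)).
under [X in _ + X]eq_bigr do rewrite (unsplitK (inr _)).
have sum_pair I (r : seq I) (F : I -> V * W) :
    \sum_(i <- r) F i = (\sum_(i <- r) (F i).1, \sum_(i <- r) (F i).2).
  by elim/big_rec3: _ => // i y1 y2 y3 _ ->; rewrite /=.
rewrite !sum_pair /=.
congr pair; rewrite /=.
  by rewrite [X in _ + X]big1 ?addr0// => i _; rewrite scaler0.
by rewrite [X in X + _]big1 ?add0r// => i _; rewrite scaler0.
Qed.

End Germs.
#[global] Hint Resolve fdim_rV fdim_R fdim_prod : core.

(** * Schwarz's theorem and local sections *)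

Section MeanValue.
Context {R : realType}.
Implicit Types (V W : normedModType R).

Lemma is_derive_line V W (f : V -> W) (y v : V) (t : R) :
  differentiable f (y + t *: v) ->
  is_derive t 1 (fun s : R => f (y + s *: v)) ('d f (y + t *: v) v).
Proof.
move=> df.
have dl : is_diff t (fun s : R => y + s *: v) (fun s => s *: v).
  have -> : (fun s : R => s *: v) = (0 : R -> V) + ( *:%R^~ v).
    by apply/funext => s /=; rewrite fctE add0r.
  by apply: is_diffD.
have dfl : differentiable f ((fun s : R => y + s *: v) t) by exact: df.
have dc : differentiable (fun s : R => f (y + s *: v)) t.
  by apply: (@differentiable_comp _ _ _ _ (fun s : R => y + s *: v) f).
split; first exact: diff_derivable.
rewrite deriveE// (@diff_comp _ _ _ _ (fun s : R => y + s *: v) f)//.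
by rewrite /= diff_val scale1r.
Qed.

Lemma continuous_line V W (f : V -> W) (y v : V) (t : R) :
  differentiable f (y + t *: v) ->
  {for t, continuous (fun s : R => f (y + s *: v))}.
Proof.
by move=> /is_derive_line[/derivable1_diffP/differentiable_continuous].
Qed.

Lemma mvt_line V (f : V -> R) (y v : V) (s : R) : 0 < s ->
  (forall t, 0 <= t <= s -> differentiable f (y + t *: v)) ->
  exists2 t, 0 < t < s & f (y + s *: v) - f y = s * 'd f (y + t *: v) v.
Proof.
move=> s0 df; pose g t := f (y + t *: v).
have [||t] := @MVT _ g (fun t => 'd f (y + t *: v) v) 0 s s0.
- move=> t; rewrite in_itv /= => /andP[t0 ts].
  by apply: is_derive_line; apply: df; rewrite (ltW t0) (ltW ts).
- apply: continuous_in_subspaceT => t; rewrite inE /= in_itv /= => ts.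
  by apply: continuous_line; exact: df.
rewrite in_itv /= subr0 => ts E; exists t => //.
by move: E; rewrite /g scale0r addr0 mulrC.
Qed.

Lemma line_ball V (x a b : V) (d t : R) : 0 <= t <= 1 ->
  ball x d a -> ball x d b -> ball x d (b + t *: (a - b)).
Proof.
move=> /andP[t0 t1]; rewrite -!ball_normE /= => xa xb.
have -> : x - (b + t *: (a - b)) = t *: (x - a) + (1 - t) *: (x - b).
  rewrite scalerBl scale1r [RHS]addrCA -scalerBr.
  have -> : x - a - (x - b) = - (a - b) by rewrite !opprB addrC addrA subrK.
  by rewrite scalerN opprD addrA.
apply: le_lt_trans (ler_normD _ _) _; rewrite !normrZ (ger0_norm t0).
rewrite ger0_norm ?subr_ge0//.
have [->|tN0] := eqVneq t 0; first by rewrite mul0r add0r subr0 mul1r.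
have tp : 0 < t by rewrite lt_neqAle eq_sym tN0.
have : t * `|x - a| < t * d by rewrite ltr_pM2l.
have : (1 - t) * `|x - b| <= (1 - t) * d.
  by apply: ler_wpM2l; [rewrite subr_ge0|exact: ltW].
move: (_ * `|x - a|) (_ * `|x - b|) => p q; lra.
Qed.

(** Two applications of the mean value theorem, to [t |-> f (x + s w + t v) - f (x + t v)] and then
    to ['d f _ v] along [w]; continuity of the second differential replaces the intermediate point
    by [x]. *)
Lemma second_difference V (f : V -> R) (x v w : V) : ck 2 f x ->
  forall e : R, 0 < e -> \forall s \near 0^'+,
    `|f (x + s *: w + s *: v) - f (x + s *: v) - f (x + s *: w) + f x
       - s ^+ 2 * 'd (fun y => 'd f y v) x w| <= s ^+ 2 * e.
Proof.
move=> [df cf] e e0; have [dfv cfv] := cf v.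
have {}cfv : {for x, continuous (fun y => 'd (fun z => 'd f z v) y w)} by exact: cfv.
have near1 : \forall y \near x, differentiable f y /\
    (differentiable (fun z => 'd f z v) y /\
     `|'d (fun z => 'd f z v) x w - 'd (fun z => 'd f z v) y w| < e).
  near=> y; split; first by near: y.
  split; first by near: y.
  by near: y; move/cvgrPdist_lt: cfv => /(_ _ e0).
have /nbhs_ballP[d /= d0 H] := near1.
pose M := 1 + `|v| + `|w|; have M0 : 0 < M by rewrite /M; have := normr_ge0 v; have := normr_ge0 w; lra.
have inb (t u s : R) : 0 < s -> s < d / M -> 0 <= t <= s -> 0 <= u <= s ->
    ball x d (x + u *: w + t *: v).
  move=> s0 sd /andP[t0 ts] /andP[u0 us]; rewrite -ball_normE /=.
  rewrite -addrA opprD addrA subrr add0r normrN.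
  apply: le_lt_trans (ler_normD _ _) _; rewrite !normrZ !ger0_norm//.
  move: sd; rewrite ltr_pdivlMr// /M.
  have : u * `|w| <= s * `|w| by apply: ler_wpM2r.
  have : t * `|v| <= s * `|v| by apply: ler_wpM2r.
  move: (u * _) (t * _) => p q; nra.
near=> s.
have s0 : 0 < s by near: s; exact: nbhs_right_gt.
have sd : s < d / M by near: s; apply: nbhs_right_lt; rewrite divr_gt0.
have s0s : 0 <= s <= s by rewrite (ltW s0) lexx.
have z0s : 0 <= (0 : R) <= s by rewrite lexx (ltW s0).
pose g (t : R) := f (x + s *: w + t *: v) - f (x + t *: v).
have [t /andP[t0 ts]] : exists2 t, 0 < t < s & g s - g 0 =
    s * ('d f (x + s *: w + t *: v) v - 'd f (x + t *: v) v).
  have D1 t : 0 <= t <= s -> differentiable f (x + s *: w + t *: v).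
    by move=> ts; have [] := H _ (inb t s s s0 sd ts s0s).
  have D2 t : 0 <= t <= s -> differentiable f (x + t *: v).
    move=> ts; have := inb t 0 s s0 sd ts z0s.
    by rewrite scale0r addr0 => /H[].
  have [||t] := @MVT _ g (fun t => 'd f (x + s *: w + t *: v) v - 'd f (x + t *: v) v) 0 s s0.
  - move=> t; rewrite in_itv /= => /andP[t0 ts].
    have ts' : 0 <= t <= s by rewrite (ltW t0) (ltW ts).
    by apply: is_deriveB; apply: is_derive_line; [exact: D1|exact: D2].
  - apply: continuous_in_subspaceT => t; rewrite inE /= in_itv /= => ts.
    by apply: cvgB; apply: continuous_line; [exact: D1|exact: D2].
  by rewrite in_itv /= subr0 => ts E; exists t => //; rewrite E mulrC.
have ts' : 0 <= t <= s by rewrite (ltW t0) (ltW ts).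
have [|u /andP[u0 us] Eu] := @mvt_line _ (fun z => 'd f z v) (x + t *: v) w s s0.
  move=> u us; have := inb t u s s0 sd ts' us.
  by rewrite addrAC => /H[_ []].
rewrite [x + s *: w + t *: v]addrAC Eu /g !scale0r !addr0 => E.
have us' : 0 <= u <= s by rewrite (ltW u0) (ltW us).
have [_ [_]] := H _ (inb t u s s0 sd ts' us').
rewrite addrAC; set a := 'd _ x w; set b := 'd _ _ w in Eu *; move=> ab.
have -> : f (x + s *: w + s *: v) - f (x + s *: v) - f (x + s *: w) + f x
  - s ^+ 2 * a = s ^+ 2 * (b - a).
  by move: E; rewrite opprB expr2 -/b => E; rewrite mulrBr -!mulrA -E; ring.
rewrite normrM ger0_norm ?sqr_ge0// ler_wpM2l ?sqr_ge0//.
by rewrite distrC ltW.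
Unshelve. all: by end_near. Qed.

(** Exchanging [v] and [w] leaves the second difference unchanged, and both mixed derivatives are
    its limit after division by [s ^+ 2]. *)
Lemma diff_sym V (f : V -> R) (x v w : V) : ck 2 f x ->
  'd (fun y => 'd f y v) x w = 'd (fun y => 'd f y w) x v.
Proof.
move=> cf; apply/eqP; rewrite -subr_eq0 -normr_le0; apply/ler_addgt0Pr => e e0.
rewrite add0r; have e20 : 0 < e / 2 by rewrite divr_gt0.
near (0 : R)^'+ => s.
have s0 : 0 < s by near: s; exact: nbhs_right_gt.
have A : `|f (x + s *: w + s *: v) - f (x + s *: v) - f (x + s *: w) + f x
       - s ^+ 2 * 'd (fun y => 'd f y v) x w| <= s ^+ 2 * (e / 2).
  by near: s; exact: second_difference.
have B : `|f (x + s *: v + s *: w) - f (x + s *: w) - f (x + s *: v) + f x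
       - s ^+ 2 * 'd (fun y => 'd f y w) x v| <= s ^+ 2 * (e / 2).
  by near: s; exact: second_difference.
rewrite -(ler_pM2l (exprn_gt0 2 s0)) -[X in X * `|_|](ger0_norm (sqr_ge0 s)) -normrM.
rewrite [x + s *: v + s *: w]addrAC in B; rewrite mulrBr.
rewrite [_ - f (x + s *: v) - _]addrAC in A.
set a := s ^+ 2 * 'd _ x w in A *; set b := s ^+ 2 * 'd _ x v in B *.
set P := _ + f x in A B.
have -> : a - b = (P - b) - (P - a) by ring.
apply: le_trans (ler_normB _ _) _.
have -> : s ^+ 2 * e = s ^+ 2 * (e / 2) + s ^+ 2 * (e / 2).
  by rewrite -mulrDr -splitr.
exact: lerD.
Unshelve. all: by end_near. Qed.

(** Strict differentiability: the mean value theorem on the segment gives ['d f y] at an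
    intermediate [y], close to ['d f x] on the finitely many directions [eb i]. Both endpoints move,
    as needed for Newton's iteration and for iterated products in a group. *)
Lemma ck1_strictR V (f : V -> R) (x : V) : fdim V -> ck 1 f x ->
  forall e : R, 0 < e -> \forall z \near (x, x),
    `|f z.1 - f z.2 - 'd f x (z.1 - z.2)| <= e * `|z.1 - z.2|.
Proof.
move=> [N [eb [c [cc ce]]]] [df cf] e e0.
have [k [k0 kc]] : exists k : R, 0 < k /\ forall i (h : V), `|c i h| <= k * `|h|.
  have /choice [K HK] : forall i, exists k : R, 0 < k /\ forall h, `|c i h| <= k * `|h|.
    by move=> i; have [k k0 kP] := linear_lipschitz (cc i); exists k.
  exists (1 + \sum_i K i); split.
    by apply: ltr_pwDl => //; apply: sumr_ge0 => i _; have [/ltW] := HK i.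
  move=> i h; have [_ /(_ h) /le_trans] := HK i; apply; apply: ler_wpM2r => //.
  rewrite (bigD1 i)//= addrCA lerDl addr_ge0// sumr_ge0// => j _.
  by have [/ltW] := HK j.
(* Each of the [N] directions contributes at most [k * |a - b| * eta]; [N.+1] keeps the denominator
   nonzero for [N = 0]. *)
pose eta := e / (k * N.+1%:R).
have eta0 : 0 < eta by rewrite divr_gt0// mulr_gt0.
have near1 : \forall y \near x, differentiable f y /\
    forall i, `|'d f x (eb i) - 'd f y (eb i)| <= eta.
  near=> y; split; first by near: y.
  near: y; apply: filter_forall => i.
  have /cvgrPdist_le : {for x, continuous (fun y => 'd f y (eb i))} by exact: cf.
  exact.
have /nbhs_ballP[d /= d0 H] := near1.
have bd : nbhs x (ball x d) by exact: nbhsx_ballx.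
exists (ball x d, ball x d) => //= -[a b] /= [xa xb].
have [|t /andP[t0 t1]] := @mvt_line _ f b (a - b) 1 ltr01.
  by move=> t t1; have [] := H _ (line_ball t1 xa xb).
have -> : b + 1 *: (a - b) = a by rewrite scale1r addrC subrK.
rewrite mul1r; set y := b + t *: (a - b) => ->.
have t1' : 0 <= t <= 1 by rewrite (ltW t0) (ltW t1).
have [_ Ht] := H _ (line_ball t1' xa xb).
rewrite -/y in Ht.
have lin (L : {linear V -> R}) h : L h = \sum_i c i h * L (eb i).
  by rewrite {1}(ce h) linear_sum; apply: eq_bigr => i _; rewrite linearZ.
rewrite (lin ('d f y)) (lin ('d f x)) -sumrB.
apply: le_trans (ler_norm_sum _ _ _) _.
apply: (@le_trans _ _ (\sum_(i < N) k * `|a - b| * eta)).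
  apply: ler_sum => i _; rewrite -mulrBr normrM.
  by apply: ler_pM => //; rewrite distrC.
rewrite sumr_const card_ord -mulr_natr /eta.
have key (M : R) : 0 < M ->
    k * `|a - b| * (e / (k * M)) * N%:R = e * `|a - b| * (N%:R / M).
  by move=> M0; field; rewrite !gt_eqF.
rewrite key; last by rewrite ltr0n.
by rewrite ler_piMr ?mulr_ge0 ?(ltW e0)// ler_pdivrMr// mul1r ler_nat.
Unshelve. all: by end_near. Qed.

Lemma mx_norm_le m n (A : 'M[R]_(m, n)) (e : R) : 0 <= e ->
  (forall i j, `|A i j| <= e) -> `|A| <= e.
Proof.
move=> e0 H; rewrite [leLHS]/Num.Def.normr/= mx_normrE.
by apply: bigmax_le => // -[i j] _; exact: H.
Qed.

Lemma diff_coord V m n (f : V -> 'M[R]_(m, n)) x v i j : differentiable f x ->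
  'd (fun y => f y i j) x v = ('d f x v) i j.
Proof.
move=> df; pose c : {linear 'M[R]_(m, n) -> R} := HB.pack (fun M : 'M[R]_(m, n) => M i j)
  (GRing.isLinear.Build _ _ _ _ (fun M : 'M[R]_(m, n) => M i j) (linear_coord i j)).
have cc : continuous c by exact: coord_continuous.
rewrite (@diff_comp _ _ _ _ f c)//; last exact: linear_differentiable.
exact: (congr1 (@^~ ('d f x v)) (diff_lin (f x) cc)).
Qed.

Lemma ck_coord k V m n (f : V -> 'M[R]_(m, n)) i j x : ck k f x -> ck k (fun y => f y i j) x.
Proof.
pose c : {linear 'M[R]_(m, n) -> R} := HB.pack (fun M : 'M[R]_(m, n) => M i j)
  (GRing.isLinear.Build _ _ _ _ (fun M : 'M[R]_(m, n) => M i j) (linear_coord i j)).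
by apply: (@ck_comp_lin _ _ _ _ _ _ c); exact: coord_continuous.
Qed.

Lemma ck1_strict V m n (f : V -> 'M[R]_(m, n)) (x : V) : fdim V -> ck 1 f x ->
  forall e : R, 0 < e -> \forall z \near (x, x),
    `|f z.1 - f z.2 - 'd f x (z.1 - z.2)| <= e * `|z.1 - z.2|.
Proof.
move=> fV cf e e0.
pose P (ij : 'I_m * 'I_n) (z : V * V) :=
  `|f z.1 ij.1 ij.2 - f z.2 ij.1 ij.2 -
    'd (fun y => f y ij.1 ij.2) x (z.1 - z.2)| <= e * `|z.1 - z.2|.
have H : nbhs (x, x) (fun z => forall ij, P ij z).
  apply: (@filter_forall _ _ P (nbhs (x, x))) => -[i j].
  by apply: (@ck1_strictR _ (fun y => f y i j)) => //; exact: ck_coord.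
apply: filterS H => z H; apply: mx_norm_le; first by rewrite mulr_ge0 ?(ltW e0).
move=> i j; have := H (i, j); rewrite /P /= diff_coord; last exact: ck_differentiable cf.
by rewrite !mxE.
Qed.

Lemma diff_eps V W (f : V -> W) (L : {linear V -> W}) x : continuous L ->
  (forall e : R, 0 < e -> \forall y \near x, `|f y - f x - L (y - x)| <= e * `|y - x|) ->
  differentiable f x /\ 'd f x = L :> (V -> W).
Proof.
move=> cL H.
have E : f \o shift x = cst (f x) + L +o_ 0 id.
  apply/eqaddoP => _/posnumP[e].
  have H' : \forall h \near (0 : V), `|f (h + x) - f x - L h| <= e%:num * `|h|.
    have e0 : 0 < e%:num by [].
    have := H _ e0; rewrite (near_shift 0 x) /= subr0.
    by apply: filterS => h /=; rewrite addrK.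
  apply: (@filterS _ (nbhs (0 : V))) H' => h /=.
  by rewrite !fctE opprD addrA.
have D : 'd f x = L :> (V -> W) by apply: diff_unique E.
by split => //; apply/diff_locallyP; rewrite D; split.
Qed.

Lemma linear_mulmxr m n p (B : 'M[R]_(n, p)) : linear (fun A : 'M[R]_(m, n) => A *m B).
Proof. by move=> a A A'; rewrite mulmxDl scalemxAl. Qed.

Lemma continuous_mulmxr m n p (B : 'M[R]_(n, p)) :
  continuous (fun A : 'M[R]_(m, n) => A *m B).
Proof.
move=> A; apply: (@sm_continuous _ _ _ (fun A : 'M[R]_(m, n) => A *m B)).
by apply: sm_mul; [exact: sm_id|exact: sm_cst].
Qed.

(** Instead of iterating, [|T v - v|] is minimized on the compact ball: at a minimizer [v], the
    point [T v] is displaced at most half as far, so the minimum is zero. *)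
Lemma contraction_fixed m (T : 'rV[R]_m -> 'rV[R]_m) (r : R) : 0 <= r ->
  (forall v, `|v| <= r -> `|T v| <= r) ->
  (forall v w, `|v| <= r -> `|w| <= r -> `|T v - T w| <= 2^-1 * `|v - w|) ->
  exists2 v, `|v| <= r & T v = v.
Proof.
move=> r0 Tr Tc; pose A := [set v : 'rV[R]_m | `|v| <= r].
have cA : compact A.
  apply: bounded_closed_compact.
    by exists r; split; [exact: num_real|move=> M rM v /= /le_trans; apply; exact: ltW].
  apply: (@closed_comp _ _ (fun v : 'rV[R]_m => `|v|) [set x | x <= r]).
    by move=> v _; exact: norm_continuous.
  exact: closed_le.
have A0 : A !=set0 by exists 0; rewrite /A /= normr0.
have cT : {within A, continuous (fun v => `|T v - v|)}.
  apply/subspace_continuousP => v Av; apply/cvgrPdist_le => e e0.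
  rewrite near_withinE; near=> w => Aw.
  have vw : `|v - w| <= e / 2.
    by near: w; apply: cvgr_dist_le; [exact: cvg_id|rewrite divr_gt0].
  apply: le_trans (ler_dist_dist _ _) _.
  have -> : T v - v - (T w - w) = (T v - T w) - (v - w).
    by rewrite !opprB addrACA [in RHS]addrACA; congr (_ + _); rewrite addrC.
  apply: le_trans (ler_normB _ _) _.
  have := Tc _ _ Av Aw; have := normr_ge0 (v - w); lra.
have [v Av vmin] := EVT_min_rV A0 cA cT.
rewrite inE in Av; exists v => //; apply/eqP; rewrite -subr_eq0 -normr_le0.
have := vmin (T v); rewrite inE => /(_ (Tr _ Av)).
have := Tc _ _ (Tr _ Av) Av.
have := normr_ge0 (T v - v); lra.
Unshelve. all: by end_near. Qed.

(* Newton's iteration [v |-> y - y0 - phi v] with [phi v = pi (x0 + v R0) - pi x0 - v]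
   gives the section; it is only claimed to be differentiable at the base point. *)
Lemma local_section n m (pi : 'rV[R]_n -> 'rV[R]_m) (x0 : 'rV[R]_n) (R0 : 'M[R]_(m, n)) :
  ck 1 pi x0 -> (forall w, 'd pi x0 (w *m R0) = w) ->
  exists s : 'rV[R]_m -> 'rV[R]_n,
    [/\ s (pi x0) = x0, \forall y \near pi x0, pi (s y) = y,
        differentiable s (pi x0) & forall w, 'd s (pi x0) w = w *m R0].
Proof.
move=> cpi dR0; set y0 := pi x0.
pose phi (v : 'rV[R]_m) := pi (x0 + v *m R0) - y0 - v.
have phi0 : phi 0 = 0 by rewrite /phi mul0mx addr0 subrr subr0.
(* [R0] is a right inverse of the differential, so [phi] has zero differential at 0 and, by strict
   differentiability, an arbitrarily small Lipschitz constant near 0. *)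
have sphi (e : R) : 0 < e -> exists2 r : R, 0 < r & forall v w, `|v| <= r -> `|w| <= r ->
    `|phi v - phi w| <= e * `|v - w|.
  move=> e0.
  have [k k0 kP] : exists2 k : R, 0 < k & forall v : 'rV[R]_m, `|v *m R0| <= k * `|v|.
    pose L : {linear 'rV[R]_m -> 'rV[R]_n} := HB.pack (fun A : 'rV[R]_m => A *m R0)
      (GRing.isLinear.Build _ _ _ _ (fun A : 'rV[R]_m => A *m R0) (linear_mulmxr R0)).
    by have [k k0 kP] := @linear_lipschitz _ _ _ L (@continuous_mulmxr _ _ _ R0); exists k.
  have /nbhs_ballP[d /= d0 H] := ck1_strict (fdim_rV n) cpi (divr_gt0 e0 k0).
  exists (d / (2 * k)); first by rewrite divr_gt0// mulr_gt0.
  have inb (v : 'rV[R]_m) : `|v| <= d / (2 * k) -> ball x0 d (x0 + v *m R0).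
    move=> vd; rewrite -ball_normE /= opprD addrA subrr add0r normrN.
    apply: le_lt_trans (kP _) _.
    apply: le_lt_trans (ler_wpM2l (ltW k0) vd) _.
    have -> : k * (d / (2 * k)) = d / 2 by field; rewrite gt_eqF.
    lra.
  move=> v w vd wd.
  have := H (x0 + v *m R0, x0 + w *m R0) (conj (inb _ vd) (inb _ wd)).
  rewrite /= opprD addrACA subrr add0r -mulmxBl dR0 => Hvw.
  have -> : phi v - phi w = pi (x0 + v *m R0) - pi (x0 + w *m R0) - (v - w).
    rewrite /phi; move: (pi _) (pi _) => a b.
    by apply/rowP => i; rewrite !mxE; ring.
  apply: le_trans Hvw _.
  have -> : e * `|v - w| = e / k * (k * `|v - w|) by field; rewrite gt_eqF.
  by apply: ler_wpM2l => //; rewrite ltW// divr_gt0.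
have h2 : 0 < 2^-1 :> R by rewrite invr_gt0.
have [r r0 Hr] := sphi 2^-1 h2.
have ex y : `|y - y0| <= r / 2 -> exists2 v, `|v| <= r & y - y0 - phi v = v.
  move=> yr; apply: (@contraction_fixed _ (fun v => y - y0 - phi v) r (ltW r0)).
    move=> v vr; apply: le_trans (ler_normB _ _) _.
    have := Hr v 0 vr; rewrite normr0 phi0 !subr0 => /(_ (ltW r0)); lra.
  move=> v w vr wr; have -> : y - y0 - phi v - (y - y0 - phi w) = - (phi v - phi w).
    by move: (phi v) (phi w) => a b; apply/rowP => i; rewrite !mxE; ring.
  by rewrite normrN; exact: Hr.
have ex' y : exists v, `|y - y0| <= r / 2 -> `|v| <= r /\ y - y0 - phi v = v.
  have [/ex[v vr vE]|/negP yr] := boolP (`|y - y0| <= r / 2); first by exists v.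
  by exists 0.
have /choice[psi Hpsi] := ex'.
have near0 (e : R) : 0 < e -> \forall y \near y0, `|y - y0| <= e.
  move=> e0; apply: filterS (@nbhsx_ballx _ _ y0 _ e0) => y.
  by rewrite -ball_normE /= distrC => /ltW.
have r20 : 0 < r / 2 by rewrite divr_gt0.
(* With Lipschitz constant 1/2 the fixed point equation gives
   [|psi y| <= |y - y0| + |psi y| / 2]. *)
have psi_le y : `|y - y0| <= r / 2 -> `|psi y| <= 2 * `|y - y0|.
  move=> yr; have [pr E] := Hpsi _ yr.
  have := Hr _ 0 pr; rewrite normr0 phi0 !subr0 => /(_ (ltW r0)) H.
  have : `|psi y| <= `|y - y0| + `|phi (psi y)| by rewrite -{1}E ler_normB.
  lra.
have psi0 : psi y0 = 0.
  apply/eqP; rewrite -normr_le0; have := psi_le y0; rewrite subrr normr0 mulr0.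
  by apply; exact: ltW.
pose L : {linear 'rV[R]_m -> 'rV[R]_n} := HB.pack (fun A : 'rV[R]_m => A *m R0)
  (GRing.isLinear.Build _ _ _ _ (fun A : 'rV[R]_m => A *m R0) (linear_mulmxr R0)).
have cL : continuous L by exact: (@continuous_mulmxr _ _ _ R0).
have [k k0 kP] := linear_lipschitz cL.
pose s y := x0 + psi y *m R0.
have [ds dsE] : differentiable s y0 /\ 'd s y0 = L :> (_ -> _).
  apply: diff_eps => // e e0.
  (* The [2] comes from [psi_le], and [k] bounds the norm of [R0]. *)
  have ek : 0 < e / (2 * k) by rewrite divr_gt0// mulr_gt0.
  have [d d0 Hd] := sphi _ ek.
  have d20 : 0 < d / 2 by rewrite divr_gt0.
  near=> y.
  have yr : `|y - y0| <= r / 2 by near: y; exact: near0.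
  have yd : `|y - y0| <= d / 2 by near: y; exact: near0.
  have [pr E] := Hpsi _ yr; have pl := psi_le _ yr.
  have pd : `|psi y| <= d by lra.
  have -> : s y - s y0 - L (y - y0) = - L (phi (psi y)).
    rewrite /s psi0 mul0mx addr0.
    have -> : x0 + psi y *m R0 - x0 = psi y *m R0 by rewrite addrAC subrr add0r.
    rewrite -[psi y in LHS]E /= -mulmxBl -mulNmx; congr (_ *m _).
    by rewrite addrAC subrr add0r.
  rewrite normrN; apply: le_trans (kP _) _.
  have := Hd _ 0 pd; rewrite normr0 phi0 !subr0 => /(_ (ltW d0)) H.
  have : k * `|phi (psi y)| <= k * (e / (2 * k) * (2 * `|y - y0|)).
    apply: ler_wpM2l; first exact: ltW.
    by apply: le_trans H _; apply: ler_wpM2l => //; exact: ltW.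
  by have -> : k * (e / (2 * k) * (2 * `|y - y0|)) = e * `|y - y0| by field; rewrite gt_eqF.
exists s; split => //.
- by rewrite /s psi0 mul0mx addr0.
- near=> y; have yr : `|y - y0| <= r / 2 by near: y; exact: near0.
  have [pr E] := Hpsi _ yr; move: E; rewrite /phi /s => /eqP.
  rewrite -subr_eq0; set a := pi _; have -> : y - y0 - (a - y0 - psi y) - psi y = y - a.
    by apply/rowP => i; rewrite !mxE; ring.
  by rewrite subr_eq0 => /eqP.
- by move=> w; rewrite dsE.
Unshelve. all: by end_near. Qed.
End MeanValue.

(** * Linear algebra of the deformation *)

Section LinearAlgebra.
Context {R : realFieldType}.

Definition bform n (A : 'M[R]_n) (v w : 'rV[R]_n) : R := (v *m A *m w^T) 0 0.

Definition spd n (A : 'M[R]_n) :=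
  A^T = A /\ forall v : 'rV[R]_n, v != 0 -> 0 < bform A v v.

Lemma bformDl n (A : 'M[R]_n) u v w : bform A (u + v) w = bform A u w + bform A v w.
Proof. by rewrite /bform !mulmxDl mxE. Qed.

Lemma bformDr n (A : 'M[R]_n) u v w : bform A w (u + v) = bform A w u + bform A w v.
Proof. by rewrite /bform linearD mulmxDr mxE. Qed.

Lemma bformZl n (A : 'M[R]_n) a v w : bform A (a *: v) w = a * bform A v w.
Proof. by rewrite /bform -!scalemxAl mxE. Qed.

Lemma bformNl n (A : 'M[R]_n) v w : bform A (- v) w = - bform A v w.
Proof. by rewrite /bform !mulNmx mxE. Qed.

Lemma bformBl n (A : 'M[R]_n) u v w : bform A (u - v) w = bform A u w - bform A v w.
Proof. by rewrite bformDl bformNl. Qed.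

Lemma bform_mul m n (A : 'M[R]_n) (C : 'M[R]_(m, n)) v w :
  bform A (v *m C) (w *m C) = bform (C *m A *m C^T) v w.
Proof. by rewrite /bform trmx_mul !mulmxA. Qed.

Lemma bform_delta n (A : 'M[R]_n) i j : bform A (delta_mx 0 i) (delta_mx 0 j) = A i j.
Proof. by rewrite /bform -rowE trmx_delta -colE !mxE. Qed.

Lemma bform_inj n (A B : 'M[R]_n) : (forall v w, bform A v w = bform B v w) -> A = B.
Proof. by move=> H; apply/matrixP => i j; rewrite -!bform_delta. Qed.

Lemma bformC n (A : 'M[R]_n) v w : A^T = A -> bform A v w = bform A w v.
Proof.
move=> sA; have E : v *m A *m w^T = (w *m A *m v^T)^T.
  by rewrite !trmx_mul trmxK sA mulmxA.
by rewrite /bform E mxE.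
Qed.

Lemma bform_sum n (A : 'M[R]_n) v w : bform A v w = \sum_i \sum_j v 0 i * A i j * w 0 j.
Proof.
rewrite /bform mxE exchange_big /=; apply: eq_bigr => j _.
by rewrite !mxE big_distrl.
Qed.

Lemma spd_ge0 n (A : 'M[R]_n) v : spd A -> 0 <= bform A v v.
Proof.
move=> [_ H]; have [->|/H/ltW//] := eqVneq v 0.
by rewrite /bform !mul0mx mxE.
Qed.

Lemma spd_eq0 n (A : 'M[R]_n) v : spd A -> bform A v v = 0 -> v = 0.
Proof. by move=> [_ H] E; apply/eqP/negP => /negP /H; rewrite E ltxx. Qed.

Lemma row_free_ker0 m n (A : 'M[R]_(m, n)) :
  (forall v : 'rV[R]_m, v *m A = 0 -> v = 0) -> row_free A.
Proof.
move=> H; rewrite -kermx_eq0; apply/eqP/row_matrixP => i.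
by rewrite row0; apply: H; rewrite -row_mul mulmx_ker row0.
Qed.

Lemma row_free_inj0 m n (A : 'M[R]_(m, n)) (v : 'rV[R]_m) :
  row_free A -> v *m A = 0 -> v = 0.
Proof. by move=> /row_freeP[B AB] vA; rewrite -[v]mulmx1 -AB mulmxA vA mul0mx. Qed.

Lemma spd_unit n (A : 'M[R]_n) : spd A -> A \in unitmx.
Proof.
move=> sA; rewrite -row_free_unit; apply: row_free_ker0 => v vA.
by apply: spd_eq0 sA _; rewrite /bform vA mul0mx mxE.
Qed.

Lemma trmx_invS n (A : 'M[R]_n) : A^T = A -> (invmx A)^T = invmx A.
Proof. by rewrite trmx_inv => ->. Qed.

Lemma spd_gram m n (A : 'M[R]_n) (T : 'M[R]_(m, n)) :
  spd A -> row_free T -> spd (T *m A *m T^T).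
Proof.
move=> sA fT; split; first by rewrite !trmx_mul trmxK sA.1 mulmxA.
move=> v v0; rewrite -bform_mul; apply: sA.2; apply: contraNneq v0 => vT.
by rewrite (row_free_inj0 fT vT).
Qed.

Lemma spd_inv n (A : 'M[R]_n) : spd A -> spd (invmx A).
Proof.
move=> sA; have uA := spd_unit sA.
have -> : invmx A = invmx A *m A *m (invmx A)^T.
  by rewrite mulVmx// mul1mx trmx_invS// sA.1.
by apply: spd_gram => //; rewrite row_free_unit unitmx_inv.
Qed.

(** The inverse of a form transforms contragrediently; the independence of bases and charts below
    rests on this. *)
Lemma inv_gram n (D X : 'M[R]_n) : D \in unitmx -> X \in unitmx ->
  D^T *m invmx (D *m X *m D^T) *m D = invmx X.
Proof.
move=> uD uX; apply: (can_inj (mulKmx uX)); rewrite mulmxV//.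
apply: (can_inj (mulKmx uD)); rewrite !mulmxA mulmxV ?mul1mx ?mulmx1//.
by rewrite !unitmx_mul unitmx_tr uD uX.
Qed.

Lemma spdDZ n (s : R) (A B : 'M[R]_n) : 0 <= s -> spd A -> spd B -> spd (s *: A + B).
Proof.
move=> s0 sA sB; split; first by rewrite linearD linearZ /= sA.1 sB.1.
move=> v v0; rewrite /bform mulmxDr mulmxDl mxE -scalemxAr -scalemxAl mxE.
by apply: ltr_wpDl (sB.2 _ v0); apply: mulr_ge0 => //; exact: spd_ge0.
Qed.

Section Deformation.
Variables (n d : nat) (A : 'M[R]_n) (B : 'M[R]_d) (K : 'M[R]_(d, n)).

Definition gramT r (T : 'M[R]_(r, n)) := T *m A *m T^T.
(** Row [i] is the covector [xi |-> A(t_i, xi K)] on the Lie algebra, the adjoint of the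
    infinitesimal action applied to [t_i]. [vertT] is the Gram matrix of these covectors for the
    inner product dual to [B]. *)
Definition liftT r (T : 'M[R]_(r, n)) := T *m A *m K^T.
Definition vertT r (T : 'M[R]_(r, n)) := liftT T *m invmx B *m (liftT T)^T.

(* With [A] the metric of M, [B] the bi-invariant metric on the Lie algebra, [K]
   the infinitesimal action and the rows of [T] a basis of the orbit tangent
   space, this is the matrix of the rescaled metric for [s = l^2]; at [s = 0] it is
   that of the limit metric. *)
Definition deformT (s : R) r (T : 'M[R]_(r, n)) : 'M[R]_n :=
  A *m T^T *m invmx (s *: gramT T + vertT T) *m T *m A + A
  - A *m T^T *m invmx (gramT T) *m T *m A.

(** [row_base K] is an arbitrary basis that need not vary continuously with [K]; [deformT_basis]
    allows any other basis. *)
Definition deform s := deformT s (row_base K).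

(** Acts on row vectors from the right, as the [A]-orthogonal projection onto the row space of [T]
    when the rows are independent. *)
Definition projT r (T : 'M[R]_(r, n)) := A *m T^T *m invmx (gramT T) *m T.

Hypotheses (sA : spd A) (sB : spd B).

Section Basis.
Variables (r : nat) (T : 'M[R]_(r, n)).
Hypotheses (fT : row_free T) (TK : (T :=: K)%MS).

Lemma spd_gramT : spd (gramT T). Proof. exact: spd_gram. Qed.

(** If [c] kills [liftT T], then [c *m T] is [A]-orthogonal to the row space of [K], to which it
    belongs. Thus [vertT] is definite by itself, and the deformation extends to [s = 0]. *)
Lemma liftT_free : row_free (liftT T).
Proof.
have /submxP[E TE] : (T <= K)%MS by rewrite TK.
apply: row_free_ker0 => c cL; apply: (spd_eq0 spd_gramT).
have -> : gramT T = liftT T *m E^T.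
  by rewrite /gramT /liftT -[RHS]mulmxA -trmx_mul -TE.
by rewrite /bform mulmxA cL !mul0mx mxE.
Qed.

Lemma spd_vertT : spd (vertT T).
Proof.
by rewrite /vertT; apply: spd_gram; [exact: spd_inv|exact: liftT_free].
Qed.

Lemma spd_sumT s : 0 <= s -> spd (s *: gramT T + vertT T).
Proof. by move=> s0; apply: spdDZ => //; [exact: spd_gramT|exact: spd_vertT]. Qed.

Lemma gramT_tr : (gramT T)^T = gramT T. Proof. exact: spd_gramT.1. Qed.

(** Coordinates of the action fields in the frame [T]: pair with [T], then divide by the Gram
    matrix. *)
Lemma action_factor : K = (liftT T)^T *m invmx (gramT T) *m T.
Proof.
have /submxP[C KC] : (K <= T)%MS by rewrite TK.
have -> : (liftT T)^T = C *m gramT T.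
  by rewrite /liftT /gramT !trmx_mul trmxK sA.1 mulmxA {1}KC !mulmxA.
by rewrite mulmxK// spd_unit//; exact: spd_gramT.
Qed.

Lemma deformT_tr s : 0 <= s -> (deformT s T)^T = deformT s T.
Proof.
move=> s0; rewrite /deformT linearB linearD /= !trmx_mul !trmxK sA.1.
rewrite (trmx_invS (spd_sumT s0).1) (trmx_invS gramT_tr).
by rewrite !mulmxA.
Qed.

Lemma projT_perp : (1%:M - projT T) *m A *m T^T = 0.
Proof.
have uS := spd_unit spd_gramT.
rewrite mulmxBl mul1mx mulmxBl /projT -!mulmxA (mulmxA T) -/(gramT T) mulVmx//.
by rewrite mulmx1 subrr.
Qed.

Lemma projT_perpK : (1%:M - projT T) *m A *m K^T = 0.
Proof.
have /submxP[C ->] : (K <= T)%MS by rewrite TK.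
by rewrite trmx_mul mulmxA projT_perp mul0mx.
Qed.

Lemma projT_sub (v : 'rV[R]_n) : (v *m projT T <= K)%MS.
Proof. by rewrite -TK /projT mulmxA submxMl. Qed.

Lemma horizontal_mx : (1%:M - projT T) *m A *m (1%:M - projT T)^T =
  A - A *m T^T *m invmx (gramT T) *m T *m A.
Proof.
rewrite linearB /= trmx1 mulmxBr mulmx1 [(projT T)^T]trmx_mul mulmxA projT_perp.
by rewrite mul0mx subr0 mulmxBl mul1mx.
Qed.

Lemma horizontal_part v :
  bform (A - A *m T^T *m invmx (gramT T) *m T *m A) v v =
  bform A (v - v *m projT T) (v - v *m projT T).
Proof.
have -> : v - v *m projT T = v *m (1%:M - projT T) by rewrite mulmxBr mulmx1.
by rewrite bform_mul horizontal_mx.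
Qed.

(** The form is a definite form in the pairing of [v] with [T], plus [A] on the horizontal part of
    [v]; if the pairing vanishes, [v] is its own horizontal part. *)
Lemma spd_deformT s : 0 <= s -> spd (deformT s T).
Proof.
move=> s0; split; first exact: deformT_tr.
move=> v v0.
have -> : bform (deformT s T) v v =
    bform (invmx (s *: gramT T + vertT T)) (v *m (A *m T^T)) (v *m (A *m T^T)) +
    bform A (v - v *m projT T) (v - v *m projT T).
  rewrite -horizontal_part bform_mul /deformT !trmx_mul trmxK sA.1.
  by rewrite /bform -addrA mulmxDr mulmxDl mxE !mulmxA.
have sI := spd_inv (spd_sumT s0).
have [c0|c0] := eqVneq (v *m (A *m T^T)) 0.
  rewrite /projT !mulmxA -(mulmxA v A) c0 !mul0mx subr0 /bform !mul0mx mxE add0r.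
  exact: sA.2.
by apply: ltr_wpDr; [exact: spd_ge0|exact: sI.2].
Qed.

End Basis.

(** Both bases have [\rank K] rows, so they differ by an invertible [D]; [gramT] and [vertT] change
    by congruence with [D], which [inv_gram] cancels. *)
Lemma deformT_basis s r (T : 'M[R]_(r, n)) : 0 <= s -> row_free T -> (T :=: K)%MS ->
  deform s = deformT s T.
Proof.
move=> s0 fT TK; have e : r = \rank K by rewrite -TK; apply/esym/eqP.
rewrite /deform; move: (row_base K) (row_base_free K) (eq_row_base K).
move: (\rank K) e => r' e; subst r' => T' fT' T'K.
have /submxP[D TD] : (T <= T')%MS by rewrite TK T'K.
have uD : D \in unitmx.
  rewrite -row_free_unit; apply: row_free_ker0 => c cD.
  by apply: (row_free_inj0 fT); rewrite TD mulmxA cD mul0mx.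
rewrite /deformT; have -> : gramT T = D *m gramT T' *m D^T.
  by rewrite /gramT TD trmx_mul !mulmxA.
have -> : vertT T = D *m vertT T' *m D^T.
  by rewrite /vertT /liftT TD !trmx_mul !mulmxA.
have -> : s *: (D *m gramT T' *m D^T) + D *m vertT T' *m D^T
   = D *m (s *: gramT T' + vertT T') *m D^T.
  by rewrite mulmxDr mulmxDl -scalemxAr -scalemxAl.
have key X : X \in unitmx ->
    A *m T^T *m invmx (D *m X *m D^T) *m T *m A = A *m T'^T *m invmx X *m T' *m A.
  by move=> uX; rewrite -(inv_gram uD uX) TD trmx_mul !mulmxA.
rewrite !key//; first exact: spd_unit (spd_gramT fT').
exact: spd_unit (spd_sumT fT' T'K s0).
Qed.

Lemma spd_deform s : 0 <= s -> spd (deform s).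
Proof.
by apply: spd_deformT; [exact: row_base_free|exact: eq_row_base].
Qed.

(** * The limit form on action fields *)

Section Limit.
Variables (r : nat) (T : 'M[R]_(r, n)).
Hypotheses (fT : row_free T) (TK : (T :=: K)%MS).

(** The [B]-orthogonal projection of [xi] to the complement of the kernel of [K], that is, of the
    isotropy algebra. *)
Definition horiz_lift (xi : 'rV[R]_d) := xi *m (liftT T)^T *m invmx (vertT T) *m liftT T *m invmx B.

Lemma horiz_lift_act xi : horiz_lift xi *m K = xi *m K.
Proof.
have uV : vertT T \in unitmx by apply: spd_unit; exact: spd_vertT.
have uS : gramT T \in unitmx by apply: spd_unit; exact: spd_gramT.
have LL : horiz_lift xi *m (liftT T)^T = xi *m (liftT T)^T.
  have VE : vertT T = liftT T *m invmx B *m (liftT T)^T by [].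
  rewrite /horiz_lift; move: (liftT T) (vertT T) VE uV => L V VE uV.
  by rewrite -!mulmxA (mulmxA L) -VE mulVmx// mulmx1.
have [Z KZ] : exists Z, K = (liftT T)^T *m Z.
  by exists (invmx (gramT T) *m T); rewrite mulmxA -(action_factor fT TK).
transitivity (horiz_lift xi *m ((liftT T)^T *m Z)); first by rewrite -KZ.
by rewrite mulmxA LL -mulmxA -KZ.
Qed.

(** Action fields have no horizontal part, and the remaining matrix [L^T V^-1 L], with
    [L = liftT T], is the Gram matrix of [horiz_lift] for [B]: the quotient of [B] by the isotropy
    algebra. *)
Lemma limit_form xi eta :
  bform (deformT 0 T) (xi *m K) (eta *m K) = bform B (horiz_lift xi) (horiz_lift eta).
Proof.
have uV : vertT T \in unitmx by apply: spd_unit; exact: spd_vertT.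
have uS : gramT T \in unitmx by apply: spd_unit; exact: spd_gramT.
have uB : B \in unitmx by exact: spd_unit.
rewrite bform_mul /deformT scale0r add0r -addrA mulmxDr mulmxDl.
have -> : K *m (A - A *m T^T *m invmx (gramT T) *m T *m A) *m K^T = 0.
  rewrite -mulmxA -[A - _](_ : (1%:M - projT T) *m A = _).
    by rewrite (projT_perpK fT TK) mulmx0.
  by rewrite mulmxBl mul1mx.
rewrite addr0.
have -> : K *m (A *m T^T *m invmx (vertT T) *m T *m A) *m K^T =
    (liftT T)^T *m invmx (vertT T) *m liftT T.
  by rewrite /liftT !trmx_mul trmxK sA.1 !mulmxA.
have VE : vertT T = liftT T *m invmx B *m (liftT T)^T by [].
have VT : (vertT T)^T = vertT T by case: (spd_vertT fT TK).
rewrite /horiz_lift; move: (liftT T) (vertT T) VE uV VT => L V VE uV VT.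
have -> : xi *m L^T *m invmx V *m L *m invmx B = xi *m (L^T *m invmx V *m L *m invmx B).
  by rewrite !mulmxA.
have -> : eta *m L^T *m invmx V *m L *m invmx B = eta *m (L^T *m invmx V *m L *m invmx B).
  by rewrite !mulmxA.
rewrite bform_mul mulmxKV//; congr bform.
rewrite !trmx_mul trmxK (trmx_invS sB.1) (trmx_invS VT).
rewrite -!mulmxA; congr (_ *m (_ *m _)).
by rewrite (mulmxA L) (mulmxA (L *m _)) -VE mulmxA mulmxV// mul1mx.
Qed.

Lemma horiz_lift_perp xi zeta : zeta *m K = 0 -> bform B (horiz_lift xi) zeta = 0.
Proof.
move=> zK; have uB : B \in unitmx by exact: spd_unit.
have LZ : liftT T *m zeta^T = 0.
  by rewrite /liftT -mulmxA -trmx_mul zK trmx0 mulmx0.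
by rewrite /bform /horiz_lift mulmxKV// -mulmxA LZ mulmx0 mxE.
Qed.

Lemma horiz_lift_id xi : (forall zeta, zeta *m K = 0 -> bform B xi zeta = 0) ->
  horiz_lift xi = xi.
Proof.
move=> H; apply/eqP; rewrite eq_sym -subr_eq0; apply/eqP.
have zK : (xi - horiz_lift xi) *m K = 0.
  by rewrite mulmxBl horiz_lift_act subrr.
apply: (spd_eq0 sB); rewrite bformBl H// horiz_lift_perp//.
by rewrite subrr.
Qed.

(** Pythagoras: an orthogonal projection does not increase length. *)
Lemma limit_form_le xi :
  bform (deformT 0 T) (xi *m K) (xi *m K) <= bform B xi xi.
Proof.
rewrite limit_form; set h := horiz_lift xi.
have zK : (xi - h) *m K = 0 by rewrite mulmxBl horiz_lift_act subrr.
have hz : bform B h (xi - h) = 0 by exact: horiz_lift_perp.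
have zh : bform B (xi - h) h = 0 by rewrite (bformC _ _ sB.1).
have -> : bform B xi xi = bform B (xi - h + h) (xi - h + h) by rewrite subrK.
rewrite (bformDl B (xi - h) h) !(bformDr B (xi - h) h) hz zh addr0 add0r addrC.
by rewrite lerDl spd_ge0.
Qed.

End Limit.

(** * The Cheeger metric in matrix form *)

Section Cheeger.
Variables (r : nat) (T : 'M[R]_(r, n)) (s : R) (N Gl : 'M[R]_n).
Hypotheses (fT : row_free T) (TK : (T :=: K)%MS) (s0 : 0 < s).
Hypotheses (NE : N = 1%:M + s^-1 *: (A *m K^T *m invmx B *m K))
  (GlT : Gl^T = Gl) (NGl : N *m Gl *m N^T = N *m A).

(** [N *m A] is [A] plus a nonnegative multiple of the Gram matrix of [A K^T] for [invmx B], hence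
    definite. *)
Lemma cheeger_unit : N \in unitmx.
Proof.
rewrite -row_free_unit; apply: row_free_ker0 => c cN.
apply: (spd_eq0 sA); apply/eqP; rewrite eq_le spd_ge0// andbT.
have : bform (N *m A) c c = 0 by rewrite /bform mulmxA cN !mul0mx mxE.
rewrite NE mulmxDl mul1mx /bform mulmxDr mulmxDl mxE => /eqP.
rewrite addr_eq0 => /eqP E; rewrite -/(bform A c c) in E *.
rewrite {}E oppr_le0 -scalemxAl -scalemxAr -scalemxAl mxE.
apply: mulr_ge0; first by rewrite invr_ge0 ltW.
have -> : c *m (A *m K^T *m invmx B *m K *m A) *m c^T =
    (c *m (A *m K^T)) *m invmx B *m (c *m (A *m K^T))^T.
  by rewrite !trmx_mul trmxK sA.1 !mulmxA.
by apply: spd_ge0; exact: spd_inv.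
Qed.

(** Cancel [N] on the left in [NGl] and transpose: the deformed metric is [N^-1 A]. *)
Lemma cheeger_mulN : N *m Gl = A.
Proof.
have E : Gl *m N^T = A.
  by apply: (can_inj (mulKmx cheeger_unit)); rewrite mulmxA.
by rewrite -[LHS]trmxK trmx_mul GlT E sA.1.
Qed.

Let P := projT T.

(** [N] is the identity on the orthogonal complement of the orbit, so the deformation changes
    neither the metric there nor the complement itself. *)
Lemma cheeger_perp : (1%:M - P) *m Gl = (1%:M - P) *m A.
Proof.
have PN : (1%:M - P) *m N = 1%:M - P.
  rewrite NE mulmxDr mulmx1 -scalemxAr !mulmxA (projT_perpK fT TK).
  by rewrite !mul0mx scaler0 addr0.
by rewrite -[X in _ = _ *m X]cheeger_mulN mulmxA PN.
Qed.

(** [N] sends the frame [T] to [s^-1 (s S + V) S^-1 T]; solving [N Gl = A] on the frame leaves the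
    factor [s] that the rescaling divides out. *)
Lemma cheeger_vert : T *m Gl *m T^T = s *: (gramT T *m invmx (s *: gramT T + vertT T) *m gramT T).
Proof.
have uS : gramT T \in unitmx by apply: spd_unit; exact: spd_gramT.
have uSV : s *: gramT T + vertT T \in unitmx by apply: spd_unit; apply: spd_sumT => //; exact: ltW.
have sN0 : s != 0 by rewrite gt_eqF.
have VK : vertT T *m invmx (gramT T) *m T = liftT T *m invmx B *m K.
  have KE := action_factor fT TK.
  transitivity (liftT T *m invmx B *m ((liftT T)^T *m invmx (gramT T) *m T)).
    by rewrite /vertT !mulmxA.
  by rewrite -KE.
have TN : T *m N = s^-1 *: ((s *: gramT T + vertT T) *m invmx (gramT T) *m T).
  rewrite NE mulmxDr mulmx1 -scalemxAr !mulmxDl -!scalemxAl VK mulmxV// mul1mx.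
  by rewrite scalerDr scalerA mulVf// scale1r /liftT !mulmxA.
have E : gramT T = s^-1 *: ((s *: gramT T + vertT T) *m invmx (gramT T) *m (T *m Gl *m T^T)).
  transitivity (T *m N *m Gl *m T^T); first by rewrite /gramT -[in LHS]cheeger_mulN mulmxA.
  by rewrite TN -!scalemxAl !mulmxA.
have {}E := congr1 ( *:%R s) E; rewrite scalerA mulfV// scale1r in E.
clear TN VK; move: (s *: gramT T + vertT T) uSV E => X uX E.
rewrite scalemxAr E; clear E; move: uS.
move: (gramT T) (T *m Gl *m T^T) => S Y uS.
by rewrite !mulmxA mulmxKV// mulmxV// mul1mx.
Qed.

Lemma cheeger_deform :
  s^-1 *: (P *m Gl *m P^T) + (1%:M - P) *m Gl *m (1%:M - P)^T = deformT s T.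
Proof.
have uS : gramT T \in unitmx by apply: spd_unit; exact: spd_gramT.
have sN0 : s != 0 by rewrite gt_eqF.
rewrite cheeger_perp (horizontal_mx fT) /deformT -addrA; congr (_ + _).
have -> : P *m Gl *m P^T = A *m T^T *m invmx (gramT T) *m (T *m Gl *m T^T) *m
    (A *m T^T *m invmx (gramT T))^T.
  by rewrite /P /projT [(_ *m T)^T]trmx_mul !mulmxA.
rewrite cheeger_vert -scalemxAr -scalemxAl scalerA mulVf// scale1r.
have ST := gramT_tr fT; move: (s *: gramT T + vertT T) => X.
move: (gramT T) uS ST => S uS ST.
by rewrite !trmx_mul trmxK sA.1 (trmx_invS ST) !mulmxA mulmxKV// mulmxK.
Qed.

Lemma cheeger_perpK : (1%:M - P) *m Gl *m K^T = 0.
Proof. by rewrite cheeger_perp (projT_perpK fT TK). Qed.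

End Cheeger.
End Deformation.

(* Naturality: change of charts ([C = 1]) and isometries of the action. *)
Lemma deform_cov n n' d (A : 'M[R]_n) (A' : 'M[R]_n') (B : 'M[R]_d) (K : 'M[R]_(d, n))
    (K' : 'M[R]_(d, n')) (J : 'M[R]_(n, n')) (C : 'M[R]_d) (s : R) :
  0 <= s -> spd A -> spd A' -> spd B -> A = J *m A' *m J^T -> K' = C *m K *m J ->
  C *m B *m C^T = B -> J *m deform A' B K' s *m J^T = deform A B K s.
Proof.
move=> s0 sA sA' sB AE KE CB.
have uB := spd_unit sB.
have uC : C \in unitmx.
  rewrite -row_free_unit; apply/row_freeP; exists (B *m C^T *m invmx B).
  by rewrite !mulmxA CB mulmxV.
have CBV : C^T *m invmx B *m C = invmx B by rewrite -{1}CB inv_gram.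
pose T := row_base K *m J.
have gE : gramT A' T = gramT A (row_base K).
  by rewrite /gramT /T trmx_mul !mulmxA AE !mulmxA.
have fT : row_free T.
  apply: row_free_ker0 => c cT; apply: (row_free_inj0 (row_base_free K)).
  apply: (spd_eq0 sA); rewrite bform_mul -/(gramT A _) -gE /bform /gramT.
  by rewrite -(mulmxA T) (mulmxA c) cT !mul0mx mxE.
have TK : (T :=: K')%MS.
  rewrite KE; apply: eqmx_trans (eqmxMr J (eq_row_base K)) _.
  by apply: eqmxMr; apply: eqmx_sym; apply: eqmxMfull; rewrite row_full_unit.
rewrite (deformT_basis sA' sB s0 fT TK) /deform /deformT gE.
have lE : liftT A' K' T = liftT A K (row_base K) *m C^T.
  by rewrite /liftT /T KE !trmx_mul !mulmxA AE !mulmxA.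
have -> : vertT A' B K' T = vertT A B K (row_base K).
  rewrite /vertT lE; move: (liftT A K (row_base K)) => L.
  by rewrite trmx_mul trmxK -[in RHS]CBV !mulmxA.
rewrite mulmxBr mulmxDr mulmxBl mulmxDl -AE.
have key X : J *m (A' *m T^T *m X *m T *m A') *m J^T = A *m (row_base K)^T *m X *m row_base K *m A.
  by rewrite /T trmx_mul AE !mulmxA.
by rewrite !key.
Qed.
End LinearAlgebra.

(** * Differentials of maps between manifolds *)

Section Charts.
Context {R : realType} (M : topologicalType) (E : normedModType R).
Implicit Types (a : chart M E) (D : set M).

Lemma cinv_nbhs a D u : ccod a u -> nbhs (cinv a u) D ->
  \forall v \near u, ccod a v /\ D (cinv a v).
Proof.
move=> au nD; near=> v; split; near: v.
  by apply: open_nbhs_nbhs; split => //; exact: ccod_open.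
exact: (cinv_continuous au).
Unshelve. all: by end_near. Qed.

Lemma open_preim a D : open D -> open (ccod a `&` cinv a @^-1` D).
Proof.
move=> oD; rewrite openE => u [au Du]; rewrite /interior.
by apply: cinv_nbhs => //; apply: open_nbhs_nbhs.
Qed.

Lemma cdom_nbhs a x : cdom a x -> \forall y \near x, cdom a y.
Proof. by move=> ax; apply: open_nbhs_nbhs; split => //; exact: cdom_open. Qed.

Lemma ccod_nbhs a u : ccod a u -> \forall v \near u, ccod a v.
Proof. by move=> ax; apply: open_nbhs_nbhs; split => //; exact: ccod_open. Qed.

Lemma cmap_nbhs a (P : set E) x : cdom a x -> nbhs (cmap a x) P ->
  \forall y \near x, cdom a y /\ P (cmap a y).
Proof.
move=> ax nP; near=> y; split; near: y; first exact: cdom_nbhs.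
exact: (cmap_continuous ax).
Unshelve. all: by end_near. Qed.

End Charts.

Section SmoothAt.
Context {R : realType}.

(** Smoothness as a property of the germ at one point, in all charts of the atlas around it; no
    domains have to be carried through compositions. *)
Definition smat (M N : topologicalType) (E F : normedModType R)
    (C : charted M E) (C' : charted N F) (f : M -> N) (x : M) : Prop :=
  {for x, continuous f} /\
  forall a b, atlas C a -> atlas C' b -> cdom a x -> cdom b (f x) ->
    sm (cmap b \o f \o cinv a) (cmap a x).

Lemma smat_map (M N : topologicalType) (E F : normedModType R)
    (C : charted M E) (C' : charted N F) (D : set M) (f : M -> N) (x : M) :
  open D -> D x -> smooth_map C C' D f -> smat C C' f x.
Proof.
move=> oD Dx [cf sf]; split; first exact: cf.
move=> a b aa ab ax bfx; have := sf a b aa ab.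
apply: smooth_sm.
  apply: open_preim; rewrite openE => y [Dy bfy]; rewrite /interior.
  near=> z; split; near: z; first exact: open_nbhs_nbhs.
  by apply: (cf y Dy); exact: cdom_nbhs.
split; first exact: cmap_ccod.
by rewrite /= cmapK.
Unshelve. all: by end_near. Qed.

Variables (M : topologicalType) (E : normedModType R) (C : charted M E).
Hypothesis (hM : smooth_manifold C).

Lemma sm_trans a b x : atlas C a -> atlas C b -> cdom a x -> cdom b x ->
  sm (cmap b \o cinv a) (cmap a x).
Proof.
move=> aa ab ax bx; have [_ _ H] := hM.
apply: smooth_sm (H a b aa ab); first by apply: open_preim; exact: cdom_open.
by split; [exact: cmap_ccod|rewrite /= cmapK].
Qed.

Lemma diff_chart_source (N : topologicalType) (F : normedModType R)
    (C' : charted N F) f x a a' b v :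
  smat C C' f x -> atlas C a -> atlas C a' -> atlas C' b ->
  cdom a x -> cdom a' x -> cdom b (f x) ->
  'd (cmap b \o f \o cinv a') (cmap a' x) ('d (cmap a' \o cinv a) (cmap a x) v) =
  'd (cmap b \o f \o cinv a) (cmap a x) v.
Proof.
move=> [cf sf] aa aa' ab ax a'x bfx.
have d1 := sm_differentiable (sm_trans aa aa' ax a'x).
have e1 : (cmap a' \o cinv a) (cmap a x) = cmap a' x by rewrite /= cmapK.
have d2 : differentiable (cmap b \o f \o cinv a') ((cmap a' \o cinv a) (cmap a x)).
  by rewrite e1; exact: sm_differentiable (sf _ _ aa' ab a'x bfx).
have := diff_comp d1 d2; rewrite e1 => dE.
have [_ ->] : differentiable (cmap b \o f \o cinv a) (cmap a x) /\
   'd (cmap b \o f \o cinv a) (cmap a x) =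
   'd ((cmap b \o f \o cinv a') \o (cmap a' \o cinv a)) (cmap a x) :> (E -> F).
  apply: near_eq_diff; last exact: differentiable_comp.
  have : \forall v \near cmap a x, ccod a v /\ cdom a' (cinv a v).
    by apply: cinv_nbhs; [exact: cmap_ccod|rewrite cmapK//; exact: cdom_nbhs].
  by apply: filterS => w [_ a'w] /=; rewrite cmapK.
exact: (esym (congr1 (@^~ v) dE)).
Qed.

Lemma diff_chart_target (L : topologicalType) (F : normedModType R)
    (C' : charted L F) f x a b b' v :
  smat C' C f x -> atlas C' a -> atlas C b -> atlas C b' ->
  cdom a x -> cdom b (f x) -> cdom b' (f x) ->
  'd (cmap b' \o cinv b) (cmap b (f x)) ('d (cmap b \o f \o cinv a) (cmap a x) v) =
  'd (cmap b' \o f \o cinv a) (cmap a x) v.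
Proof.
move=> [cf sf] aa ab ab' ax bx b'x.
have e1 : (cmap b \o f \o cinv a) (cmap a x) = cmap b (f x) by rewrite /= cmapK.
have d1 := sm_differentiable (sf _ _ aa ab ax bx).
have d2 : differentiable (cmap b' \o cinv b) ((cmap b \o f \o cinv a) (cmap a x)).
  by rewrite e1; exact: sm_differentiable (sm_trans ab ab' bx b'x).
have := diff_comp d1 d2; rewrite e1 => dE.
have [_ ->] : differentiable (cmap b' \o f \o cinv a) (cmap a x) /\
   'd (cmap b' \o f \o cinv a) (cmap a x) =
   'd ((cmap b' \o cinv b) \o (cmap b \o f \o cinv a)) (cmap a x) :> (F -> E).
  apply: near_eq_diff; last exact: differentiable_comp.
  have : \forall v \near cmap a x, ccod a v /\ cdom b (f (cinv a v)).
    apply: (@cinv_nbhs _ _ _ a (f @^-1` cdom b)); first exact: cmap_ccod.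
    by rewrite cmapK//; apply: cf; exact: cdom_nbhs.
  by apply: filterS => w [_ a'w] /=; rewrite cmapK.
exact: (esym (congr1 (@^~ v) dE)).
Qed.

Lemma smat_id x : smat C C id x.
Proof. by split=> [|a b aa ab ax bx]; [exact: cvg_id|exact: sm_trans]. Qed.

Lemma diff_chart_id (a : chart M E) x v : cdom a x -> 'd (cmap a \o cinv a) (cmap a x) v = v.
Proof.
move=> ax; have [||_ ->] := @near_eq_diff _ _ _ id (cmap a \o cinv a) (cmap a x).
- by apply: filterS (ccod_nbhs (cmap_ccod ax)) => u au; rewrite /= cinvK.
- exact: ex_diff.
- by rewrite (@diff_lin _ _ _ idfun)// => y; exact: cvg_id.
Qed.

Lemma mdiff_id x v : mdiff C C id x v = v.
Proof. exact/diff_chart_id/chart_at_cdom. Qed.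

Lemma pushE (a : chart M E) x v : cdom a x ->
  push C a (cmap a x) v = 'd (cmap (chart_at C x) \o cinv a) (cmap a x) v.
Proof. by move=> ax; rewrite /push cmapK. Qed.

Definition pull (a : chart M E) x (v : E) : E := 'd (cmap a \o cinv (chart_at C x)) (cmap (chart_at C x) x) v.

Lemma pushK a x v : atlas C a -> cdom a x -> pull a x (push C a (cmap a x) v) = v.
Proof.
move=> aa ax; rewrite pushE// /pull.
rewrite (diff_chart_source v (smat_id x) aa (chart_at_atlas _ _) aa ax (chart_at_cdom _ _) ax).
exact: diff_chart_id.
Qed.

Lemma pullK a x v : atlas C a -> cdom a x -> push C a (cmap a x) (pull a x v) = v.
Proof.
move=> aa ax; rewrite pushE// /pull.
rewrite (diff_chart_source v (smat_id x) (chart_at_atlas _ _) aa (chart_at_atlas _ _)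
   (chart_at_cdom _ _) ax (chart_at_cdom _ _)).
by apply: diff_chart_id; exact: chart_at_cdom.
Qed.

Lemma push_inj a x : atlas C a -> cdom a x -> injective (push C a (cmap a x)).
Proof. by move=> aa ax v w E'; rewrite -(pushK v aa ax) E' pushK. Qed.

End SmoothAt.

Section Differential.
Context {R : realType}.

(** Preferred charts change with the point without any regularity. Through [push] the differential
    is expressed in two fixed charts, where it can be differentiated again. *)
Lemma mdiff_push (M N : topologicalType) (E F : normedModType R)
    (C : charted M E) (C' : charted N F) f x a b v :
  smooth_manifold C -> smooth_manifold C' -> smat C C' f x ->
  atlas C a -> atlas C' b -> cdom a x -> cdom b (f x) ->
  mdiff C C' f x (push C a (cmap a x) v) =
  push C' b (cmap b (f x)) ('d (cmap b \o f \o cinv a) (cmap a x) v).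
Proof.
move=> hM hN sf aa ab ax bfx; rewrite !pushE// /mdiff.
rewrite (diff_chart_source hM v sf aa)//; [|exact: chart_at_atlas|exact: chart_at_atlas|exact: chart_at_cdom|exact: chart_at_cdom].
by rewrite (diff_chart_target hN v sf)//; [exact: chart_at_atlas|exact: chart_at_cdom].
Qed.

Lemma diff_map_comp (M N P : topologicalType) (E F H : normedModType R)
    (C : charted M E) (C' : charted N F) (C'' : charted P H) f g x a b c v :
  smat C C' f x -> smat C' C'' g (f x) ->
  atlas C a -> atlas C' b -> atlas C'' c ->
  cdom a x -> cdom b (f x) -> cdom c (g (f x)) ->
  'd (cmap c \o (g \o f) \o cinv a) (cmap a x) v =
  'd (cmap c \o g \o cinv b) (cmap b (f x)) ('d (cmap b \o f \o cinv a) (cmap a x) v).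
Proof.
move=> [cf sf] [cg sg] aa ab ac ax bx cx.
have e1 : (cmap b \o f \o cinv a) (cmap a x) = cmap b (f x) by rewrite /= cmapK.
have d1 := sm_differentiable (sf _ _ aa ab ax bx).
have d2 : differentiable (cmap c \o g \o cinv b) ((cmap b \o f \o cinv a) (cmap a x)).
  by rewrite e1; exact: sm_differentiable (sg _ _ ab ac bx cx).
have := diff_comp d1 d2; rewrite e1 => dE.
have [_ ->] : differentiable (cmap c \o (g \o f) \o cinv a) (cmap a x) /\
   'd (cmap c \o (g \o f) \o cinv a) (cmap a x) =
   'd ((cmap c \o g \o cinv b) \o (cmap b \o f \o cinv a)) (cmap a x) :> (E -> H).
  apply: near_eq_diff; last exact: differentiable_comp.
  have : \forall v \near cmap a x, ccod a v /\ cdom b (f (cinv a v)).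
    apply: (@cinv_nbhs _ _ _ a (f @^-1` cdom b)); first exact: cmap_ccod.
    by rewrite cmapK//; apply: cf; exact: cdom_nbhs.
  by apply: filterS => w [_ a'w] /=; rewrite cmapK.
exact: (congr1 (@^~ v) dE).
Qed.

Lemma mdiff_comp (M N P : topologicalType) (E F H : normedModType R)
    (C : charted M E) (C' : charted N F) (C'' : charted P H) f g x v :
  smat C C' f x -> smat C' C'' g (f x) ->
  mdiff C C'' (g \o f) x v = mdiff C' C'' g (f x) (mdiff C C' f x v).
Proof.
move=> sf sg; rewrite /mdiff.
by rewrite (diff_map_comp (b := chart_at C' (f x)) v sf sg)//; try exact: chart_at_atlas; exact: chart_at_cdom.
Qed.

Lemma smat_comp (M N P : topologicalType) (E F : normedModType R) n
    (C : charted M E) (C' : charted N F) (C'' : charted P 'rV[R]_n) f g x :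
  fdim F -> smat C C' f x -> smat C' C'' g (f x) -> smat C C'' (g \o f) x.
Proof.
move=> fF [cf sf] [cg sg]; split; first exact: continuous_comp cf cg.
move=> a c aa ac ax cx.
pose b := chart_at C' (f x).
have ab : atlas C' b by exact: chart_at_atlas.
have bx : cdom b (f x) by exact: chart_at_cdom.
apply: (@sm_eq _ _ _ (fun u => (cmap c \o g \o cinv b) ((cmap b \o f \o cinv a) u))).
  have : \forall v \near cmap a x, ccod a v /\ cdom b (f (cinv a v)).
    apply: (@cinv_nbhs _ _ _ a (f @^-1` cdom b)); first exact: cmap_ccod.
    by rewrite cmapK//; apply: cf; exact: cdom_nbhs.
  by apply: filterS => w [_ a'w] /=; rewrite cmapK.
apply: sm_comp => //; first exact: sf.
by rewrite /= cmapK//; exact: sg.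
Qed.

Lemma mdiff_near (M N : topologicalType) (E F : normedModType R)
    (C : charted M E) (C' : charted N F) f g x :
  smat C C' f x -> {near x, f =1 g} -> smat C C' g x /\
  forall v, mdiff C C' g x v = mdiff C C' f x v.
Proof.
move=> [cf sf] fg; have fgx : f x = g x by exact: nbhs_singleton fg.
have fgN a : cdom a x -> \forall u \near cmap a x, f (cinv a u) = g (cinv a u).
  move=> ax; have : \forall v \near cmap a x, ccod a v /\ f (cinv a v) = g (cinv a v).
    apply: (@cinv_nbhs _ _ _ a (fun y => f y = g y)); first exact: cmap_ccod.
    by rewrite cmapK.
  by apply: filterS => v [].
split.
  split; first by rewrite /prop_for /continuous_at -fgx; apply: cvg_trans cf; exact: near_eq_cvg.
  move=> a b aa ab ax; rewrite -fgx => bx; apply: sm_eq (sf a b aa ab ax bx).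
  near=> u; rewrite /=; congr (cmap _ _); near: u; exact: fgN.
move=> v; rewrite /mdiff -fgx.
set a := chart_at C x; set b := chart_at C' (f x).
have ax : cdom a x by exact: chart_at_cdom.
have d : differentiable (cmap b \o f \o cinv a) (cmap a x).
  by apply/sm_differentiable/sf; [exact: chart_at_atlas..|exact: chart_at_cdom|exact: chart_at_cdom].
have e : {near cmap a x, cmap b \o f \o cinv a =1 cmap b \o g \o cinv a}.
  by near=> u; rewrite /=; congr (cmap _ _); near: u; exact: fgN.
by have [_ ->] := near_eq_diff e d.
Unshelve. all: by end_near.
Qed.

Variables (M N : topologicalType) (E F : normedModType R)
  (C : charted M E) (C' : charted N F).
Hypotheses (hM : smooth_manifold C) (hN : smooth_manifold C').

Lemma smat_pairl (y : N) (x : M) : smat C (prod_charted C C') (fun x => (x, y)) x.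
Proof.
split; first by apply: (@cvg_pair _ _ _ (nbhs x)); [exact: cvg_id|exact: cvg_cst].
move=> a c aa [b [b' [ab ab' ->]]] ax [/= bx b'y].
change (sm (fun u => ((cmap b \o cinv a) u, cmap b' y)) (cmap a x)).
by apply: sm_pair; [exact: (sm_trans hM aa ab ax bx)|exact: sm_cst].
Qed.

Lemma smat_pairr (x : M) (y : N) : smat C' (prod_charted C C') (fun y => (x, y)) y.
Proof.
split; first by apply: (@cvg_pair _ _ _ (nbhs y)); [exact: cvg_cst|exact: cvg_id].
move=> a c aa [b [b' [ab ab' ->]]] ax [/= bx b'y].
change (sm (fun u => (cmap b x, (cmap b' \o cinv a) u)) (cmap a y)).
by apply: sm_pair; [exact: sm_cst|exact: (sm_trans hN aa ab' ax b'y)].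
Qed.

Lemma mdiff_pairl (y : N) (x : M) v : mdiff C (prod_charted C C') (fun x => (x, y)) x v = (v, 0).
Proof.
rewrite /mdiff /=; set a := chart_at C x; set b := chart_at C' y.
have ax : cdom a x by exact: chart_at_cdom.
have d1 := sm_differentiable (sm_trans hM (chart_at_atlas C x) (chart_at_atlas C x) ax ax).
have d2 : differentiable (fun _ : E => cmap b y) (cmap a x) by exact: differentiable_cst.
transitivity ('d (fun u => ((cmap a \o cinv a) u, cmap b y)) (cmap a x) v); first by [].
by rewrite diff_pair// diff_cst diff_chart_id.
Qed.

Lemma mdiff_pairr (x : M) (y : N) v : mdiff C' (prod_charted C C') (fun y => (x, y)) y v = (0, v).
Proof.
rewrite /mdiff /=; set a := chart_at C x; set b := chart_at C' y.
have ax : cdom b y by exact: chart_at_cdom.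
have d1 := sm_differentiable (sm_trans hN (chart_at_atlas C' y) (chart_at_atlas C' y) ax ax).
have d2 : differentiable (fun _ : F => cmap a x) (cmap b y) by exact: differentiable_cst.
transitivity ('d (fun u => (cmap a x, (cmap b \o cinv b) u)) (cmap b y) v); first by [].
by rewrite diff_pair// diff_cst diff_chart_id.
Qed.

Variables (P : topologicalType) (n : nat) (C'' : charted P 'rV[R]_n) (f : M * N -> P).
Hypotheses (fE : fdim E) (fF : fdim F).

Lemma smat_fixr (x : M) (y : N) : smat (prod_charted C C') C'' f (x, y) ->
  smat C C'' (fun x => f (x, y)) x /\
  forall v, mdiff C C'' (fun x => f (x, y)) x v = mdiff (prod_charted C C') C'' f (x, y) (v, 0).
Proof.
move=> sf; split.
  by apply: (@smat_comp _ _ _ _ _ _ _ (prod_charted C C') _ (fun x => (x, y)) f);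
    [exact: fdim_prod|exact: smat_pairl|].
move=> v; rewrite -(mdiff_pairl y x v).
by rewrite -(@mdiff_comp _ _ _ _ _ _ _ _ _ (fun x => (x, y)) f)//; exact: smat_pairl.
Qed.

Lemma smat_fixl (x : M) (y : N) : smat (prod_charted C C') C'' f (x, y) ->
  smat C' C'' (fun y => f (x, y)) y /\
  forall v, mdiff C' C'' (fun y => f (x, y)) y v = mdiff (prod_charted C C') C'' f (x, y) (0, v).
Proof.
move=> sf; split.
  by apply: (@smat_comp _ _ _ _ _ _ _ (prod_charted C C') _ (fun y => (x, y)) f);
    [exact: fdim_prod|exact: smat_pairr|].
move=> v; rewrite -(mdiff_pairr x y v).
by rewrite -(@mdiff_comp _ _ _ _ _ _ _ _ _ (fun y => (x, y)) f)//; exact: smat_pairr.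
Qed.

End Differential.

(** * The infinitesimal action and the deformed metrics *)

(* Locked with distinct keys, matrices of differentials are never unfolded by unification. *)
Fact pushM_key : unit. Proof. by []. Qed.
Fact Kmx_key : unit. Proof. by []. Qed.
Fact actJ_key : unit. Proof. by []. Qed.
Fact AdM_key : unit. Proof. by []. Qed.
Fact Kc_key : unit. Proof. by []. Qed.

Section MetricMatrix.
Context {R : realType} (n : nat) (M : topologicalType) (C : charted M 'rV[R]_n).
Hypothesis hM : smooth_manifold C.
Implicit Types (g : tensor M 'rV[R]_n) (a : chart M 'rV[R]_n).

Definition gmx g x : 'M[R]_n := \matrix_(i, j) g x (ebase R i) (ebase R j).

Definition pushM a x : 'M[R]_n :=
  locked_with pushM_key (lin1_mx ('d (cmap (chart_at C x) \o cinv a) (cmap a x))).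

(** [gmx] uses the preferred chart of each point, so its entries need not be continuous in [x];
    [cmx], in a fixed chart, is the smooth version. [Kmx] and [Kc] are related in the same way. *)
Definition cmx g a u : 'M[R]_n := \matrix_(i, j) gij C g a i j u.

Lemma metric_form (U : set M) g x v w : riemannian_metric C U g -> U x ->
  g x v w = bform (gmx g x) v w.
Proof.
move=> [bl sy _ _] Ux.
have l0 w' : g x 0 w' = 0.
  have := bl x Ux 0 0 0 w'; rewrite scale0r add0r mul0r add0r => E.
  have := bl x Ux 1 0 0 w'; rewrite scaler0 add0r mul1r => /eqP.
  by rewrite -subr_eq0 opprD addrA subrr add0r oppr_eq0 => /eqP.
have lsum I (r : seq I) (c : I -> R) (f : I -> 'rV[R]_n) w' :
    g x (\sum_(i <- r) c i *: f i) w' = \sum_(i <- r) c i * g x (f i) w'.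
  by elim: r => [|i r IH]; rewrite ?big_nil ?l0// !big_cons bl// IH.
rewrite bform_sum {1}(row_sum_delta v) lsum; apply: eq_bigr => i _.
rewrite sy// {1}(row_sum_delta w) lsum big_distrr /=; apply: eq_bigr => j _.
by rewrite mxE (sy _ Ux) /ebase mulrA [RHS]mulrAC mulrAC -mulrA mulrCA mulrA mulrAC.
Qed.

Lemma spd_gmx (U : set M) g x : riemannian_metric C U g -> U x -> spd (gmx g x).
Proof.
move=> rg Ux; have [_ sy pos _] := rg; split.
  by apply/matrixP => i j; rewrite !mxE sy.
by move=> v v0; rewrite -(metric_form v v rg Ux); exact: pos.
Qed.

Lemma push_mx a x v : cdom a x -> push C a (cmap a x) v = v *m pushM a x.
Proof. by move=> ax; rewrite pushE// /pushM locked_withE mul_rV_lin1. Qed.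

Lemma pushM_unit a x : atlas C a -> cdom a x -> pushM a x \in unitmx.
Proof.
move=> aa ax; rewrite -row_free_unit; apply: row_free_ker0 => v.
rewrite -push_mx// => v0; apply: (push_inj hM aa ax).
by rewrite v0 push_mx// mul0mx.
Qed.

Lemma comp_form a x g (A : 'M[R]_n) v w : cdom a x ->
  (forall v w, g x v w = bform A v w) ->
  Defs.comp C g a (cmap a x) v w = bform (pushM a x *m A *m (pushM a x)^T) v w.
Proof. by move=> ax gA; rewrite /Defs.comp cmapK// !push_mx// gA bform_mul. Qed.

Lemma cmxE (U : set M) g a x : riemannian_metric C U g -> U x -> cdom a x ->
  cmx g a (cmap a x) = pushM a x *m gmx g x *m (pushM a x)^T.
Proof.
move=> rg Ux ax; apply/matrixP => i j; rewrite mxE /gij.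
rewrite (@comp_form a x g (gmx g x))//; last by move=> v w; exact: metric_form rg Ux.
by rewrite bform_delta.
Qed.

Lemma comp_cmx (U : set M) g a x v w : riemannian_metric C U g -> U x -> cdom a x ->
  Defs.comp C g a (cmap a x) v w = bform (cmx g a (cmap a x)) v w.
Proof.
move=> rg Ux ax; rewrite (cmxE rg Ux ax) (@comp_form a x g (gmx g x))// => v' w'.
exact: metric_form rg Ux.
Qed.

Lemma spd_cmx (U : set M) g a x : riemannian_metric C U g -> U x -> atlas C a -> cdom a x ->
  spd (cmx g a (cmap a x)).
Proof.
move=> rg Ux aa ax; rewrite (cmxE rg Ux ax); apply: spd_gram; first exact: spd_gmx rg Ux.
by rewrite row_free_unit pushM_unit.
Qed.

Lemma sm_cmx (U : set M) g a x : riemannian_metric C U g -> open U -> U x ->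
  atlas C a -> cdom a x -> sm (cmx g a) (cmap a x).
Proof.
move=> [_ _ _ sg] oU Ux aa ax; apply: sm_mx => i j.
under eq_fun do rewrite mxE.
apply: smooth_sm (sg a aa (ebase R i) (ebase R j)); first exact: open_preim.
by split; [exact: cmap_ccod|rewrite /= cmapK].
Qed.

End MetricMatrix.

Section ActionField.
Context {R : realType} (d n : nat) (G : topGroupType) (M : topologicalType).
Context (CG : charted G 'rV[R]_d) (CM : charted M 'rV[R]_n) (act : G -> M -> M).
Hypotheses (hG : lie_group CG) (hM : smooth_manifold CM) (hact : smooth_action CG CM act).

Let hGm : smooth_manifold CG. Proof. by case: hG. Qed.

Lemma act1 x : act 1%g x = x. Proof. by case: hact. Qed.
Lemma actM h k x : act (h * k)%g x = act h (act k x). Proof. by case: hact. Qed.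

Let smact h x : smat (prod_charted CG CM) CM (fun z : G * M => act z.1 z.2) (h, x).
Proof. by apply: smat_map openT I _; case: hact. Qed.

Let smmul h k : smat (prod_charted CG CG) CG (fun z : G * G => (z.1 * z.2)%g) (h, k).
Proof. by apply: smat_map openT I _; case: hG. Qed.

Lemma smat_act h x : smat CM CM (act h) x.
Proof. by have [] := smat_fixl hM (fdim_rV d) (fdim_rV n) (smact h x). Qed.

Lemma smat_orbit x h : smat CG CM (act^~ x) h.
Proof. by have [] := smat_fixr hGm (fdim_rV d) (fdim_rV n) (smact h x). Qed.

(** The differential is the sum of two partial ones, and the partial one along [M] is that of
    [act 1], the identity. *)
Lemma mdiff_actD x xi v :
  mdiff (prod_charted CG CM) CM (fun z : G * M => act z.1 z.2) (1%g, x) (xi, v) =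
  mdiff CG CM (act^~ x) 1%g xi + v.
Proof.
have [_ E1] := smat_fixr hGm (fdim_rV d) (fdim_rV n) (smact 1%g x).
have [_ E2] := smat_fixl hM (fdim_rV d) (fdim_rV n) (smact 1%g x).
rewrite E1 -[X in _ + X](mdiff_id CM x).
have -> : id = act 1%g by apply/funext => y; rewrite act1.
rewrite E2 /mdiff -linearD; congr ('d _ _ _).
by rewrite -[RHS]/(xi + 0, 0 + v) addr0 add0r.
Qed.

Lemma smat_lmul h k : smat CG CG (fun p => h * p)%g k.
Proof. by have [] := smat_fixl hGm (fdim_rV d) (fdim_rV d) (smmul h k). Qed.

Lemma smat_rmul h k : smat CG CG (fun p => p * h)%g k.
Proof. by have [] := smat_fixr hGm (fdim_rV d) (fdim_rV d) (smmul k h). Qed.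

Definition Kmx x : 'M[R]_(d, n) :=
  locked_with Kmx_key (lin1_mx ('d (cmap (chart_at CM (act 1%g x)) \o act^~ x \o cinv (chart_at CG 1%g))
           (cmap (chart_at CG 1%g) 1%g))).

Lemma KmxE x xi : mdiff CG CM (act^~ x) 1%g xi = xi *m Kmx x.
Proof. by rewrite /Kmx locked_withE mul_rV_lin1. Qed.

Lemma orbit_tangentE x v : orbit_tangent CG CM act x v <-> (v <= Kmx x)%MS.
Proof.
rewrite /orbit_tangent; split.
  by move=> [xi _ <-]; rewrite KmxE submxMl.
by move=> /submxP[xi ->]; exists xi => //; rewrite KmxE.
Qed.

Definition actJ h x : 'M[R]_n :=
  locked_with actJ_key (lin1_mx ('d (cmap (chart_at CM (act h x)) \o act h \o cinv (chart_at CM x))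
           (cmap (chart_at CM x) x))).

Lemma actJE h x v : mdiff CM CM (act h) x v = v *m actJ h x.
Proof. by rewrite /actJ locked_withE mul_rV_lin1. Qed.

Definition adjoint h (p : G) : G := (h * p * h^-1)%g.

Lemma smat_adjoint h p : smat CG CG (adjoint h) p.
Proof.
apply: (@smat_comp _ _ _ _ _ _ _ _ CG _ (fun p => h * p)%g (fun p => p * h^-1)%g).
- exact: fdim_rV.
- exact: smat_lmul.
- exact: smat_rmul.
Qed.

Definition AdM h : 'M[R]_d :=
  locked_with AdM_key (lin1_mx ('d (cmap (chart_at CG (adjoint h 1%g)) \o adjoint h \o cinv (chart_at CG 1%g))
           (cmap (chart_at CG 1%g) 1%g))).

Lemma AdME h v : mdiff CG CG (adjoint h) 1%g v = v *m AdM h.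
Proof. by rewrite /AdM locked_withE mul_rV_lin1. Qed.

Lemma adjoint1 h : adjoint h 1%g = 1%g.
Proof. by rewrite /adjoint mulg1 mulgV. Qed.

(** Differentiates [h (p x) = (h p h^-1) (h x)] with respect to [p] at 1. *)
Lemma act_adjoint h x : Kmx x *m actJ h x = AdM h *m Kmx (act h x).
Proof.
apply/row_matrixP => i; rewrite !rowE !mulmxA; set xi := delta_mx 0 i.
rewrite -KmxE -actJE -AdME -KmxE.
have E1 : mdiff CG CM (act h \o act^~ x) 1%g xi =
    mdiff CM CM (act h) x (mdiff CG CM (act^~ x) 1%g xi).
  by have := mdiff_comp xi (smat_orbit x 1%g) (smat_act h (act 1%g x)); rewrite act1.
have E2 : mdiff CG CM (act^~ (act h x) \o adjoint h) 1%g xi =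
    mdiff CG CM (act^~ (act h x)) 1%g (mdiff CG CG (adjoint h) 1%g xi).
  have := mdiff_comp xi (smat_adjoint h 1%g) (smat_orbit (act h x) (adjoint h 1%g)).
  by rewrite adjoint1.
have E3 : act h \o act^~ x = act^~ (act h x) \o adjoint h.
  by apply/funext => p /=; rewrite -!actM /adjoint mulgVK.
exact: etrans (esym E1) (etrans (congr1 (fun f => mdiff CG CM f 1%g xi) E3) E2).
Qed.

Variable (b : tensor G 'rV[R]_d).
Hypothesis hb : bi_invariant_metric CG b.

Definition gmxG : 'M[R]_d := gmx b 1%g.

Lemma spd_gmxG : spd gmxG.
Proof. by apply: (@spd_gmx _ _ _ CG setT) => //; case: hb. Qed.

Lemma biinv_form p v w : b p v w = bform (gmx b p) v w.
Proof. by have [rb _ _] := hb; exact: metric_form rb I. Qed.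

(** Conjugation by [h] is left translation by [h] followed by right translation by [h^-1]; both
    invariances are used. *)
Lemma AdM_isom h : AdM h *m gmxG *m (AdM h)^T = gmxG.
Proof.
apply: bform_inj => v w; rewrite -bform_mul -!AdME -!biinv_form.
have [_ bl br] := hb.
rewrite -(bl h 1%g I v w) mulg1.
rewrite -(br h^-1%g h I) mulgV.
have E z : mdiff CG CG (adjoint h) 1%g z =
    mdiff CG CG (fun p => p * h^-1)%g h (mdiff CG CG (fun p => h * p)%g 1%g z).
  have H := mdiff_comp z (smat_lmul h 1%g) (smat_rmul h^-1%g (h * 1)%g).
  by rewrite mulg1 in H; exact: H.
by rewrite !E.
Qed.

Lemma AdM_unit h : AdM h \in unitmx.
Proof.
have uB := spd_unit spd_gmxG.
rewrite -row_free_unit; apply/row_freeP; exists (gmxG *m (AdM h)^T *m invmx gmxG).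
by rewrite !mulmxA AdM_isom mulmxV.
Qed.

Lemma AdMV_isom h : invmx (AdM h) *m gmxG *m (invmx (AdM h))^T = gmxG.
Proof.
have uA := AdM_unit h.
rewrite -{1}(AdM_isom h) !mulmxA mulVmx// mul1mx -mulmxA -trmx_mul mulVmx//.
by rewrite trmx1 mulmx1.
Qed.

Lemma Kmx_act h x : Kmx (act h x) = invmx (AdM h) *m Kmx x *m actJ h x.
Proof. by rewrite -mulmxA act_adjoint mulKmx// AdM_unit. Qed.

Variables (gM : tensor M 'rV[R]_n).
Hypotheses (hgM : riemannian_metric CM setT gM) (isom : invariant_metric CM act setT gM).

Definition deform_at (s : R) x : 'M[R]_n := deform (gmx gM x) gmxG (Kmx x) s.

Definition deformed (s : R) : tensor M 'rV[R]_n :=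
  fun x v w => bform (deform_at s x) v w.

Lemma spd_gmM x : spd (gmx gM x).
Proof. exact: spd_gmx hgM I. Qed.

Lemma spd_deform_at s x : 0 <= s -> spd (deform_at s x).
Proof. by move=> s0; apply: spd_deform => //; [exact: spd_gmM|exact: spd_gmxG]. Qed.

Lemma gmM_act h x : gmx gM x = actJ h x *m gmx gM (act h x) *m (actJ h x)^T.
Proof.
apply: bform_inj => v w; rewrite -bform_mul -!actJE.
by rewrite -!(metric_form _ _ hgM I) isom.
Qed.

(** [deform_cov] with two isometries: the differential of the action on [M], and the inverse of the
    adjoint map on the Lie algebra. *)
Lemma deform_act s h x : 0 <= s ->
  deform_at s x = actJ h x *m deform_at s (act h x) *m (actJ h x)^T.
Proof.
move=> s0; apply/esym; apply: (@deform_cov _ _ _ _ _ _ _ _ _ _ (invmx (AdM h))) => //.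
- exact: spd_gmM.
- exact: spd_gmM.
- exact: spd_gmxG.
- exact: gmM_act.
- exact: Kmx_act.
- exact: AdMV_isom.
Qed.

Lemma deformed_invariant s (U : set M) : 0 <= s ->
  invariant_metric CM act U (deformed s).
Proof.
by move=> s0 h x _ v w; rewrite /deformed !actJE bform_mul -deform_act.
Qed.

Definition Kc (a : chart M 'rV[R]_n) u : 'M[R]_(d, n) :=
  locked_with Kc_key (lin1_mx ('d (cmap a \o act^~ (cinv a u) \o cinv (chart_at CG 1%g))
           (cmap (chart_at CG 1%g) 1%g))).

Lemma Kc_diff a u xi : xi *m Kc a u =
  'd (cmap a \o act^~ (cinv a u) \o cinv (chart_at CG 1%g)) (cmap (chart_at CG 1%g) 1%g) xi.
Proof. by rewrite /Kc locked_withE mul_rV_lin1. Qed.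

Lemma KcE a x : atlas CM a -> cdom a x -> Kmx x = Kc a (cmap a x) *m pushM CM a x.
Proof.
move=> aa ax; apply/row_matrixP => i; rewrite !rowE mulmxA; set xi := delta_mx 0 i.
rewrite -KmxE.
rewrite Kc_diff.
rewrite (cmapK ax).
rewrite -(push_mx CM _ ax).
rewrite (pushE CM _ ax).
rewrite /mdiff.
rewrite act1.
have ax1 : cdom a (act 1%g x) by rewrite act1.
have E := diff_chart_target hM xi (smat_orbit x 1%g) (chart_at_atlas _ _) aa
  (chart_at_atlas CM (act 1%g x)) (chart_at_cdom _ _) ax1 (chart_at_cdom _ _).
by rewrite act1 in E; exact: esym E.
Qed.

Definition deform_c a (s : R) u := deform (cmx CM gM a u) gmxG (Kc a u) s.

Lemma deform_cE a s x : 0 <= s -> atlas CM a -> cdom a x ->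
  pushM CM a x *m deform_at s x *m (pushM CM a x)^T = deform_c a s (cmap a x).
Proof.
move=> s0 aa ax; apply: (@deform_cov _ _ _ _ _ _ _ _ _ _ 1%:M) => //.
- exact: spd_cmx hgM I aa ax.
- exact: spd_gmM.
- exact: spd_gmxG.
- exact: cmxE hgM I ax.
- by rewrite mul1mx; exact: KcE.
- by rewrite mul1mx trmx1 mulmx1.
Qed.

Lemma comp_deformed a s x v w : 0 <= s -> atlas CM a -> cdom a x ->
  Defs.comp CM (deformed s) a (cmap a x) v w = bform (deform_c a s (cmap a x)) v w.
Proof.
move=> s0 aa ax; rewrite -deform_cE//.
by rewrite (@comp_form _ _ _ CM a x (deformed s) (deform_at s x)).
Qed.

Section SmoothK.

Definition actc (a : chart M 'rV[R]_n) (z : 'rV[R]_d * 'rV[R]_n) : 'rV[R]_n :=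
  cmap a (act (cinv (chart_at CG 1%g) z.1) (cinv a z.2)).

Definition idG : 'rV[R]_d := cmap (chart_at CG 1%g) 1%g.

Lemma sm_actc a x : atlas CM a -> cdom a x -> sm (actc a) (idG, cmap a x).
Proof.
move=> aa ax; have [_ H] := smact 1%g x.
apply: (H (prod_chart (chart_at CG 1%g) a) a) => //=.
- by exists (chart_at CG 1%g), a; split => //; exact: chart_at_atlas.
- by split => //; exact: chart_at_cdom.
- by rewrite act1.
Qed.

Lemma diff_fixr (V W X : normedModType R) (f : V * W -> X) v w h :
  differentiable f (v, w) -> 'd (fun v => f (v, w)) v h = 'd f (v, w) (h, 0).
Proof.
move=> df; have dp : differentiable (fun v : V => (v, w)) v.
  by apply: differentiable_pair => //; exact: differentiable_cst.
have -> : (fun v => f (v, w)) = f \o (fun v => (v, w)) by [].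
by rewrite diff_comp//= diff_pair// diff_cst (@diff_lin _ _ _ idfun)//= => y; exact: cvg_id.
Qed.

Lemma diff_fixl (V W X : normedModType R) (f : V * W -> X) v w h :
  differentiable f (v, w) -> 'd (fun w => f (v, w)) w h = 'd f (v, w) (0, h).
Proof.
move=> df; have dp : differentiable (fun w : W => (v, w)) w.
  by apply: differentiable_pair => //; exact: differentiable_cst.
have -> : (fun w => f (v, w)) = f \o (fun w => (v, w)) by [].
by rewrite diff_comp//= diff_pair// diff_cst (@diff_lin _ _ _ idfun)//= => y; exact: cvg_id.
Qed.

Lemma near_pairl (V W : normedModType R) (P : set (V * W)) (v : V) (w : W) :
  nbhs (v, w) P -> \forall w' \near w, P (v, w').
Proof.
move=> [[A B] /= [nA nB] AB]; apply: filterS nB => w' Bw'; apply: AB.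
by split; [exact: (nbhs_singleton nA)|exact: Bw'].
Qed.

Lemma Kc_near a x : atlas CM a -> cdom a x ->
  \forall u \near cmap a x, forall xi, xi *m Kc a u = 'd (actc a) (idG, u) (xi, 0).
Proof.
move=> aa ax; have := near_pairl (sm_near_differentiable (sm_actc aa ax)).
apply: filterS => u du xi; rewrite Kc_diff -(diff_fixr _ du).
by [].
Qed.

(** Near [x], [Kc] is the partial differential of the jointly smooth [actc] in the group variable,
    taken at the identity. *)
Lemma sm_Kc a x : atlas CM a -> cdom a x -> sm (Kc a) (cmap a x).
Proof.
move=> aa ax; apply: sm_mx => i j.
apply: (@sm_eq _ _ _ (fun u => ('d (actc a) (idG, u) (delta_mx 0 i, 0)) 0 j)).
  apply: filterS (Kc_near aa ax) => u Ku.
  by rewrite -Ku -rowE mxE.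
apply: sm_coord.
apply: (@sm_comp _ _ _ _ _ (fun u => (idG, u)) (fun z => 'd (actc a) z (delta_mx 0 i, 0))).
- by apply: fdim_prod; exact: fdim_rV.
- by apply: sm_pair; [exact: sm_cst|exact: sm_id].
- by apply: sm_diff; exact: sm_actc.
Qed.

End SmoothK.
End ActionField.

(** * Identification and smoothness of the rescaled metrics *)

Section DeformedMetric.
Context {R : realType} (d n : nat) (G : topGroupType) (M : topologicalType).
Context (CG : charted G 'rV[R]_d) (CM : charted M 'rV[R]_n) (act : G -> M -> M).
Hypotheses (hG : lie_group CG) (hM : smooth_manifold CM) (hact : smooth_action CG CM act).
Context (b : tensor G 'rV[R]_d) (hb : bi_invariant_metric CG b).
Context (gM : tensor M 'rV[R]_n) (hgM : riemannian_metric CM setT gM).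

Local Notation K := (Kmx CG CM act).
Local Notation B := (gmxG b).
Local Notation A := (gmx gM).

(* Horizontal vectors of the submersion [G x M -> M] at [(1, x)] are the
   [(l^-2 K^* w, w)]; their images are the [w + l^-2 K K^* w]. *)
Lemma cheeger_mx (l : R) gl x : 0 < l -> cheeger_metric CG CM act l b gM gl ->
  let N := 1%:M + (l ^+ 2)^-1 *: (A x *m (K x)^T *m invmx B *m K x) in
  N *m gmx gl x *m N^T = N *m A x.
Proof.
move=> l0 [rgl [_ _ _ sub]] N.
have uB := spd_unit (spd_gmxG hb).
have BT := (spd_gmxG hb).1; have AT := (spd_gmM hgM x).1.
have l2 : l ^+ 2 != 0 by rewrite expf_neq0// gt_eqF.
pose eta (w : 'rV[R]_n) := (l ^+ 2)^-1 *: (w *m (A x *m (K x)^T *m invmx B)).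
have act1x : act 1%g x = x by case: hact.
have img w : mdiff (prod_charted CG CM) CM (fun z : G * M => act z.1 z.2)
    (1%g, x) (eta w, w) = w *m N.
  rewrite (mdiff_actD hG hM hact) KmxE /N mulmxDr mulmx1 addrC; congr (_ + _).
  by rewrite /eta -scalemxAl -scalemxAr !mulmxA.
have bE v w : b 1%g v w = bform B v w.
  by have [rb _ _] := hb; exact: metric_form rb I.
have gE v w : gM x v w = bform (A x) v w by exact: metric_form hgM I.
have pE (v w : 'rV[R]_d * 'rV[R]_n) : product_metric l b gM (1%g, x) v w =
    l ^+ 2 * bform B v.1 w.1 + bform (A x) v.2 w.2.
  by rewrite /product_metric /= bE gE.
have etaB w xi : l ^+ 2 * bform B (eta w) xi = (w *m A x *m (xi *m K x)^T) 0 0.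
  rewrite /eta bformZl mulrA mulfV// mul1r /bform !mulmxA mulmxKV//.
  by rewrite trmx_mul mulmxA.
have hor w : horizontal (prod_charted CG CM) CM (product_metric l b gM)
    (fun z : G * M => act z.1 z.2) (1%g, x) (eta w, w).
  move=> [xi v]; rewrite (mdiff_actD hG hM hact) KmxE => /eqP.
  rewrite addr_eq0 => /eqP xiK; rewrite pE /= etaB xiK /bform linearN mulmxN mxE.
  by rewrite addNr.
apply: bform_inj => w w'; rewrite -bform_mul.
have := sub (1%g, x) I _ _ (hor w) (hor w'); rewrite !img /= act1x.
rewrite (metric_form _ _ rgl I) => ->; rewrite pE /= etaB /N.
have E : w *m A x *m (eta w' *m K x)^T =
    w *m ((l ^+ 2)^-1 *: (A x *m (K x)^T *m invmx B *m K x) *m A x) *m w'^T.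
  rewrite /eta -!scalemxAl linearZ /= -!scalemxAr -scalemxAl; congr (_ *: _).
  by rewrite !trmx_mul !trmxK (trmx_invS BT) AT !mulmxA.
by rewrite /bform mulmxDl mul1mx mulmxDr mulmxDl [RHS]mxE addrC E.
Qed.

Lemma rescaled_deformed (l : R) gl x v w : 0 < l -> cheeger_metric CG CM act l b gM gl ->
  rescaled_metric CG CM act l gl x v w = deformed CG CM act b gM (l ^+ 2) x v w.
Proof.
move=> l0 hgl; have l20 : 0 < l ^+ 2 by rewrite exprn_gt0.
have [rgl _] := hgl.
have sA := spd_gmM hgM x; have sB := spd_gmxG hb.
set N := 1%:M + (l ^+ 2)^-1 *: (A x *m (K x)^T *m invmx B *m K x).
have NGl : N *m gmx gl x *m N^T = N *m A x := cheeger_mx x l0 hgl.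
have sGl : spd (gmx gl x) by exact: spd_gmx rgl I.
have fT := row_base_free (K x); have TK := eq_row_base (K x).
have glE u u' : gl x u u' = bform (gmx gl x) u u' by exact: metric_form rgl I.
pose P := projT (A x) (row_base (K x)).
(* The [gl]-orthogonal projection onto the orbit is the [gM]-orthogonal one: by [cheeger_perpK] the
   vector [u - u *m P] is [gl]-orthogonal to the orbit, and definiteness of [gl] gives
   uniqueness. *)
have PE u : orbit_proj CG CM act gl x u = u *m P.
  rewrite /orbit_proj; apply: xget_unique.
    split; first by apply/orbit_tangentE; exact: projT_sub.
    move=> s /orbit_tangentE/submxP[xi ->]; rewrite glE.
    have -> : u - u *m P = u *m (1%:M - P) by rewrite mulmxBr mulmx1.
    rewrite /bform trmx_mul !mulmxA -(mulmxA u) -(mulmxA u).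
    by rewrite (cheeger_perpK sA sB fT TK l20 erefl sGl.1 NGl) mulmx0 mul0mx mxE.
  move=> t [/orbit_tangentE tK tP]; apply/eqP; rewrite -subr_eq0; apply/eqP.
  apply: (spd_eq0 sGl); rewrite -glE.
  have tt : orbit_tangent CG CM act x (t - u *m P).
    by apply/orbit_tangentE; rewrite addmx_sub// eqmx_opp; exact: projT_sub.
  have yE p : t - p = (u - p) - (u - t).
    by apply/rowP => i; rewrite !mxE; ring.
  rewrite glE; set y := t - u *m P.
  have -> : bform (gmx gl x) y y = bform (gmx gl x) (u - u *m P) y - bform (gmx gl x) (u - t) y.
    by rewrite -bformBl -yE.
  rewrite -[X in _ - X]glE (tP _ tt) subr0.
  move: tt => /orbit_tangentE/submxP[xi]; rewrite -/y => ->.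
  have -> : u - u *m P = u *m (1%:M - P) by rewrite mulmxBr mulmx1.
  rewrite /bform trmx_mul !mulmxA -(mulmxA u) -(mulmxA u).
  by rewrite (cheeger_perpK sA sB fT TK l20 erefl sGl.1 NGl) mulmx0 mul0mx mxE.
rewrite /rescaled_metric !PE !glE /deformed /deform_at.
rewrite (deformT_basis sA sB (ltW l20) fT TK).
rewrite -(cheeger_deform sA sB fT TK l20 erefl sGl.1 NGl).
have E u : u - u *m P = u *m (1%:M - P) by rewrite mulmxBr mulmx1.
rewrite !E !bform_mul /bform mulmxDr mulmxDl [RHS]mxE; congr (_ + _).
by rewrite -scalemxAr -scalemxAl [RHS]mxE.
Qed.

Definition rank_const x := \forall y \near x, \rank (K y) = \rank (K x).

Lemma rank_Kc a x : atlas CM a -> cdom a x ->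
  \rank (K x) = \rank (Kc CG act a (cmap a x)).
Proof.
move=> aa ax; rewrite (KcE hG hM hact aa ax) mxrankMfree//.
by rewrite row_free_unit (pushM_unit hM).
Qed.

Lemma near_chart (a : chart M 'rV[R]_n) x (P : set M) : cdom a x -> nbhs x P ->
  \forall u \near cmap a x, [/\ ccod a u, cdom a (cinv a u), cmap a (cinv a u) = u & P (cinv a u)].
Proof.
move=> ax nP; have : \forall u \near cmap a x, ccod a u /\ P (cinv a u).
  by apply: cinv_nbhs; [exact: cmap_ccod|rewrite cmapK].
apply: filterS => u [au Pu]; split => //; first exact: cinv_cdom.
exact: cinvK.
Qed.

Lemma rank_free r m p (T : 'M[R]_(r, p)) (L : 'M[R]_(m, p)) :
  row_free T -> (T <= L)%MS -> \rank L = r -> (T :=: L)%MS.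
Proof.
move=> fT TL rL; apply/eqmxP; rewrite TL /=.
by rewrite -(geq_leqif (mxrank_leqif_sup TL)) rL; move/eqP: fT => ->.
Qed.

(** [E] is constant: its rows are Lie algebra elements whose fields form a basis at [x]. They stay
    independent while the Gram determinant is nonzero, and constancy of the rank makes them span. *)
Lemma local_frame a x : atlas CM a -> cdom a x -> rank_const x ->
  exists r (E : 'M[R]_(r, d)), \forall u \near cmap a x,
    row_free (E *m Kc CG act a u) /\ (E *m Kc CG act a u :=: Kc CG act a u)%MS.
Proof.
move=> aa ax rk; set K0 := Kc CG act a (cmap a x).
have /submxP[E EE] : (row_base K0 <= K0)%MS by rewrite eq_row_base.
exists (\rank K0), E.
have sK := sm_Kc hact aa ax.
have sT : sm (fun u => E *m Kc CG act a u) (cmap a x).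
  by apply: sm_mul => //; exact: sm_cst.
have dS : \forall u \near cmap a x,
    \det ((E *m Kc CG act a u) *m (cmx CM gM a u) *m (E *m Kc CG act a u)^T) != 0.
  have sS : sm (fun u => (E *m Kc CG act a u) *m (cmx CM gM a u) *m (E *m Kc CG act a u)^T) (cmap a x).
    apply: sm_mul; last exact: sm_tr.
    by apply: sm_mul => //; exact: (sm_cmx hgM openT I aa ax).
  have := sm_continuous (sm_det sS); rewrite /prop_for /continuous_at => /cvgr_neq0.
  apply; rewrite -unitfE -unitmxE; apply: spd_unit; apply: spd_gram.
    exact: (spd_cmx hM hgM I aa ax).
  by rewrite -EE row_base_free.
have nr := near_chart ax rk.
near=> u.
have fE : row_free (E *m Kc CG act a u).
  apply: row_free_ker0 => c cE.
  have uS : (E *m Kc CG act a u) *m (cmx CM gM a u) *m (E *m Kc CG act a u)^T \in unitmx.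
    by rewrite unitmxE unitfE; near: u.
  apply: (row_free_inj0 (A := (E *m Kc CG act a u) *m (cmx CM gM a u) *m (E *m Kc CG act a u)^T)).
    by rewrite row_free_unit.
  by rewrite -(mulmxA (E *m _)) (mulmxA c) cE mul0mx.
split; first exact: fE.
apply: rank_free; [exact: fE|exact: submxMl|].
have [au adu cu ru] : [/\ ccod a u, cdom a (cinv a u), cmap a (cinv a u) = u &
    \rank (K (cinv a u)) = \rank (K x)] by near: u.
have e1 := rank_Kc aa adu; rewrite cu in e1.
exact: etrans (esym e1) (etrans ru (rank_Kc aa ax)).
Unshelve. all: by end_near. Qed.

(* Joint smoothness in [s = l^2] at [s = 0] gives the convergence of all derivatives. *)
Lemma sm_deform_joint a x (s0 : R) : atlas CM a -> cdom a x -> rank_const x -> 0 <= s0 ->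
  exists F : R * 'rV[R]_n -> 'M[R]_n, sm F (s0, cmap a x) /\
    \forall u \near cmap a x, forall s, 0 <= s -> deform_c CG CM act b gM a s u = F (s, u).
Proof.
move=> aa ax rk s00; have [r [E HE]] := local_frame aa ax rk.
pose T u := E *m Kc CG act a u.
(* In the local frame the formula makes sense on both sides of [s0], so [F] is smooth in the
   two-sided sense even at [s0 = 0]; agreement with [deform_c] is needed only for [s >= 0]. *)
exists (fun z => deformT (cmx CM gM a z.2) B (Kc CG act a z.2) z.1 (T z.2)); split; last first.
  have nT := near_chart ax (cdom_nbhs ax).
  near=> u => s sge0.
  have [au adu cu _] : [/\ ccod a u, cdom a (cinv a u), cmap a (cinv a u) = u & cdom a (cinv a u)] by near: u.
  have [fE EK] : row_free (T u) /\ (T u :=: Kc CG act a u)%MS by near: u.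
  rewrite /deform_c (deformT_basis _ (spd_gmxG hb) sge0 fE EK)//.
  by rewrite -cu; exact: (spd_cmx hM hgM I aa adu).
have [fE0 EK0] := nbhs_singleton HE.
have sA0 := spd_cmx hM hgM I aa ax.
have c2 m p (f : 'rV[R]_n -> 'M[R]_(m, p)) : sm f (cmap a x) ->
    sm (fun z : R * 'rV[R]_n => f z.2) (s0, cmap a x).
  by move=> sf; apply: sm_comp; [exact: fdim_rV|exact: sm_snd|].
have sK := c2 _ _ _ (sm_Kc hact aa ax).
have sA := c2 _ _ _ (sm_cmx hgM openT I aa ax).
have sT : sm (fun z : R * 'rV[R]_n => T z.2) (s0, cmap a x).
  by apply: sm_mul => //; exact: sm_cst.
have sTT := sm_tr sT.
have sg : sm (fun z : R * 'rV[R]_n => gramT (cmx CM gM a z.2) (T z.2)) (s0, cmap a x).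
  by apply: sm_mul => //; exact: sm_mul.
have sl : sm (fun z : R * 'rV[R]_n => liftT (cmx CM gM a z.2) (Kc CG act a z.2) (T z.2)) (s0, cmap a x).
  by apply: sm_mul; [exact: sm_mul|exact: sm_tr].
have sv : sm (fun z : R * 'rV[R]_n => vertT (cmx CM gM a z.2) B (Kc CG act a z.2) (T z.2)) (s0, cmap a x).
  by apply: sm_mul; [apply: sm_mul => //; exact: sm_cst|exact: sm_tr].
have AT := sm_mul sA sTT.
have part (X : R * 'rV[R]_n -> 'M[R]_r) : X (s0, cmap a x) \in unitmx ->
    sm X (s0, cmap a x) -> sm (fun z => cmx CM gM a z.2 *m (T z.2)^T *m invmx (X z) *m T z.2 *m cmx CM gM a z.2) (s0, cmap a x).
  move=> uX sX; apply: sm_mul => //; apply: sm_mul => //; apply: sm_mul => //.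
  exact: sm_inv.
apply: smB; last first.
  by apply: part => //; exact: (spd_unit (spd_gramT sA0 fE0)).
apply: smD => //; apply: part.
  exact: (spd_unit (spd_sumT sA0 (spd_gmxG hb) fE0 EK0 s00)).
apply: smD => //; apply: smZ => //; exact: sm_fst.
Unshelve. all: by end_near. Qed.

Lemma sm_deform_c a x (s : R) : atlas CM a -> cdom a x -> rank_const x -> 0 <= s ->
  sm (deform_c CG CM act b gM a s) (cmap a x).
Proof.
move=> aa ax rk s0; have [F [sF FE]] := sm_deform_joint aa ax rk s0.
apply: (@sm_eq _ _ _ (fun u => F (s, u))).
  by apply: filterS FE => u ->.
apply: (@sm_comp _ _ _ _ _ (fun u => (s, u)) F) => //.
  by apply: fdim_prod; [exact: fdim_R|exact: fdim_rV].
by apply: sm_pair; [exact: sm_cst|exact: sm_id].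
Qed.

Lemma deformed_metric (U : set M) (s : R) : open U -> (forall x, U x -> rank_const x) ->
  0 <= s -> riemannian_metric CM U (deformed CG CM act b gM s).
Proof.
move=> oU rk s0; split.
- by move=> x Ux r v v' w; rewrite /deformed bformDl bformZl.
- by move=> x Ux v w; rewrite /deformed bformC//; have [] := spd_deform_at act hb hgM x s0.
- by move=> x Ux v v0; apply: (spd_deform_at act hb hgM x s0).2.
move=> a aa v w; apply: sm_smooth => u [au Uu].
have ad := cinv_cdom au.
rewrite -(cinvK au).
apply: (@sm_eq _ _ _ (fun u => (v *m deform_c CG CM act b gM a s u *m w^T) 0 0)).
  have := near_chart ad (open_nbhs_nbhs (conj oU Uu)).
  apply: filterS => u' [au' ad' cu' _].
  have E := comp_deformed hG hM hact hb hgM v w s0 aa ad'.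
  by rewrite cu' in E; exact: (esym E).
apply: sm_coord; apply: sm_mul; last exact: sm_cst.
apply: sm_mul; first exact: sm_cst.
by apply: sm_deform_c => //; exact: rk.
Qed.

End DeformedMetric.

(** * Local constancy of the orbit dimension *)

Lemma nbhs_small_ball {R : realType} (V : normedModType R) (x : V) (P : set V) :
  nbhs x P -> \forall r \near (0 : R)^'+, forall y, `|y - x| < r -> P y.
Proof.
move=> /nbhs_ballP[e /= e0 eP]; near=> r => y yr; apply: eP.
rewrite -ball_normE /= distrC; apply: lt_trans yr _.
by near: r; exact: nbhs_right_lt.
Unshelve. all: by end_near. Qed.

Lemma nbhs_small_ball2 {R : realType} (V W : normedModType R) (x : V) (y : W) (P : set (V * W)) :
  nbhs (x, y) P -> \forall r \near (0 : R)^'+, forall v w,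
    `|v - x| < r -> `|w - y| < r -> P (v, w).
Proof.
move=> /nbhs_small_ball; apply: filterS => r rP v w vr wr; apply: rP.
by rewrite prod_normE /= gt_max vr wr.
Qed.

Lemma leq_of_sub (p q r : nat) : (q <= r -> p <= r -> r - p <= r - q -> q <= p)%N.
Proof. lia. Qed.

Section Stabilizer.
Context {R : realType} (d n : nat) (G : topGroupType) (M : topologicalType).
Context (CG : charted G 'rV[R]_d) (CM : charted M 'rV[R]_n) (act : G -> M -> M).
Hypotheses (hG : lie_group CG) (hM : smooth_manifold CM) (hact : smooth_action CG CM act).

Local Notation K := (Kmx CG CM act).
Local Notation kap := (chart_at CG 1%g).
Local Notation e := (idG CG).

Let act1 x : act 1%g x = x. Proof. by case: hact. Qed.
Let actM h k x : act (h * k)%g x = act h (act k x). Proof. by case: hact. Qed.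
Let kap1 : cdom kap 1%g. Proof. exact: chart_at_cdom. Qed.
Let pe : cinv kap e = 1%g. Proof. exact: cmapK. Qed.

Definition mulc (z : 'rV[R]_d * 'rV[R]_d) : 'rV[R]_d :=
  cmap kap (cinv kap z.1 * cinv kap z.2)%g.

Lemma sm_mulc : sm mulc (e, e).
Proof.
have H : smat (prod_charted CG CG) CG (fun z : G * G => (z.1 * z.2)%g) (1%g, 1%g).
  by apply: smat_map openT I _; case: hG.
have [_ {}H] := H.
apply: (H (prod_chart kap kap) kap) => //=; last by rewrite mulg1.
- by exists kap, kap; split => //; exact: chart_at_atlas.
- exact: chart_at_atlas.
Qed.

Lemma mulc_dom : \forall z \near (e, e), [/\ ccod kap z.1, ccod kap z.2 &
  cdom kap (cinv kap z.1 * cinv kap z.2)%g].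
Proof.
have H : smat (prod_charted CG CG) CG (fun z : G * G => (z.1 * z.2)%g) (1%g, 1%g).
  by apply: smat_map openT I _; case: hG.
have [cH _] := H.
have n1 : \forall z \near (1%g, 1%g), cdom kap (z.1 * z.2)%g.
  by apply: cH; rewrite /= mulg1; exact: cdom_nbhs.
have ce : ccod kap e by exact: cmap_ccod.
have := @cinv_nbhs _ _ _ (prod_chart kap kap) _ (e, e) (conj ce ce).
rewrite /= pe => /(_ _ n1); apply: filterS => z [[z1 z2] zd]; split => //.
Qed.

Lemma diff_mulc h : 'd mulc (e, e) (0, h) = h.
Proof.
rewrite -diff_fixl; last exact: sm_differentiable sm_mulc.
have [||_ ->] := @near_eq_diff _ _ _ id (fun w => mulc (e, w)) e.
- apply: filterS (ccod_nbhs (cmap_ccod kap1)) => u au.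
  by rewrite /mulc /= pe mul1g cinvK.
- exact: ex_diff.
- by rewrite (@diff_lin _ _ _ idfun)// => y; exact: cvg_id.
Qed.

(** Strict differentiability at [(e, e)], applied to [(u, w)] and [(u, e)]: in the chart,
    multiplying by [w] is translation by [w - e] with a small relative error, uniformly in [u].
    Errors can therefore be summed over many factors. *)
Lemma mulc_step (eps : R) : 0 < eps -> \forall r \near (0 : R)^'+, forall u w,
  `|u - e| < r -> `|w - e| < r -> [/\ ccod kap u,
    cinv kap (mulc (u, w)) = (cinv kap u * cinv kap w)%g,
    ccod kap (mulc (u, w)) &
    `|mulc (u, w) - u - (w - e)| <= eps * `|w - e|].
Proof.
move=> eps0.
have H1 := ck1_strict (fdim_prod (fdim_rV d) (fdim_rV d)) (sm_mulc 1%N) eps0.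
have {}H1 := nbhs_small_ball2 H1.
have H2 := nbhs_small_ball2 mulc_dom.
near=> r.
have st : forall z1 z2 : 'rV[R]_d * 'rV[R]_d, `|z1 - (e, e)| < r -> `|z2 - (e, e)| < r ->
    `|mulc z1 - mulc z2 - 'd mulc (e, e) (z1 - z2)| <= eps * `|z1 - z2|.
  by near: r; apply: filterS H1 => r H z1 z2 h1 h2; exact: (H z1 z2 h1 h2).
have dm : forall u w, `|u - e| < r -> `|w - e| < r ->
    [/\ ccod kap u, ccod kap w & cdom kap (cinv kap u * cinv kap w)%g].
  by near: r; exact: H2.
move=> u w ur wr; have r0 : 0 < r by apply: le_lt_trans ur.
have [cu cw cuw] := dm _ _ ur wr.
split => //; [by rewrite /mulc cmapK|exact: cmap_ccod|].
have := st (u, w) (u, e).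
rewrite -[(u, w) - (u, e)]/(u - u, w - e) subrr diff_mulc.
have -> : mulc (u, e) = u by rewrite /mulc /= pe mulg1 cinvK.
have -> : `|(0 : 'rV[R]_d, w - e)| = `|w - e| by rewrite prod_normE /= normr0 max_r.
apply.
- by rewrite -[(u, w) - (e, e)]/(u - e, w - e) prod_normE /= gt_max ur wr.
- by rewrite -[(u, e) - (e, e)]/(u - e, e - e) prod_normE /= gt_max ur subrr normr0.
Unshelve. all: by end_near. Qed.

Lemma actc_dom (a : chart M 'rV[R]_n) x : cdom a x -> \forall z \near (e, cmap a x),
  [/\ ccod kap z.1, ccod a z.2 & cdom a (act (cinv kap z.1) (cinv a z.2))].
Proof.
move=> ax.
have [cH _] : smat (prod_charted CG CM) CM (fun z : G * M => act z.1 z.2) (1%g, x).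
  by apply: smat_map openT I _; case: hact.
have n1 : \forall z \near (1%g, x), cdom a (act z.1 z.2).
  by apply: cH; rewrite /= act1; exact: cdom_nbhs.
have ce : ccod kap e by exact: cmap_ccod.
have := @cinv_nbhs _ _ _ (prod_chart kap a) _ (e, cmap a x) (conj ce (cmap_ccod ax)).
rewrite /= pe cmapK// => /(_ _ n1); apply: filterS => z [[z1 z2] zd]; split => //.
Qed.

(** Strict differentiability bounds the increment in [y], uniformly in [u], by the norm [k] of the
    differential plus an error of slope 1; hence [L = k + 1]. *)
Lemma actc_step a x : atlas CM a -> cdom a x -> exists2 L : R, 0 < L &
  \forall r \near (0 : R)^'+, forall u y y',
  `|u - e| < r -> `|y - cmap a x| < r -> `|y' - cmap a x| < r ->
  [/\ cdom a (act (cinv kap u) (cinv a y)), ccod a y,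
   {for u, continuous (fun u => actc CG act a (u, cmap a x))} &
   `|actc CG act a (u, y) - actc CG act a (u, y')| <= L * `|y - y'|].
Proof.
move=> aa ax; have sa := sm_actc hact aa ax.
have [k k0 kP] := linear_lipschitz (diff_continuous (sm_differentiable sa)).
exists (k + 1); first by rewrite addr_gt0.
have H1 := nbhs_small_ball2 (ck1_strict (fdim_prod (fdim_rV d) (fdim_rV n)) (sa 1%N) ltr01).
have H2 := nbhs_small_ball2 (actc_dom ax).
have H3 := nbhs_small_ball2 (sm_near_differentiable sa).
near=> r.
have st : forall z1 z2 : 'rV[R]_d * 'rV[R]_n,
    `|z1 - (e, cmap a x)| < r -> `|z2 - (e, cmap a x)| < r ->
    `|actc CG act a z1 - actc CG act a z2 - 'd (actc CG act a) (e, cmap a x) (z1 - z2)|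
      <= 1 * `|z1 - z2|.
  by near: r; apply: filterS H1 => r H z1 z2 h1 h2; exact: (H z1 z2 h1 h2).
have dm : forall u y, `|u - e| < r -> `|y - cmap a x| < r ->
    [/\ ccod kap u, ccod a y & cdom a (act (cinv kap u) (cinv a y))].
  by near: r; exact: H2.
have df : forall u y, `|u - e| < r -> `|y - cmap a x| < r -> differentiable (actc CG act a) (u, y).
  by near: r; exact: H3.
move=> u y y' ur yr y'r; have r0 : 0 < r by apply: le_lt_trans ur.
have [cu cy cuy] := dm _ _ ur yr.
split => //.
  have du : differentiable (actc CG act a) (u, cmap a x).
    by apply: df; rewrite ?subrr ?normr0.
  have c1 : {for u, continuous (fun u : 'rV[R]_d => (u, cmap a x))}.
    exact: (sm_continuous (sm_pair (@sm_id _ _ u) (@sm_cst _ _ _ (cmap a x) u))).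
  apply: (@continuous_comp _ _ _ (fun u : 'rV[R]_d => (u, cmap a x)) (actc CG act a)) => //.
  exact: differentiable_continuous.
have nE : `|(0 : 'rV[R]_d, y - y')| = `|y - y'| by rewrite prod_normE /= normr0 max_r.
have H : `|actc CG act a (u, y) - actc CG act a (u, y')
    - 'd (actc CG act a) (e, cmap a x) (0, y - y')| <= `|y - y'|.
  have := st (u, y) (u, y').
  rewrite -[(u, y) - (u, y')]/(u - u, y - y') subrr mul1r nE; apply.
  - by rewrite -[(u, y) - _]/(u - e, y - cmap a x) prod_normE /= gt_max ur yr.
  - by rewrite -[(u, y') - _]/(u - e, y' - cmap a x) prod_normE /= gt_max ur y'r.
have := kP (0, y - y'); rewrite nE => H'.
rewrite mulrDl mul1r [leRHS]addrC; apply: (le_trans _ (lerD H H')).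
by rewrite -[X in `|X| <= _](subrK ('d (actc CG act a) (e, cmap a x) (0, y - y'))) ler_normD.
Unshelve. all: by end_near. Qed.

(** The first-order term of the displacement of [x] is [s] times the action field of [xi] in the
    chart, which vanishes. *)
Lemma actc_first_order a x xi (eta : R) : atlas CM a -> cdom a x -> xi *m K x = 0 ->
  0 < eta -> \forall s \near (0 : R)^'+,
    `|actc CG act a (e + s *: xi, cmap a x) - cmap a x| <= s * eta.
Proof.
move=> aa ax xiK eta0; have sa := sm_actc hact aa ax.
have xiKc : xi *m Kc CG act a (cmap a x) = 0.
  move: xiK; rewrite (KcE hG hM hact aa ax) mulmxA => /(congr1 (mulmx^~ (invmx (pushM CM a x)))).
  by rewrite mul0mx mulmxK// (pushM_unit hM).
have d0 : 'd (actc CG act a) (e, cmap a x) (xi, 0) = 0.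
  by have := nbhs_singleton (Kc_near hact aa ax) xi; rewrite xiKc => <-.
have eta'0 : 0 < eta / (1 + `|xi|) by rewrite divr_gt0// ltr_wpDr.
have := nbhs_small_ball2 (ck1_strict (fdim_prod (fdim_rV d) (fdim_rV n)) (sa 1%N) eta'0).
move=> H1; near (0 : R)^'+ => r.
have r0 : 0 < r by near: r; exact: nbhs_right_gt.
have st : forall z1 z2 : 'rV[R]_d * 'rV[R]_n,
    `|z1 - (e, cmap a x)| < r -> `|z2 - (e, cmap a x)| < r ->
    `|actc CG act a z1 - actc CG act a z2 - 'd (actc CG act a) (e, cmap a x) (z1 - z2)|
      <= eta / (1 + `|xi|) * `|z1 - z2|.
  by near: r; apply: filterS H1 => r H z1 z2 h1 h2; exact: (H z1 z2 h1 h2).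
near=> s; have s0 : 0 < s by near: s; exact: nbhs_right_gt.
have sr : s < r / (1 + `|xi|).
  by near: s; apply: nbhs_right_lt; rewrite divr_gt0// ltr_wpDr.
have nx : s * `|xi| <= s * (1 + `|xi|).
  by apply: ler_wpM2l; [exact: ltW|rewrite lerDr].
have := st (e + s *: xi, cmap a x) (e, cmap a x).
have -> : (e + s *: xi, cmap a x) - (e, cmap a x) = s *: (xi, 0).
  by congr pair; rewrite /= ?subrr ?scaler0// addrAC subrr add0r.
rewrite linearZ /= d0 scaler0 subr0.
have -> : actc CG act a (e, cmap a x) = cmap a x by rewrite /actc /= pe cmapK// act1.
have -> : `|s *: (xi, 0 : 'rV[R]_n)| = s * `|xi|.
  by rewrite normrZ gtr0_norm// prod_normE /= normr0 max_l.
move=> H; apply: le_trans (H _ _) _.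
- by apply: le_lt_trans nx _; rewrite -ltr_pdivlMr// ltr_wpDr.
- by rewrite subrr normr0.
apply: le_trans (ler_wpM2l (ltW eta'0) nx) _.
have x0 : 0 < 1 + `|xi| by rewrite ltr_wpDr.
by rewrite mulrCA divfK ?gt_eqF.
Unshelve. all: by end_near. Qed.

(* Discretized one-parameter subgroup: [(w_N)^N], [w_N = e + (t / N) xi], stays
   within [eps t] of [e + t xi] and moves [x] by [o(1)] as [N] grows, since [xi]
   kills [x] to first order. *)
Lemma discrete_flow a x xi (eps : R) : atlas CM a -> cdom a x -> xi *m K x = 0 ->
  0 < eps -> \forall t \near (0 : R)^'+,
    (forall c, `|c - e - t *: xi| <= eps * t -> ccod kap c /\
      cdom a (act (cinv kap c) x) /\
      {for c, continuous (fun u => actc CG act a (u, cmap a x))}) /\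
    forall eta : R, 0 < eta ->
    exists2 c, `|c - e - t *: xi| <= eps * t &
      `|actc CG act a (c, cmap a x) - cmap a x| <= eta.
Proof.
move=> aa ax xiK eps0; set y0 := cmap a x.
have x0 : 0 < 1 + `|xi| by rewrite ltr_wpDr.
have eps'0 : 0 < eps / (1 + `|xi|) by rewrite divr_gt0.
have [L L0 Lst] := actc_step aa ax.
have Mst := mulc_step eps'0.
near (0 : R)^'+ => r.
have r0 : 0 < r by near: r; exact: nbhs_right_gt.
have ms : forall u w, `|u - e| < r -> `|w - e| < r -> [/\ ccod kap u,
    cinv kap (mulc (u, w)) = (cinv kap u * cinv kap w)%g,
    ccod kap (mulc (u, w)) & `|mulc (u, w) - u - (w - e)| <= eps / (1 + `|xi|) * `|w - e|].
  by near: r; exact: Mst.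
have acs : forall u y y', `|u - e| < r -> `|y - y0| < r -> `|y' - y0| < r ->
    [/\ cdom a (act (cinv kap u) (cinv a y)), ccod a y,
     {for u, continuous (fun u => actc CG act a (u, y0))} &
     `|actc CG act a (u, y) - actc CG act a (u, y')| <= L * `|y - y'|].
  by near: r; exact: Lst.
near=> t.
have t0 : 0 < t by near: t; exact: nbhs_right_gt.
have tr : t * (1 + `|xi| + eps) < r.
  rewrite -ltr_pdivlMr; last by rewrite ltr_wpDl// ltW.
  by near: t; apply: nbhs_right_lt; rewrite divr_gt0// ltr_wpDl// ltW.
have inb (c : 'rV[R]_d) (k : R) : 0 <= k <= t -> `|c - e - k *: xi| <= eps * k -> `|c - e| < r.
  move=> /andP[k0 kt] ck; rewrite -(subrK (k *: xi) (c - e)).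
  apply: le_lt_trans (ler_normD _ _) _; rewrite normrZ ger0_norm//.
  apply: le_lt_trans tr; apply: le_trans (lerD ck (lexx _)) _.
  rewrite -mulrC -mulrDr; apply: ler_pM => //; first by rewrite addr_ge0// ltW.
  by rewrite addrC lerD2r lerDr.
have y00 : `|y0 - y0| < r by rewrite subrr normr0.
split.
  move=> c ct; have cr : `|c - e| < r by apply: inb ct; rewrite lexx ltW.
  have [ca _ cc _] := acs c y0 y0 cr y00 y00.
  have e0 : `|e - e| < r by rewrite subrr normr0.
  have [cc' _ _ _] := ms c e cr e0.
  by split => //; split => //; rewrite cmapK in ca.
move=> eta eta0.
(* The first bound makes the displacements of [N] steps, each stretched by at most [L], add up to
   [eta]; the second keeps the once displaced point in the ball of radius [r]. *)
have eta'0 : 0 < Num.min (eta / (L * t)) (r / t / 2) by rewrite lt_min !divr_gt0// mulr_gt0.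
have fo := actc_first_order aa ax xiK eta'0.
have [N [N0 [Nxi Nfo]]] : exists N : nat, (0 < N)%N /\ `|(t / N%:R) *: xi| < r /\
    `|actc CG act a (e + (t / N%:R) *: xi, y0) - y0|
      <= t / N%:R * Num.min (eta / (L * t)) (r / t / 2).
  have /nbhs_ballP[d0 /= dd0 H] : \forall s \near (0 : R), 0 < s ->
     `|actc CG act a (e + s *: xi, y0) - y0| <= s * Num.min (eta / (L * t)) (r / t / 2).
    exact: fo.
  have [N HN] : exists N : nat, t / d0 < N%:R.
    by exists (Num.bound (t / d0)); apply: archi_boundP; rewrite divr_ge0// ltW.
  exists N.+1; split => //.
  have NN0 : 0 < N.+1%:R :> R by rewrite ltr0n.
  split.
    rewrite normrZ gtr0_norm ?divr_gt0//.
    apply: le_lt_trans tr; apply: ler_pM => //; first by rewrite ltW// divr_gt0.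
      by rewrite ler_pdivrMr// ler_peMr ?ler1n// ltW.
    by rewrite addrAC lerDr addr_ge0// ltW.
  apply: H; last by rewrite divr_gt0.
  rewrite -ball_normE /= sub0r normrN gtr0_norm ?divr_gt0// ltr_pdivrMr//.
  by rewrite -ltr_pdivrMl// mulrC; apply: lt_le_trans HN _; rewrite ler_nat.
have NR0 : 0 < N%:R :> R by rewrite ltr0n.
set s := t / N%:R in Nxi Nfo; have s0 : 0 < s by rewrite divr_gt0.
pose w := e + s *: xi; pose y1 := actc CG act a (w, y0).
have we : w - e = s *: xi by rewrite /w addrAC subrr add0r.
have wr : `|w - e| < r by rewrite we.
have sle : s <= t by rewrite /s ler_pdivrMr// ler_peMr ?(ltW t0)// ler1n.
have y1r : `|y1 - y0| < r.
  apply: le_lt_trans Nfo _.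
  apply: (@le_lt_trans _ _ (s * (r / t / 2))).
    by apply: ler_wpM2l; [exact: ltW|rewrite ge_min lexx orbT].
  apply: (@le_lt_trans _ _ (t * (r / t / 2))).
    by apply: ler_wpM2r => //; rewrite ltW// !divr_gt0.
  have -> : t * (r / t / 2) = r / 2 by field; rewrite gt_eqF.
  lra.
have y1s : `|y1 - y0| <= s * (eta / (L * t)).
  apply: le_trans Nfo _.
  by apply: ler_wpM2l; [exact: ltW|rewrite ge_min lexx].
(* The powers of [cinv kap w], in coordinates. Each multiplication errs by at most [eps * s], so the
   total error is at most [eps * t] whatever [N] is. *)
pose u := fix u k := if k is k'.+1 then mulc (u k', w) else e.
have uP k : (k <= N)%N -> `|u k - e - (k%:R * s) *: xi| <= eps * (k%:R * s) /\
   `|actc CG act a (u k, y0) - y0| <= k%:R * (L * (s * (eta / (L * t)))) /\ ccod kap (u k).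
  elim: k => [|k IH] kN.
    rewrite /= mul0r scale0r subr0 subrr normr0 mulr0 lexx.
    have -> : actc CG act a (e, y0) = y0 by rewrite /actc /= pe /y0 cmapK// act1.
    by rewrite subrr normr0 mul0r; split => //; split => //; exact: cmap_ccod.
  have {IH}[IH1 [IH2 IH3]] := IH (ltnW kN).
  have kst : 0 <= k%:R * s <= t.
    rewrite mulr_ge0 ?(ltW s0)//= /s mulrCA ler_piMr ?(ltW t0)// ler_pdivrMr// mul1r ler_nat.
    exact: ltnW.
  have ur := inb _ _ kst IH1.
  have [_ mE mc mle] := ms _ _ ur wr.
  split.
    rewrite /= -/(u k) -natr1 [_ * s]mulrDl mul1r scalerDl.
    have -> : mulc (u k, w) - e - ((k%:R * s) *: xi + s *: xi) =
        (mulc (u k, w) - u k - (w - e)) + (u k - e - (k%:R * s) *: xi).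
      rewrite we; move: (mulc _) (_ *: xi) (s *: xi) => p q q'.
      by apply/rowP => i; rewrite !mxE; ring.
    apply: le_trans (ler_normD _ _) _; rewrite mulrDr addrC; apply: lerD => //.
    apply: le_trans mle _; rewrite we normrZ gtr0_norm//.
    have -> : eps / (1 + `|xi|) * (s * `|xi|) = eps * s * (`|xi| / (1 + `|xi|)) by field; rewrite gt_eqF.
    rewrite ler_piMr ?mulr_ge0 ?(ltW eps0) ?(ltW s0)// ler_pdivrMr// mul1r.
    by rewrite lerDr.
  split => //.
  have [_ _ _ le1] := acs _ _ _ ur y1r y00.
  have [dw _ _ _] := acs w y0 y0 wr y00 y00.
  rewrite cmapK// in dw.
  (* Since [w^(k+1) x = w^k (w x)], the new displacement is the first one transported by [w^k],
     which stretches it by at most [L], plus the displacement under [w^k]. *)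
  have -> : actc CG act a (u k.+1, y0) = actc CG act a (u k, y1).
    have -> : u k.+1 = mulc (u k, w) by [].
    rewrite /actc [(mulc _, y0).1]/= mE actM [(mulc _, y0).2]/=.
    by rewrite /y1 /actc /= /y0 (cmapK ax) cmapK.
  have -> : actc CG act a (u k, y1) - y0 =
      (actc CG act a (u k, y1) - actc CG act a (u k, y0)) + (actc CG act a (u k, y0) - y0).
    by rewrite addrA subrK.
  apply: le_trans (ler_normD _ _) _; rewrite -natr1 mulrDl mul1r addrC.
  by apply: lerD => //; apply: le_trans le1 _; apply: ler_wpM2l => //; exact: ltW.
exists (u N).
  have [+ _] := uP _ (leqnn N).
  by have -> : N%:R * s = t by rewrite /s mulrC divfK// gt_eqF.
have [_ [+ _]] := uP _ (leqnn N); move=> /le_trans; apply.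
rewrite le_eqVlt; apply/orP; left; apply/eqP.
by rewrite /s; field; rewrite !gt_eqF.
Unshelve. all: by end_near. Qed.

(* The Lie algebra of a stabilizer is the kernel of the infinitesimal action. *)
Lemma stabilizer_flow a x xi (eps : R) : atlas CM a -> cdom a x -> xi *m K x = 0 ->
  0 < eps -> \forall t \near (0 : R)^'+, exists c,
    [/\ `|c - e - t *: xi| <= eps * t, ccod kap c & act (cinv kap c) x = x].
Proof.
move=> aa ax xiK eps0; have := discrete_flow aa ax xiK eps0.
move=> H; near=> t.
have t0 : 0 < t by near: t; exact: nbhs_right_gt.
have [Hd Hs] : (forall c, `|c - e - t *: xi| <= eps * t -> ccod kap c /\
      cdom a (act (cinv kap c) x) /\
      {for c, continuous (fun u => actc CG act a (u, cmap a x))}) /\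
    forall eta : R, 0 < eta ->
    exists2 c, `|c - e - t *: xi| <= eps * t &
      `|actc CG act a (c, cmap a x) - cmap a x| <= eta.
  by near: t.
pose C0 := e + t *: xi; pose A := [set c : 'rV[R]_d | `|c - e - t *: xi| <= eps * t].
have AE c : c - e - t *: xi = c - C0 by rewrite /C0 opprD addrA.
have cN : continuous (fun c : 'rV[R]_d => `|c - C0|).
  move=> c; apply: (@continuous_comp _ _ _ (fun c : 'rV[R]_d => c - C0) Num.Def.normr c).
    exact: (sm_continuous (smB (@sm_id _ _ c) (@sm_cst _ _ _ C0 c))).
  exact: norm_continuous.
have cA : compact A.
  apply: bounded_closed_compact.
    exists (eps * t + `|C0|); split; first exact: num_real.
    move=> m mb c; rewrite /A /= AE => cC; apply: ltW; apply: le_lt_trans mb.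
    rewrite -[c in `|c|](subrK C0); apply: le_trans (ler_normD _ _) _.
    by rewrite lerD2r.
  rewrite (_ : A = (fun c => `|c - C0|) @^-1` [set y | y <= eps * t]).
    apply: closed_comp; last exact: closed_le.
    by move=> c _; exact: cN.
  by apply/seteqP; split => c; rewrite /A /= AE.
have A0 : A !=set0 by exists C0; rewrite /A /= AE subrr normr0 mulr_ge0 ?ltW.
have cf : {within A, continuous (fun c => `|actc CG act a (c, cmap a x) - cmap a x|)}.
  apply/subspace_continuousP => c Ac; have [_ [_ cc]] := Hd c Ac.
  apply: cvg_within_filter.
  by apply: cvg_norm; apply: cvgB; [exact: cc|exact: cvg_cst].
(* By [discrete_flow] the displacement of [x] is arbitrarily small on the compact ball [A]; its
   minimum there is thus zero and is attained. *)
have [c Ac cmin] := EVT_min_rV A0 cA cf.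
rewrite inE in Ac; have [cc [ca _]] := Hd c Ac.
exists c; split => //.
have : actc CG act a (c, cmap a x) = cmap a x.
  apply/eqP; rewrite -subr_eq0 -normr_le0; apply/ler_addgt0Pr => eta eta0; rewrite add0r.
  have [c' Ac' c'e] := Hs _ eta0.
  by apply: le_trans c'e; apply: cmin; rewrite inE.
rewrite /actc /= cmapK// => /(congr1 (cinv a)).
by rewrite !cmapK.
Unshelve. all: by end_near. Qed.

(** In the chart, the stabilizer of [x] contains elements [e + t xi + o(t)], and they fix [x'] too;
    the derivative of the orbit map of [x'] along [xi] is therefore zero. *)
Lemma kernel_stabilizer x x' (xi : 'rV[R]_d) : xi *m K x = 0 ->
  (forall k, act k x = x -> act k x' = x') -> xi *m K x' = 0.
Proof.
move=> xiK stab; set a := chart_at CM x; set a' := chart_at CM x'.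
have ax : cdom a x by exact: chart_at_cdom.
have ax' : cdom a' x' by exact: chart_at_cdom.
have aa : atlas CM a by exact: chart_at_atlas.
have aa' : atlas CM a' by exact: chart_at_atlas.
have sa := sm_actc hact aa' ax'.
suff Kc0 : xi *m Kc CG act a' (cmap a' x') = 0.
  by rewrite (KcE hG hM hact aa' ax') mulmxA Kc0 mul0mx.
pose psi u := actc CG act a' (u, cmap a' x').
have spsi : sm psi e.
  apply: (@sm_comp _ _ _ _ _ (fun u : 'rV[R]_d => (u, cmap a' x')) (actc CG act a')) => //.
    by apply: fdim_prod; exact: fdim_rV.
  by apply: sm_pair; [exact: sm_id|exact: sm_cst].
have dpsi h : 'd psi e h = h *m Kc CG act a' (cmap a' x').
  rewrite /psi (diff_fixr _ (sm_differentiable sa)).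
  by rewrite (nbhs_singleton (Kc_near hact aa' ax')).
have psie : psi e = cmap a' x' by rewrite /psi /actc /= pe act1 cmapK.
rewrite -dpsi; apply/eqP; rewrite -normr_le0; apply/ler_addgt0Pr => eta eta0; rewrite add0r.
have [k k0 kP] := linear_lipschitz (diff_continuous (sm_differentiable spsi)).
(* Chosen so that [eps <= 1] and [eps * (|xi| + eps + k) <= eta], the bound that remains after
   division by [t]. *)
pose eps := eta / (k + 1 + `|xi| + 1 + eta).
have den : 0 < k + 1 + `|xi| + 1 + eta by have := normr_ge0 xi; lra.
have eps0 : 0 < eps by rewrite divr_gt0.
have := nbhs_small_ball2 (ck1_strict (fdim_rV d) (spsi 1%N) eps0).
move=> Hst; near (0 : R)^'+ => r.
have r0 : 0 < r by near: r; exact: nbhs_right_gt.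
have st : forall u v, `|u - e| < r -> `|v - e| < r ->
   `|psi u - psi v - 'd psi e (u - v)| <= eps * `|u - v|.
  by near: r; exact: Hst.
near (0 : R)^'+ => t.
have t0 : 0 < t by near: t; exact: nbhs_right_gt.
have [c [ct cc cx]] : exists c,
    [/\ `|c - e - t *: xi| <= eps * t, ccod kap c & act (cinv kap c) x = x].
  by near: t; exact: (stabilizer_flow aa ax xiK eps0).
have tr : t * (`|xi| + eps) < r.
  rewrite -ltr_pdivlMr; last by rewrite ltr_wpDl.
  by near: t; apply: nbhs_right_lt; rewrite divr_gt0// ltr_wpDl.
have psic : psi c = psi e by rewrite psie /psi /actc /= cmapK// stab.
have ce : `|c - e| <= t * (`|xi| + eps).
  rewrite -(subrK (t *: xi) (c - e)); apply: le_trans (ler_normD _ _) _.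
  by rewrite normrZ gtr0_norm// mulrDr addrC lerD2l mulrC.
have e0 : `|e - e| < r by rewrite subrr normr0.
have := st c e (le_lt_trans ce tr) e0; rewrite psic subrr sub0r normrN => H.
have E : t *: 'd psi e xi = 'd psi e (c - e) - 'd psi e (c - e - t *: xi).
  by rewrite -linearB -linearZ; congr ('d _ _ _); rewrite opprB addrC subrK.
have : t * `|'d psi e xi| <= eps * (t * (`|xi| + eps)) + k * (eps * t).
  rewrite -{1}(gtr0_norm t0) -normrZ E; apply: le_trans (ler_normB _ _) _.
  apply: lerD; first by apply: le_trans H _; apply: ler_wpM2l => //; exact: ltW.
  by apply: le_trans (kP _) _; apply: ler_wpM2l => //; exact: ltW.
have -> : eps * (t * (`|xi| + eps)) + k * (eps * t) = t * (eps * (`|xi| + eps + k)) by ring.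
rewrite ler_pM2l// => /le_trans; apply.
rewrite /eps; set D := k + 1 + `|xi| + 1 + eta.
have epsle : eta / D <= 1 by rewrite ler_pdivrMr// mul1r /D; have := normr_ge0 xi; lra.
rewrite -mulrA ler_piMr ?(ltW eta0)// mulrC ler_pdivrMr// mul1r.
by rewrite /D; have := normr_ge0 xi; move: (eta / D) epsle => q; lra.
Unshelve. all: by end_near. Qed.

Variable (b : tensor G 'rV[R]_d).
Hypothesis hb : bi_invariant_metric CG b.

Lemma rank_act h x : \rank (K (act h x)) = \rank (K x).
Proof.
have uA := AdM_unit hG hb h.
have le y k : (\rank (K (act k y)) <= \rank (K y))%N.
  rewrite (Kmx_act hG hM hact hb) -mulmxA.
  apply: leq_trans (mxrankM_maxr _ _) (mxrankM_maxl _ _).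
apply/eqP; rewrite eqn_leq; apply/andP; split; first exact: le.
have H := le (act h x) h^-1%g.
rewrite -actM mulVg act1 in H.
exact: H.
Qed.

Context (gM : tensor M 'rV[R]_n) (hgM : riemannian_metric CM setT gM).

(** A basis of action fields at [x] remains independent nearby, its Gram determinant being
    continuous. *)
Lemma rank_lower x : \forall y \near x, (\rank (K x) <= \rank (K y))%N.
Proof.
set a := chart_at CM x; have ax : cdom a x by exact: chart_at_cdom.
have aa : atlas CM a by exact: chart_at_atlas.
set K0 := Kc CG act a (cmap a x).
have /submxP[E EE] : (row_base K0 <= K0)%MS by rewrite eq_row_base.
pose S u := (E *m Kc CG act a u) *m (cmx CM gM a u) *m (E *m Kc CG act a u)^T.
have sT : sm (fun u => E *m Kc CG act a u) (cmap a x).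
  by apply: sm_mul; [exact: sm_cst|exact: (sm_Kc hact aa ax)].
have sS : sm S (cmap a x).
  apply: sm_mul; last exact: sm_tr.
  by apply: sm_mul => //; exact: (sm_cmx hgM openT I aa ax).
have dS : \forall u \near cmap a x, \det (S u) != 0.
  have := sm_continuous (sm_det sS); rewrite /prop_for /continuous_at => /cvgr_neq0.
  apply; rewrite -unitfE -unitmxE; apply: spd_unit; apply: spd_gram.
    exact: (spd_cmx hM hgM I aa ax).
  by rewrite -EE row_base_free.
have := cmap_nbhs ax dS; apply: filterS => y [ay dy].
have e1 := rank_Kc hG hM hact aa ax; have e2 := rank_Kc hG hM hact aa ay.
apply: leq_trans (eq_leq e1) (leq_trans _ (eq_leq (esym e2))).
have rS : \rank (S (cmap a y)) = \rank K0 by apply: mxrank_unit; rewrite unitmxE unitfE.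
apply: leq_trans (eq_leq (esym rS)) _; rewrite /S -mulmxA -mulmxA.
exact: leq_trans (mxrankM_maxr _ _) (mxrankM_maxl _ _).
Qed.

(** Some point [h y] is fixed by the stabilizer of [x], so the kernel of [K x] lies in that of
    [K (act h y)], whose rank is that of [K y]. This bounds the rank from above; [rank_lower] is the
    other half. *)
Lemma rank_const_Mreg x : Mreg act x -> rank_const CG CM act x.
Proof.
rewrite /Mreg /rank_const /= => H; have H' := rank_lower x.
near=> y; apply/eqP; rewrite eqn_leq; apply/andP; split; last by near: y.
have [h Hh] : exists h : G, forall k, act k x = x -> act k (act h y) = act h y.
  by near: y.
apply: leq_trans (eq_leq (esym (rank_act h y))) _.
have kk : (kermx (K x) <= kermx (K (act h y)))%MS.
  apply/row_subP => i; apply/sub_kermxP; apply: (kernel_stabilizer (x := x)) => //.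
  by rewrite -row_mul mulmx_ker row0.
have := leq_trans (eq_leq (esym (mxrank_ker (K x)))) (leq_trans (mxrankS kk) (eq_leq (mxrank_ker (K (act h y))))).
exact: leq_of_sub (rank_leq_row _) (rank_leq_row _).
Unshelve. all: by end_near. Qed.

End Stabilizer.

(** * Convergence *)

Section PartialDerivatives.
Context {R : realType} {n : nat}.

Lemma pderive_near (s : seq 'I_n) (f g : 'rV[R]_n -> R) (u : 'rV[R]_n) :
  {near u, f =1 g} -> {near u, pderive s f =1 pderive s g}.
Proof.
elim: s => [//|i s IH] fg /=; have := near_join (IH fg).
by apply: filterS => v; exact: near_eq_derive.
Qed.

(** Derivatives in [u] at fixed [s] are again jointly smooth in [(s, u)], so their convergence as
    [s] tends to 0 is mere continuity of [H]. *)
Lemma pderive_joint (s : seq 'I_n) (F : R * 'rV[R]_n -> R) s0 u0 : sm F (s0, u0) ->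
  exists H : R * 'rV[R]_n -> R, sm H (s0, u0) /\
    \forall z \near (s0, u0), pderive s (fun u => F (z.1, u)) z.2 = H z.
Proof.
move=> sF; elim: s => [|i s [H [sH HE]]].
  by exists F; split => //; near=> z => /=; case: (z).
exists (fun z => 'd H z (0, ebase R i)); split; first exact: sm_diff.
have := near_join HE; have := sm_near_differentiable sH.
move=> dH HE2; near=> z.
have dz : differentiable H z by near: z.
have Hz : \forall w \near z, pderive s (fun u => F (w.1, u)) w.2 = H w by near: z.
have zE : z = (z.1, z.2) by case: (z).
rewrite zE in dz Hz; rewrite /=.
have Hz' : {near z.2, pderive s (fun u => F (z.1, u)) =1 (fun u => H (z.1, u))}.
  exact: (near_pairl Hz).
rewrite (near_eq_derive _ Hz') deriveE.
  by rewrite (diff_fixl _ dz) -zE.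
apply: (@differentiable_comp _ _ _ _ (fun u => (z.1, u)) H) => //.
Unshelve. all: by end_near. Qed.

End PartialDerivatives.

Section Convergence.
Context {R : realType} (d n : nat) (G : topGroupType) (M : topologicalType).
Context (CG : charted G 'rV[R]_d) (CM : charted M 'rV[R]_n) (act : G -> M -> M).
Hypotheses (hG : lie_group CG) (hM : smooth_manifold CM) (hact : smooth_action CG CM act).
Context (b : tensor G 'rV[R]_d) (hb : bi_invariant_metric CG b).
Context (gM : tensor M 'rV[R]_n) (hgM : riemannian_metric CM setT gM).
Context (gl : R -> tensor M 'rV[R]_n)
  (hgl : forall l : R, 0 < l -> cheeger_metric CG CM act l b gM (gl l)).

Local Notation gtl := (fun l : R => rescaled_metric CG CM act l (gl l)).
Local Notation gt := (deformed CG CM act b gM 0).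

Lemma rescaled_eq l : 0 < l -> gtl l = deformed CG CM act b gM (l ^+ 2).
Proof.
move=> l0; apply/funext => x; apply/funext => v; apply/funext => w.
exact: (rescaled_deformed hG hM hact hb hgM x v w l0 (hgl l0)).
Qed.

Lemma gij_deformed a x (s : R) i j : 0 <= s -> atlas CM a -> cdom a x ->
  gij CM (deformed CG CM act b gM s) a i j (cmap a x) =
  deform_c CG CM act b gM a s (cmap a x) i j.
Proof.
move=> s0 aa ax; rewrite -bform_delta.
exact: (comp_deformed hG hM hact hb hgM _ _ s0 aa ax).
Qed.

(** Both derivatives are values of one continuous [H], at [(l ^+ 2, u)] and at [(0, u)]. The
    estimate is uniform for [y] near [x], the form that a compactness argument can patch. *)
Lemma Cp_local a x i j (s : seq 'I_n) (e : R) : atlas CM a -> cdom a x ->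
  rank_const CG CM act x -> 0 < e ->
  \forall y \near x & l \near 0^'+,
    `|pderive s (gij CM (gtl l) a i j) (cmap a y) - pderive s (gij CM gt a i j) (cmap a y)| < e.
Proof.
move=> aa ax rk e0; have [F [sF FE]] := sm_deform_joint hG hM hact hb hgM aa ax rk (lexx 0).
pose Fij z := F z i j.
have sFij : sm Fij (0, cmap a x) by exact: sm_coord.
have [H [sH HE]] := pderive_joint s sFij.
have e20 : 0 < e / 2 by rewrite divr_gt0.
have cH : \forall z \near ((0 : R), cmap a x), `|H (0, cmap a x) - H z| < e / 2.
  have := sm_continuous sH; rewrite /prop_for /continuous_at => /cvgrPdist_lt; exact.
have [[A N] /= [nA nN] AN] : nbhs ((0 : R), cmap a x)
    (fun z => pderive s (fun u => Fij (z.1, u)) z.2 = H z /\ `|H (0, cmap a x) - H z| < e / 2).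
  by near=> z; split; near: z.
have FEg : \forall u \near cmap a x, (\forall v \near u, forall s, 0 <= s ->
   gij CM (deformed CG CM act b gM s) a i j v = Fij (s, v)).
  apply: near_join.
  have nc := near_chart ax (cdom_nbhs ax).
  near=> u => t t0.
  have [_ ad cu _] : [/\ ccod a u, cdom a (cinv a u), cmap a (cinv a u) = u & cdom a (cinv a u)] by near: u.
  have E := gij_deformed i j t0 aa ad; rewrite cu in E; rewrite E /Fij.
  by congr (_ _ i j); move: t t0 {E}; near: u.
exists ((fun y => cdom a y /\ (N (cmap a y) /\
     \forall v \near cmap a y, forall s, 0 <= s ->
       gij CM (deformed CG CM act b gM s) a i j v = Fij (s, v))),
   (fun l => 0 < l /\ A (l ^+ 2))) => /=.
  split.
    have nn : nbhs (cmap a x) (fun u => N u /\ \forall v \near u, forall s, 0 <= s ->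
       gij CM (deformed CG CM act b gM s) a i j v = Fij (s, v)) by exact: filterI.
    by apply: filterS (cmap_nbhs ax nn).
  near=> l; split; first by near: l; exact: nbhs_right_gt.
  near: l.
  have c2 : (fun l : R => l ^+ 2) @ (0 : R)^'+ --> (0 : R) ^+ 2.
    by apply: cvg_at_right_filter; exact: exprn_continuous.
  by rewrite expr0n /= in c2; exact: c2.
move=> [y l] /= [[ay [Ny Fy]] [l0 Al]].
have l2 : 0 <= l ^+ 2 by rewrite ltW// exprn_gt0.
rewrite (rescaled_eq l0).
have E1 : pderive s (gij CM (deformed CG CM act b gM (l ^+ 2)) a i j) (cmap a y) = H (l ^+ 2, cmap a y).
  have [<- _] := AN (l ^+ 2, cmap a y) (conj Al Ny).
  apply: (nbhs_singleton (pderive_near s _)).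
  by apply: filterS Fy => v; exact.
have A0 : A 0 by exact: nbhs_singleton nA.
have E2 : pderive s (gij CM gt a i j) (cmap a y) = H (0, cmap a y).
  have [<- _] := AN (0, cmap a y) (conj A0 Ny).
  apply: (nbhs_singleton (pderive_near s _)).
  by apply: filterS Fy => v; exact.
rewrite E1 E2.
have [_ h1] := AN (l ^+ 2, cmap a y) (conj Al Ny).
have [_ h2] := AN (0, cmap a y) (conj A0 Ny).
have -> : H (l ^+ 2, cmap a y) - H (0, cmap a y) =
   (H (0, cmap a x) - H (0, cmap a y)) - (H (0, cmap a x) - H (l ^+ 2, cmap a y)) by ring.
apply: le_lt_trans (ler_normB _ _) _.
by rewrite (splitr e); apply: ltrD.
Unshelve. all: by end_near. Qed.

(** The points of [closure U] lying in [Mreg] and in [K] form a compact set, each having constant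
    orbit dimension around it; compactness turns the local estimates into a single range of [l]. *)
Lemma Cp_limit (p : nat) (U : set M) (Ureg : U `<=` Mreg act)
    (Ucpt : compact (closure U `&` Mreg act)) : Cp_converges CM p U gtl gt.
Proof.
move=> a K aa cK Ka i j s _ e e0.
have [hausM _ _] := hM.
have clK : closed K by exact: compact_closed.
have cUK : compact ((closure U `&` Mreg act) `&` K) by exact: compact_closedI.
have nc := (compact_near_coveringP _).1 cUK.
have H : \forall l \near (0 : R)^'+, closure U `&` Mreg act `&` K `<=`
    (fun x => `|pderive s (gij CM (gtl l) a i j) (cmap a x)
      - pderive s (gij CM gt a i j) (cmap a x)| < e).
  apply: (nc R (0 : R)^'+ (fun l x => `|pderive s (gij CM (gtl l) a i j) (cmap a x)
      - pderive s (gij CM gt a i j) (cmap a x)| < e) _) => x [[_ xreg] Kx].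
  apply: Cp_local => //; first exact: Ka.
  exact: (rank_const_Mreg hG hM hact hb hgM).
apply: filterS H => l Hl x Kx Ux.
by apply: Hl; split => //; split; [exact: subset_closure|exact: Ureg].
Qed.

End Convergence.

(** * The metric of the orbit space *)

Fact jac_key : unit. Proof. by []. Qed.

Section Descent.
Context {R : realType} {n m : nat}.
Implicit Types (f pi : 'rV[R]_n -> 'rV[R]_m) (u : 'rV[R]_n).

Definition jac f u : 'M[R]_(n, m) := locked_with jac_key (lin1_mx ('d f u)).

Lemma jacE f u v : 'd f u v = v *m jac f u.
Proof. by rewrite /jac locked_withE mul_rV_lin1. Qed.

Lemma sm_jac f u : sm f u -> sm (jac f) u.
Proof.
move=> sf; apply: sm_mx => i j.
apply: (@sm_eq _ _ _ (fun u => ('d f u (delta_mx 0 i)) 0 j)); last exact/sm_coord/sm_diff.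
by near=> y; rewrite jacE -rowE mxE.
Unshelve. all: by end_near. Qed.

Lemma spd1 k : spd (1%:M : 'M[R]_k).
Proof.
split; first by rewrite trmx1.
move=> v v0; rewrite /bform mulmx1 mxE; under eq_bigr do rewrite mxE -expr2.
rewrite lt_neqAle sumr_ge0 ?andbT; last by move=> i _; exact: sqr_ge0.
apply: contraNneq v0 => /esym /eqP; rewrite psumr_eq0; last by move=> i _; exact: sqr_ge0.
by move=> /allP H; apply/eqP/rowP => i; rewrite mxE; apply/eqP; rewrite -sqrf_eq0; exact: H (mem_index_enum _).
Qed.

(* The Moore-Penrose right inverse of a surjective differential. *)
Definition jac_inv f u : 'M[R]_(m, n) := invmx ((jac f u)^T *m jac f u) *m (jac f u)^T.

Lemma jac_tr_free f u : (forall w, exists v, 'd f u v = w) -> row_free (jac f u)^T.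
Proof.
move=> sf; rewrite /row_free mxrank_tr; apply/row_fullP.
have /choice[g gE] : forall i : 'I_m, exists v, 'd f u v = delta_mx 0 i by move=> i; exact: sf.
exists (\matrix_i g i); apply/row_matrixP => i.
by rewrite row_mul rowK -jacE gE rowE mulmx1.
Qed.

Lemma jac_gram_unit f u : (forall w, exists v, 'd f u v = w) ->
  (jac f u)^T *m jac f u \in unitmx.
Proof.
move=> sf; apply: spd_unit; have := spd_gram (@spd1 n) (jac_tr_free sf).
by rewrite mulmx1 trmxK.
Qed.

Lemma jac_invE f u w : (forall w, exists v, 'd f u v = w) -> 'd f u (w *m jac_inv f u) = w.
Proof. by move=> sf; rewrite jacE /jac_inv !mulmxA -!mulmxA mulVmx ?mulmx1// jac_gram_unit. Qed.

Lemma sm_jac_inv f u : sm f u -> (forall w, exists v, 'd f u v = w) -> sm (jac_inv f) u.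
Proof.
move=> sf df; have sj := sm_jac sf; apply: sm_mul; last exact: sm_tr.
apply: (@sm_inv _ _ _ (fun u => (jac f u)^T *m jac f u)); first exact: jac_gram_unit.
by apply: sm_mul => //; exact: sm_tr.
Qed.

(* Local sections of a submersion reduce derivatives of [F] to derivatives of [F \o pi]. *)
Lemma ck_descent k (D : set 'rV[R]_n) pi (F : 'rV[R]_m -> R) : open D ->
  (forall u, D u -> sm pi u) -> (forall u, D u -> forall w, exists v, 'd pi u v = w) ->
  (forall u, D u -> ck k (fun v => F (pi v)) u) -> forall u, D u -> ck k F (pi u).
Proof.
move=> oD spi dpi; elim: k F => [|k IH] F sF u Du.
  have [s [su ps ds _]] := local_section (spi u Du 1) (fun w => jac_invE w (dpi u Du)).
  have cs : {for pi u, continuous s} by exact: differentiable_continuous.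
  have cF : {for s (pi u), continuous (fun v => F (pi v))} by rewrite su; exact: sF.
  have := continuous_comp cs cF; apply: (@ck_eq R 0%N _ _ ((fun v => F (pi v)) \o s) F).
  by apply: filterS ps => y /= ->.
(* [F] equals [(F \o pi) \o s] near [pi v], and this is differentiated at the base point of the
   section only. The resulting formula involves just [F \o pi] and the smooth [jac_inv pi], so the
   induction can continue. *)
have main v : D v -> differentiable F (pi v) /\
    forall w, 'd F (pi v) w = 'd (fun v => F (pi v)) v (w *m jac_inv pi v).
  move=> Dv.
  have [s [sv ps ds dsE]] := local_section (spi v Dv 1) (fun w => jac_invE w (dpi v Dv)).
  have dF : differentiable (fun v => F (pi v)) (s (pi v)).
    by rewrite sv; exact: ck_differentiable (sF v Dv).
  have [||d E] := @near_eq_diff _ _ _ ((fun v => F (pi v)) \o s) F (pi v).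
  - by apply: filterS ps => y /= ->.
  - exact: differentiable_comp.
  split => // w; rewrite E diff_comp//= dsE.
  by rewrite sv.
split.
  have [s [su ps ds _]] := local_section (spi u Du 1) (fun w => jac_invE w (dpi u Du)).
  have cs : {for pi u, continuous s} by exact: differentiable_continuous.
  have nD : \forall y \near pi u, D (s y).
    by apply: cs; rewrite su; exact: open_nbhs_nbhs.
  near=> y; have Ds : D (s y) by near: y.
  have <- : pi (s y) = y by near: y.
  by have [] := main _ Ds.
move=> w; apply: IH => // v Dv.
apply: (@ck_eq _ _ _ _ (fun v => 'd (fun v => F (pi v)) v (w *m jac_inv pi v))).
  have : nbhs v D by exact: open_nbhs_nbhs.
  by apply: filterS => z Dz; have [_ ->] := main z Dz.
apply: (@ck_eq _ _ _ _ (fun v => \sum_j (w *m jac_inv pi v) 0 j *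
    'd (fun v => F (pi v)) v (delta_mx 0 j))).
  near=> z; rewrite [in RHS](row_sum_delta (w *m jac_inv pi z)) linear_sum.
  by apply: eq_bigr => j _; rewrite linearZ.
apply: ck_sum => j _; apply: ckM; last by have [_] := sF v Dv; exact.
have sj : sm (fun v => w *m jac_inv pi v) v.
  by apply: sm_mul; [exact: sm_cst|apply: sm_jac_inv; [exact: spi|exact: dpi]].
exact: (sm_coord 0 j sj k).
Unshelve. all: by end_near. Qed.

Lemma sm_descent (D : set 'rV[R]_n) pi (F : 'rV[R]_m -> R) : open D ->
  (forall u, D u -> sm pi u) -> (forall u, D u -> forall w, exists v, 'd pi u v = w) ->
  (forall u, D u -> sm (fun v => F (pi v)) u) -> forall u, D u -> sm F (pi u).
Proof.
by move=> oD spi dpi sF u Du k; apply: (ck_descent oD spi dpi) => // v Dv; exact: sF.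
Qed.

End Descent.

Section OrbitSpace.
Context {R : realType} (d n m : nat) (G : topGroupType) (M B : topologicalType).
Context (CG : charted G 'rV[R]_d) (CM : charted M 'rV[R]_n) (CB : charted B 'rV[R]_m).
Context (act : G -> M -> M) (U : set M) (g : tensor M 'rV[R]_n) (pi : M -> B).
Hypotheses (hM : smooth_manifold CM) (hact : smooth_action CG CM act).
Hypotheses (oU : open U) (Uinv : forall h x, U x -> U (act h x)).
Hypotheses (rg : riemannian_metric CM U g) (ginv : invariant_metric CM act U g).
Hypothesis hpi : smooth_orbit_space CM act U CB pi.

Definition projM x : 'M[R]_(n, m) :=
  jac (cmap (chart_at CB (pi x)) \o pi \o cinv (chart_at CM x)) (cmap (chart_at CM x) x).

Lemma projE x v : mdiff CM CB pi x v = v *m projM x.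
Proof. exact: jacE. Qed.

Let smpi x : U x -> smat CM CB pi x.
Proof. by move=> Ux; have [_ sp _ _ _] := hpi; exact: smat_map oU Ux sp. Qed.

Let pisur x w : U x -> exists v, mdiff CM CB pi x v = w.
Proof.
move=> Ux; have [_ _ _ H _] := hpi; have : setT w by [].
by rewrite -(H x Ux) => -[v _ <-]; exists v.
Qed.

Let hB : smooth_manifold CB. Proof. by case: hpi. Qed.

Lemma pi_act h x : U x -> pi (act h x) = pi x.
Proof.
move=> Ux; have [_ _ _ _ H] := hpi; apply/H => //; first exact: Uinv.
rewrite /act_orbit; apply/seteqP; split => y [k _ <-] /=.
  by exists (k * h)%g; rewrite ?(actM hact).
by exists (k * h^-1)%g; rewrite // -(actM hact) mulgVK.
Qed.

Lemma projM_act h x : U x -> projM x = actJ CM act h x *m projM (act h x).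
Proof.
move=> Ux; apply/row_matrixP => i; rewrite !rowE mulmxA; set v := delta_mx 0 i.
have E1 := mdiff_comp v (smat_act hM hact h x) (smpi (Uinv h Ux)).
have [_ E2] : smat CM CB (pi \o act h) x /\
    forall v, mdiff CM CB (pi \o act h) x v = mdiff CM CB pi x v.
  apply: mdiff_near (smpi Ux) _.
  have : nbhs x U by exact: open_nbhs_nbhs.
  by apply: filterS => y Uy /=; rewrite pi_act.
by rewrite E2 !projE actJE in E1.
Qed.

Lemma gmx_act h x : U x ->
  gmx g x = actJ CM act h x *m gmx g (act h x) *m (actJ CM act h x)^T.
Proof.
move=> Ux; apply: bform_inj => v w; rewrite -bform_mul -!actJE.
rewrite -(metric_form _ _ rg (Uinv h Ux)) -(metric_form _ _ rg Ux).
by rewrite ginv.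
Qed.

(* The inverse metric on [T_(pi x) B]. *)
Definition quotS x : 'M[R]_m := (projM x)^T *m invmx (gmx g x) *m projM x.

Lemma gram_inv_cov k p (J A : 'M[R]_k) (P : 'M[R]_(k, p)) : J \in unitmx -> A \in unitmx ->
  (J *m P)^T *m invmx (J *m A *m J^T) *m (J *m P) = P^T *m invmx A *m P.
Proof. by move=> uJ uA; rewrite -(inv_gram uJ uA) trmx_mul !mulmxA. Qed.

Lemma quotS_act h x : U x -> quotS (act h x) = quotS x.
Proof.
move=> Ux; rewrite /quotS (projM_act h Ux) (gmx_act h Ux).
have := spd_unit (spd_gmx rg Ux); rewrite (gmx_act h Ux) !unitmx_mul => /andP[/andP[uJ uA] _].
by rewrite (gram_inv_cov _ uJ uA).
Qed.

Lemma projM_tr_free x : U x -> row_free (projM x)^T.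
Proof. by move=> Ux; apply: jac_tr_free => w; exact: pisur. Qed.

Lemma spd_quotS x : U x -> spd (quotS x).
Proof.
move=> Ux; have := spd_gram (spd_inv (spd_gmx rg Ux)) (projM_tr_free Ux).
by rewrite trmxK.
Qed.

Variable sel : B -> M.
Hypothesis selP : forall y, U (sel y) /\ pi (sel y) = y.

Definition quotient_metric : tensor B 'rV[R]_m :=
  fun y v w => bform (invmx (quotS (sel y))) v w.

(** [sel] is an arbitrary choice of a point in each fibre. Fibres of [pi] in [U] are orbits and
    [quotS] is invariant, so any other point gives the same form. *)
Lemma quotient_metricE x v w : U x -> quotient_metric (pi x) v w = bform (invmx (quotS x)) v w.
Proof.
move=> Ux; have [Us ps] := selP (pi x); rewrite /quotient_metric.
have [_ _ _ _ H] := hpi; have /seteqP[+ _] := (H _ _ Us Ux).1 ps.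
move=> /(_ (sel (pi x)))[]; first by exists 1%g; rewrite // (act1 hact).
by move=> h _ /= <-; rewrite quotS_act.
Qed.

Let projc (a : chart M 'rV[R]_n) (c : chart B 'rV[R]_m) := cmap c \o pi \o cinv a.

Lemma diff_projc a c x (v : 'rV[R]_n) : U x -> atlas CM a -> atlas CB c -> cdom a x -> cdom c (pi x) ->
  v *m jac (projc a c) (cmap a x) *m pushM CB c (pi x) = v *m pushM CM a x *m projM x.
Proof.
move=> Ux aa ac ax cx; rewrite -jacE -!push_mx// -projE.
by rewrite (mdiff_push v hM hB (smpi Ux) aa ac ax cx).
Qed.

Lemma projc_sur a c x (w : 'rV[R]_m) : U x -> atlas CM a -> atlas CB c -> cdom a x -> cdom c (pi x) ->
  exists v, 'd (projc a c) (cmap a x) v = w.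
Proof.
move=> Ux aa ac ax cx; have [t tE] := pisur (push CB c (cmap c (pi x)) w) Ux.
exists (pull CM a x t); apply: (push_inj hB ac cx).
rewrite -tE -(mdiff_push _ hM hB (smpi Ux) aa ac ax cx).
by rewrite pullK.
Qed.

Lemma comp_quotient a c x (v w : 'rV[R]_m) : U x -> atlas CM a -> atlas CB c -> cdom a x -> cdom c (pi x) ->
  Defs.comp CB quotient_metric c (projc a c (cmap a x)) v w =
  bform (invmx ((jac (projc a c) (cmap a x))^T *m invmx (cmx CM g a (cmap a x)) *m
    jac (projc a c) (cmap a x))) v w.
Proof.
move=> Ux aa ac ax cx; rewrite {1}/projc /= cmapK//.
have qE v' w' : quotient_metric (pi x) v' w' = bform (invmx (quotS x)) v' w'.
  exact: quotient_metricE.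
have CE := @comp_form _ _ _ CB c (pi x) quotient_metric _ v w cx qE.
rewrite CE.
congr (bform _ _ _); set J := jac _ _; set P := pushM CB c (pi x).
set A := pushM CM a x.
have uP := pushM_unit hB ac cx.
have uA := pushM_unit hM aa ax.
have JP : J *m P = A *m projM x.
  by apply/row_matrixP => i; rewrite !rowE !mulmxA; exact: diff_projc.
rewrite (cmxE rg Ux ax) -/A; set X := _ *m J.
have SE : quotS x = P^T *m X *m P.
  rewrite /quotS -(gram_inv_cov _ uA (spd_unit (spd_gmx rg Ux))) -JP trmx_mul.
  by rewrite /X !mulmxA.
have := spd_unit (spd_quotS Ux); rewrite SE !unitmx_mul => /andP[/andP[uPT uX] _].
by have := inv_gram uPT uX; rewrite trmxK.
Qed.

(** Smoothness on the orbit space is tested after composition with [pi], by [sm_descent]; there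
    [comp_quotient] gives the components through an inverse of smooth matrices, so [sel] need not be
    continuous. *)
Lemma quotient_riemannian : riemannian_metric CB setT quotient_metric.
Proof.
split.
- by move=> y _ r v v' w; rewrite /quotient_metric bformDl bformZl.
- move=> y _ v w; rewrite /quotient_metric bformC//.
  exact: (spd_inv (spd_quotS (selP y).1)).1.
- by move=> y _ v v0; exact: (spd_inv (spd_quotS (selP y).1)).2.
move=> c ac v w; apply: sm_smooth => y [cy _].
have [Us ps] := selP (cinv c y); set x := sel (cinv c y) in Us ps *.
set a := chart_at CM x.
have aa : atlas CM a by exact: chart_at_atlas.
have ax : cdom a x by exact: chart_at_cdom.
pose V := U `&` pi @^-1` cdom c.
have oV : open V.
  rewrite openE => z [Uz cz]; rewrite /interior; have [cpi _] := smpi Uz.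
  near=> z'; split; near: z'; first exact: open_nbhs_nbhs.
  exact: cpi (cdom_nbhs cz).
pose D := ccod a `&` cinv a @^-1` V.
have oD : open D by exact: open_preim.
have DE u : D u -> [/\ U (cinv a u), cdom a (cinv a u), cdom c (pi (cinv a u)) &
    cmap a (cinv a u) = u].
  by move=> [au [Uu cu]]; split => //; [exact: cinv_cdom|exact: cinvK].
have cx : cdom c (pi x) by rewrite ps; exact: cinv_cdom.
have -> : y = projc a c (cmap a x) by rewrite /projc /= cmapK// ps cinvK.
have sp u : D u -> sm (projc a c) u.
  by move=> /DE[Uu au cu <-]; have [_ H] := smpi Uu; exact: H.
have dp u : D u -> forall w, exists v, 'd (projc a c) u v = w.
  by move=> /DE[Uu au cu <-] w'; exact: projc_sur.
apply: (sm_descent oD sp dp) => [u Du|]; last first.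
  by split; [exact: cmap_ccod|rewrite /= cmapK].
pose X u := (jac (projc a c) u)^T *m invmx (cmx CM g a u) *m jac (projc a c) u.
apply: (@sm_eq _ _ _ (fun u => bform (invmx (X u)) v w)).
  have : nbhs u D by exact: open_nbhs_nbhs.
  apply: filterS => z Dz; have [Uz az cz zE] := DE z Dz.
  have E := comp_quotient v w Uz aa ac az cz; rewrite zE in E; exact: esym E.
have [Uu au cu uE] := DE u Du.
have sg : spd (cmx CM g a u).
  by rewrite -uE; exact: spd_cmx rg Uu aa au.
have sX : spd (X u).
  have := spd_gram (spd_inv sg) (jac_tr_free (dp u Du)).
  by rewrite trmxK.
apply: (sm_coord 0 0); apply: sm_mul; last exact: sm_cst.
apply: sm_mul; first exact: sm_cst.
apply: (@sm_inv _ _ _ X); first exact: spd_unit.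
have sj := sm_jac (sp u Du).
apply: sm_mul => //; apply: sm_mul; first exact: sm_tr.
apply: (@sm_inv _ _ _ (cmx CM g a)); first exact: spd_unit.
by rewrite -uE; exact: (sm_cmx rg oU Uu aa au).
Unshelve. all: by end_near. Qed.

Lemma quotient_submersion : riemannian_submersion CM CB U g pi quotient_metric.
Proof.
have [_ sp im rpi _] := hpi; split => // x Ux v w hv hw.
rewrite quotient_metricE// !projE.
set A := gmx g x; set P := projM x; set S := quotS x.
have sA := spd_gmx rg Ux; have uA := spd_unit sA; have uS := spd_unit (spd_quotS Ux).
(* The matrix of the horizontal lift. A horizontal vector is the lift of its image, because their
   difference is vertical and orthogonal to all vertical vectors. *)
pose L := invmx S *m P^T *m invmx A.
have LP : L *m P = 1%:M.
  by rewrite /L -!mulmxA (mulmxA P^T) -/(quotS x) mulVmx.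
have hE t : horizontal CM CB g pi x t -> t *m P *m L = t.
  move=> ht; apply/eqP; rewrite -subr_eq0; apply/eqP.
  set k := _ - t; have kP : k *m P = 0.
    by rewrite /k mulmxBl -[t *m P *m L *m P]mulmxA LP mulmx1 subrr.
  apply: (spd_eq0 sA); rewrite {1}/k bformBl.
  rewrite -(metric_form t k rg Ux) (ht k) ?projE// subr0.
  by rewrite /bform /L !mulmxA mulmxKV// -(mulmxA _ P^T) -trmx_mul kP trmx0 mulmx0 mxE.
rewrite (metric_form _ _ rg Ux) -{2}(hE v hv) -{2}(hE w hw) [RHS]bform_mul.
have LA : L *m gmx g x = invmx S *m P^T by rewrite /L mulmxKV.
by rewrite LA -mulmxA -trmx_mul LP trmx1 mulmx1.
Qed.

End OrbitSpace.

Lemma orbit_space_metric {R : realType} (d n m : nat) (G : topGroupType) (M B : topologicalType)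
    (CG : charted G 'rV[R]_d) (CM : charted M 'rV[R]_n) (CB : charted B 'rV[R]_m)
    (act : G -> M -> M) (U : set M) (g : tensor M 'rV[R]_n) (pi : M -> B) :
  smooth_manifold CM -> smooth_action CG CM act -> open U ->
  (forall h x, U x -> U (act h x)) -> riemannian_metric CM U g ->
  invariant_metric CM act U g -> smooth_orbit_space CM act U CB pi ->
  exists gB : tensor B 'rV[R]_m,
    riemannian_metric CB setT gB /\ riemannian_submersion CM CB U g pi gB.
Proof.
move=> hM hact oU Uinv rg ginv hpi.
have /choice[sel selP] : forall y, exists x, U x /\ pi x = y.
  move=> y; have [_ _ im _ _] := hpi.
  by have : setT y by []; rewrite -im => -[x Ux <-]; exists x.
exists (quotient_metric CM CB g pi sel).
split.
  exact: (quotient_riemannian hM hact oU Uinv rg ginv hpi selP).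
exact: (quotient_submersion hM hact oU Uinv rg ginv hpi selP).
Qed.

(** * Normal homogeneous orbits *)

Section LimitMetric.
Context {R : realFieldType} (n d : nat) (A : 'M[R]_n) (B : 'M[R]_d) (K : 'M[R]_(d, n)).
Hypotheses (sA : spd A) (sB : spd B).

(** The element [eta] is arbitrary: it differs from its projection by an element of the kernel of
    [K], which pairs to zero with [xi]. *)
Lemma deform0_perp xi eta : (forall zeta, zeta *m K = 0 -> bform B xi zeta = 0) ->
  bform (deform A B K 0) (xi *m K) (eta *m K) = bform B xi eta.
Proof.
move=> H; have fT := row_base_free K; have TK := eq_row_base K.
rewrite /deform (limit_form sA sB fT TK) (horiz_lift_id sA sB fT TK H).
set h := horiz_lift _ _ _ _ _; have zK : (h - eta) *m K = 0.
  by rewrite mulmxBl (horiz_lift_act sA sB fT TK) subrr.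
by rewrite -[h in LHS](subrK eta) bformDr H// add0r.
Qed.

Lemma deform0_le xi : bform (deform A B K 0) (xi *m K) (xi *m K) <= bform B xi xi.
Proof. exact: (limit_form_le sA sB (row_base_free K) (eq_row_base K)). Qed.

End LimitMetric.

Section NormalHomogeneous.
Context {R : realType} (d n : nat) (G : topGroupType) (M : topologicalType).
Context (CG : charted G 'rV[R]_d) (CM : charted M 'rV[R]_n) (act : G -> M -> M).
Hypotheses (hG : lie_group CG) (hM : smooth_manifold CM) (hact : smooth_action CG CM act).
Context (b : tensor G 'rV[R]_d) (hb : bi_invariant_metric CG b).
Context (gM : tensor M 'rV[R]_n) (hgM : riemannian_metric CM setT gM).

Local Notation K := (Kmx CG CM act).
Local Notation gt := (deformed CG CM act b gM 0).

Lemma smat_smooth_map (N : topologicalType) (E : normedModType R) (C : charted N E) m (L : topologicalType)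
    (C' : charted L 'rV[R]_m) (D : set N) f :
  (forall x, D x -> smat C C' f x) -> smooth_map C C' D f.
Proof.
move=> H; split; first by move=> x /H[].
move=> a c aa ac; apply: sm_smooth => u [au [Du cu]]; have [_ S] := H _ Du.
by rewrite -(cinvK au); apply: S => //; exact: cinv_cdom.
Qed.

(** Right translation to the identity: the trivialization of the tangent bundle of [G] in which the
    derivative of [p |-> p x] at [p] is an action field at [p x]. *)
Definition rtriv p v : 'rV[R]_d := mdiff CG CG (fun q => q * p^-1)%g p v.

Lemma rtriv_sur p xi : exists v, rtriv p v = xi.
Proof.
exists (mdiff CG CG (fun q => q * p)%g 1%g xi).
have E := mdiff_comp xi (smat_rmul hG p 1%g) (smat_rmul hG p^-1%g (1 * p)%g).
have F : (fun q => q * p^-1)%g \o (fun q => q * p)%g = (id : G -> G).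
  by apply/funext => q /=; rewrite mulgK.
by rewrite F mdiff_id mul1g in E.
Qed.

(** Differentiates [q x = (q p^-1) (p x)] at [q = p]. *)
Lemma mdiff_orbit p x v : mdiff CG CM (act^~ x) p v = rtriv p v *m K (act p x).
Proof.
have E := mdiff_comp v (smat_rmul hG p^-1%g p) (smat_orbit hG hact (act p x) (p * p^-1)%g).
have F : act^~ (act p x) \o (fun q => q * p^-1)%g = act^~ x.
  by apply/funext => q /=; rewrite -(actM hact) mulgVK.
rewrite F mulgV in E; rewrite -KmxE; exact: E.
Qed.

Lemma rtriv_isom p v w : b p v w = bform (gmxG b) (rtriv p v) (rtriv p w).
Proof.
have [_ _ br] := hb; rewrite -(biinv_form hb).
by have E := br p^-1%g p I v w; rewrite mulgV in E; exact: esym E.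
Qed.

(** Witnesses are [b] itself, the stabilizer of [x] and the orbit map. A vector horizontal for the
    orbit map at [p] becomes, after right translation to 1, orthogonal to the kernel of
    [K (act p x)], and [deform0_perp] applies. *)
Lemma deformed_normal_homogeneous x : normal_homogeneous_orbit CG CM act gt x.
Proof.
have [haus _ _] := hM.
have cf : continuous (act^~ x) by move=> p; case: (smat_orbit hG hact x p).
have cx : closed (act^~ x @^-1` [set x]).
  apply: closed_comp; first by move=> p _; exact: cf.
  by apply: accessible_closed_set1; exact: hausdorff_accessible.
exists b, [set h | act h x = x], (fun p => act p x); split.
- exact: hb.
- split; rewrite /=.
  + exact: cx.
  + exact: (act1 hact).
  + by move=> h k hx kx; rewrite (actM hact) kx.
  + by move=> h hx; rewrite -{1}hx -(actM hact) mulVg (act1 hact).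
- move=> p p' /=; split => [E|E].
    by rewrite (actM hact) -E -(actM hact) mulVg (act1 hact).
  by rewrite -[in LHS]E -(actM hact) mulgA mulgV mul1g.
- by move=> h p; exact: (actM hact).
split.
- by apply: smat_smooth_map => p _; exact: smat_orbit.
- by [].
- move=> p _; apply/seteqP; split => v.
    by move=> [w _ <-]; apply/orbit_tangentE; rewrite mdiff_orbit submxMl.
  move=> /orbit_tangentE /submxP[xi ->]; have [w <-] := rtriv_sur p xi.
  by exists w => //; rewrite mdiff_orbit.
- move=> p _ v w hv _; rewrite !mdiff_orbit /deformed /deform_at.
  rewrite (deform0_perp (spd_gmM hgM _) (spd_gmxG hb)) ?rtriv_isom// => zeta zK.
  have [k kE] := rtriv_sur p zeta; rewrite -kE -rtriv_isom; apply: hv.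
  by rewrite mdiff_orbit kE.
Qed.

End NormalHomogeneous.

(** * Totally geodesic orbits *)

Section MatrixDerivatives.
Context {R : realType} {V : normedModType R}.

Lemma diff_mulmx m n p (f : V -> 'M[R]_(m, n)) (g : V -> 'M[R]_(n, p)) x v :
  sm f x -> sm g x ->
  'd (fun y => f y *m g y) x v = 'd f x v *m g x + f x *m 'd g x v.
Proof.
move=> sf sg; apply/matrixP => i j.
have sfc k := sm_differentiable (sm_coord i k sf).
have sgc k := sm_differentiable (sm_coord k j sg).
rewrite -(diff_coord v i j (sm_differentiable (sm_mul sf sg))).
have E : (fun y => (f y *m g y) i j) =
    \sum_k ((fun y => f y i k) * (fun y => g y k j)).
  by apply/funext => y; rewrite mxE fct_sumE.
rewrite -deriveE; last exact/sm_differentiable/sm_coord/sm_mul.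
have dk k : derivable ((fun y => f y i k) * (fun y => g y k j)) x v.
  by apply: derivableM; exact: diff_derivable.
rewrite E derive_sum// !mxE -big_split /=; apply: eq_bigr => k _.
have Ef : 'D_v (fun y => f y i k) x = ('d f x v) i k.
  by rewrite deriveE// (diff_coord v i k (sm_differentiable sf)).
have Eg : 'D_v (fun y => g y k j) x = ('d g x v) k j.
  by rewrite deriveE// (diff_coord v k j (sm_differentiable sg)).
rewrite deriveM; [|exact: diff_derivable|exact: diff_derivable].
by rewrite Ef Eg addrC; congr (_ + _); exact: mulrC.
Qed.

Lemma diff_trmx m n (f : V -> 'M[R]_(m, n)) x v : sm f x ->
  'd (fun y => (f y)^T) x v = ('d f x v)^T.
Proof.
move=> sf; apply/matrixP => i j; rewrite mxE.
rewrite -(diff_coord v i j (sm_differentiable (sm_tr sf))).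
rewrite -(diff_coord v j i (sm_differentiable sf)).
have -> // : (fun y => (f y)^T i j) = (fun y => f y j i).
by apply/funext => y; rewrite mxE.
Qed.

Lemma diff_cst0 (W : normedModType R) (w : W) (x v : V) : 'd (fun _ : V => w) x v = 0.
Proof. by rewrite diff_cst. Qed.

Lemma diff_near_eq (W : normedModType R) (f g : V -> W) x v :
  {near x, f =1 g} -> differentiable f x -> 'd g x v = 'd f x v.
Proof. by move=> fg df; have [_ ->] := near_eq_diff fg df. Qed.

Lemma diff_max (f : V -> R) x v : (\forall y \near x, differentiable f y) ->
  (\forall y \near x, f y <= f x) -> 'd f x v = 0.
Proof.
move=> df fx.
have cl : (fun t : R => x + t *: v) @ (0 : R) --> x.
  rewrite -[X in _ --> X](addr0 x) -(scale0r v); apply: cvgD; first exact: cvg_cst.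
  by apply: cvgZr_tmp; exact: cvg_id.
have /nbhs_ballP[r /= r0 rH] : \forall t \near (0 : R),
    differentiable f (x + t *: v) /\ f (x + t *: v) <= f x.
  exact: (cl _ (filterI df fx)).
have H t : t \in `](-r), r[%R -> differentiable f (x + t *: v) /\ f (x + t *: v) <= f x.
  rewrite in_itv /= => tr; apply: rH; rewrite -ball_normE /= sub0r normrN ltr_norml//.
have dd t : t \in `](-r), r[%R -> is_derive t 1 (fun s : R => f (x + s *: v)) ('d f (x + t *: v) v).
  by move=> /H[dft _]; exact: is_derive_line.
have r00 : (0 : R) \in `](-r), r[%R by rewrite in_itv /= oppr_lt0 r0.
have rr : - r <= r by lra.
have := @derive1_at_max R (fun s : R => f (x + s *: v)) (- r) r 0 rr.
move=> /(_ _ r00) M; have {}M : is_derive (0 : R) (1 : R) (fun s : R => f (x + s *: v)) 0.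
  by apply: M => t /[dup] tr /H[? ?]; [have [] := dd t tr|rewrite scale0r addr0].
have := dd 0 r00; rewrite scale0r addr0 => -[_ <-].
by have [_ ->] := M.
Qed.

End MatrixDerivatives.

(** * The Koszul formula in a chart *)

Section Christoffel.
Context {R : realType} (n : nat) (M : topologicalType) (CM : charted M 'rV[R]_n).
Variables (g : tensor M 'rV[R]_n) (a : chart M 'rV[R]_n) (u : 'rV[R]_n).
Local Notation g_ := (cmx CM g a).
Hypotheses (sg : sm g_ u) (Tg : (g_ u)^T = g_ u) (ug : g_ u \in unitmx).

Lemma derive_gij v i j : 'D_v (gij CM g a i j) u = ('d g_ u v) i j.
Proof.
have -> : gij CM g a i j = (fun y => g_ y i j) by apply/funext => y; rewrite mxE.
rewrite deriveE; first exact: diff_coord (sm_differentiable sg).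
exact: sm_differentiable (sm_coord i j sg).
Qed.

(** Lowering the index with the metric cancels the inverse matrix and leaves the Christoffel symbols
    of the first kind. *)
Lemma christoffel_form v w p : bform (g_ u) (christoffel CM g a u v w) p =
  2^-1 * (bform ('d g_ u v) w p + bform ('d g_ u w) v p - bform ('d g_ u p) v w).
Proof.
pose c : 'rV[R]_n := \row_m \sum_i \sum_j 2^-1 *
  (('d g_ u (ebase R i)) j m + ('d g_ u (ebase R j)) i m - ('d g_ u (ebase R m)) i j) * v 0 i * w 0 j.
have -> : christoffel CM g a u v w = c *m invmx (g_ u).
  rewrite -[invmx _]trmx_invS//; apply/rowP => k; rewrite !mxE; apply: eq_bigr => m _.
  rewrite !mxE big_distrl /=; apply: eq_bigr => i _; rewrite big_distrl /=.
  by apply: eq_bigr => j _; rewrite !derive_gij; ring.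
rewrite /bform mulmxKV// mxE.
have dE x : 'd g_ u x = \sum_i x 0 i *: 'd g_ u (ebase R i).
  by rewrite {1}(row_sum_delta x) linear_sum; apply: eq_bigr => i _; rewrite linearZ.
have E1 x y z : (y *m 'd g_ u x *m z^T) 0 0 =
    \sum_k \sum_i \sum_j x 0 i * y 0 j * ('d g_ u (ebase R i)) j k * z 0 k.
  rewrite mxE; apply: eq_bigr => k _; rewrite !mxE big_distrl /= exchange_big /=.
  apply: eq_bigr => j _; rewrite dE summxE big_distrr big_distrl /=.
  by apply: eq_bigr => i _; rewrite !mxE; ring.
have E2 : (v *m 'd g_ u w *m p^T) 0 0 =
    \sum_k \sum_i \sum_j v 0 i * w 0 j * ('d g_ u (ebase R j)) i k * p 0 k.
  rewrite E1; apply: eq_bigr => k _; rewrite exchange_big /=.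
  by apply: eq_bigr => i _; apply: eq_bigr => j _; rewrite (mulrC (w _ _)).
have E3 : (v *m 'd g_ u p *m w^T) 0 0 =
    \sum_k \sum_i \sum_j v 0 i * w 0 j * ('d g_ u (ebase R k)) i j * p 0 k.
  rewrite E1 exchange_big /=; apply: eq_bigr => k _; rewrite exchange_big /=.
  by apply: eq_bigr => i _; apply: eq_bigr => j _; ring.
rewrite E1 E2 E3 -big_split -sumrB big_distrr /=; apply: eq_bigr => k _.
rewrite !mxE big_distrl -big_split -sumrB big_distrr /=; apply: eq_bigr => i _.
rewrite big_distrl -big_split -sumrB big_distrr /=; apply: eq_bigr => j _.
by ring.
Qed.

End Christoffel.

Section Pairs.
Context {R : realType}.

Lemma near_pairr (V W : normedModType R) (P : set (V * W)) (v : V) (w : W) :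
  nbhs (v, w) P -> \forall v' \near v, P (v', w).
Proof.
move=> [[A B] /= [nA nB] AB]; apply: filterS nA => v' Av'; apply: AB.
by split; [exact: Av'|exact: (nbhs_singleton nB)].
Qed.

Lemma diff_sym_mx (V : normedModType R) m n (f : V -> 'M[R]_(m, n)) x v w : sm f x ->
  'd (fun y => 'd f y v) x w = 'd (fun y => 'd f y w) x v.
Proof.
move=> sf; apply/matrixP => i j.
have H u t : ('d (fun y => 'd f y u) x t) i j = 'd (fun y => 'd (fun z => f z i j) y u) x t.
  rewrite -(diff_coord t i j (sm_differentiable (sm_diff u sf))).
  apply/esym/diff_near_eq; last exact/sm_differentiable/sm_coord/sm_diff.
  near=> y; have dy : differentiable f y by near: y; exact: sm_near_differentiable.
  by rewrite (diff_coord u i j dy).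
by rewrite !H; apply: diff_sym; exact: (sm_coord i j sf).
Unshelve. all: by end_near. Qed.

End Pairs.

Lemma diff_conj {R : realType} (V : normedModType R) n (f h : V -> 'M[R]_n) x v :
  sm f x -> sm h x -> f x = 1%:M ->
  'd (fun w => f w *m h w *m (f w)^T) x v = 'd f x v *m h x + 'd h x v + h x *m ('d f x v)^T.
Proof.
move=> sf sh f1; have D1 := diff_mulmx v (sm_mul sf sh) (sm_tr sf).
have D2 := diff_mulmx v sf sh.
have key (X a b c : 'M[R]_n) : X = a *m (f x)^T + f x *m h x *m b ->
    a = c *m h x + f x *m 'd h x v -> b = c^T -> X = c *m h x + 'd h x v + h x *m c^T.
  by move=> -> -> ->; rewrite f1 trmx1 mulmx1 !mul1mx.
exact: key D1 D2 (diff_trmx v sf).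
Qed.

(** * Second-order behaviour of the action in a chart *)

Section OrbitMap.
Context {R : realType} (d n : nat) (G : topGroupType) (M : topologicalType).
Context (CG : charted G 'rV[R]_d) (CM : charted M 'rV[R]_n) (act : G -> M -> M).
Hypotheses (hG : lie_group CG) (hM : smooth_manifold CM) (hact : smooth_action CG CM act).
Context (a : chart M 'rV[R]_n) (x : M).
Hypotheses (aa : atlas CM a) (ax : cdom a x).

Let kap := chart_at CG 1%g.
Let e := idG CG.
Let u0 := cmap a x.
Let K := Kc CG act a.
Let ac := actc CG act a.
Let phi w := ac (w, u0).

Let fd2 : fdim ('rV[R]_d * 'rV[R]_n)%type.
Proof. by apply: fdim_prod; exact: fdim_rV. Qed.

Let sac : sm ac (e, u0). Proof. exact (sm_actc hact aa ax). Qed.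

Let pe : cinv kap e = 1%g. Proof. exact: cmapK (chart_at_cdom CG 1%g). Qed.

Lemma actc_id u : ccod a u -> ac (e, u) = u.
Proof. by move=> au; rewrite /ac /actc /= pe (act1 hact) cinvK. Qed.

Lemma orbit_chart_id : phi e = u0.
Proof. by apply: actc_id; exact: cmap_ccod. Qed.

Lemma sm_orbit_chart : sm phi e.
Proof.
apply: (@sm_comp _ _ _ _ _ (fun w => (w, u0)) ac).
- exact: fd2.
- by apply: sm_pair; [exact: sm_id|exact: sm_cst].
- exact: sac.
Qed.

Lemma diff_orbit_chart xi : 'd phi e xi = xi *m K u0.
Proof.
rewrite (nbhs_singleton (Kc_near hact aa ax)).
exact: (diff_fixr xi (sm_differentiable sac)).
Qed.

Lemma diff_orbit_comp (W : normedModType R) (F : 'rV[R]_n -> W) xi : differentiable F u0 ->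
  'd (fun w => F (phi w)) e xi = 'd F u0 (xi *m K u0).
Proof.
move=> dF; have dF' : differentiable F (phi e) by rewrite orbit_chart_id.
have := diff_comp (sm_differentiable sm_orbit_chart) dF'; rewrite orbit_chart_id => E.
have /= E1 := congr1 (fun f : 'rV[R]_d -> W => f xi) E.
by rewrite -diff_orbit_chart; exact: E1.
Qed.

(** For [w] near [e], the matrix of the differential at [u0] of the transformation given by the
    group element with coordinates [w]. *)
Let P w : 'M[R]_n := \matrix_(i, j) ('d ac (w, u0) (0, delta_mx 0 i)) 0 j.

Let PE w p : p *m P w = 'd ac (w, u0) (0, p).
Proof.
have -> : (0, p) = \sum_i p 0 i *: ((0, delta_mx 0 i) : 'rV[R]_d * 'rV[R]_n).
  apply: injective_projections; rewrite /= raddf_sum /=.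
    by rewrite big1 // => i _; rewrite scaler0.
  exact: row_sum_delta.
rewrite linear_sum mulmx_sum_row; apply: eq_bigr => i _.
rewrite linearZ; congr (_ *: _); apply/rowP => j; by rewrite !mxE.
Qed.

Let sP : sm P e.
Proof.
apply: sm_mx => i j; under eq_fun do rewrite mxE.
apply: sm_coord.
apply: (@sm_comp _ _ _ _ _ (fun w => (w, u0)) (fun z => 'd ac z (0, delta_mx 0 i))).
- exact: fd2.
- by apply: sm_pair; [exact: sm_id|exact: sm_cst].
- by apply: sm_diff; exact: sac.
Qed.

Let Pe : P e = 1%:M.
Proof.
apply/row_matrixP => i; rewrite !rowE mulmx1 PE.
rewrite -(diff_fixl _ (sm_differentiable sac)).
rewrite (@diff_near_eq _ _ _ id); last exact: ex_diff.
  by rewrite (@diff_lin _ _ _ idfun)// => y; exact: cvg_id.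
by apply: filterS (ccod_nbhs (cmap_ccod ax)) => u au; rewrite actc_id.
Qed.

Let acD : \forall z \near (e, u0), differentiable ac z.
Proof. exact: sm_near_differentiable sac. Qed.

(** Symmetry of the mixed second derivatives of [actc]: the derivative in the group direction [xi]
    of the differential of the action is the differential of the action field of [xi]. *)
Let dP xi p : p *m 'd P e xi = xi *m 'd K u0 p.
Proof.
have sK : sm K u0 by exact: (sm_Kc hact aa ax).
have sd v : sm (fun z => 'd ac z v) (e, u0) by apply: sm_diff; exact: sac.
have -> : p *m 'd P e xi = 'd (fun w => p *m P w) e xi.
  by rewrite diff_mulmx ?diff_cst0 ?mul0mx ?add0r//; exact: sm_cst.
have -> : xi *m 'd K u0 p = 'd (fun u => xi *m K u) u0 p.
  by rewrite diff_mulmx ?diff_cst0 ?mul0mx ?add0r//; exact: sm_cst.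
have -> : (fun w => p *m P w) = (fun w => 'd ac (w, u0) (0, p)).
  by apply/funext => w; exact: PE.
have -> : 'd (fun u => xi *m K u) u0 p = 'd (fun u => 'd ac (e, u) (xi, 0)) u0 p.
  apply: diff_near_eq.
    by apply: filterS (Kc_near hact aa ax) => u Ku; rewrite Ku.
  apply: sm_differentiable; apply: (@sm_comp _ _ _ _ _ (fun u => (e, u)) (fun z => 'd ac z (xi, 0))).
  - exact: fd2.
  - by apply: sm_pair; [exact: sm_cst|exact: sm_id].
  - exact: sd.
rewrite (diff_fixr _ (sm_differentiable (sd (0, p)))).
rewrite (diff_fixl _ (sm_differentiable (sd (xi, 0)))).
by apply: diff_sym_mx; exact: sac.
Qed.

Let phiD : \forall w \near e, [/\ ccod kap w, cdom a (act (cinv kap w) x) &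
  phi w = cmap a (act (cinv kap w) x)].
Proof.
have := near_pairr (actc_dom hact ax); apply: filterS => w [kw _].
by rewrite /= cmapK// => aw; split => //; rewrite /phi /ac /actc /= cmapK.
Qed.

(** Invariance reads [P w *m g_ (phi w) *m (P w)^T = g_ u0] for [w] near [e]; its derivative at [e]
    along [xi] is the Killing equation for the action field of [xi]. *)
Lemma killing (U : set M) g : open U -> U x -> (forall h y, U y -> U (act h y)) ->
    riemannian_metric CM U g -> invariant_metric CM act U g -> forall xi p q,
  bform ('d (cmx CM g a) u0 (xi *m K u0)) p q
  + bform (cmx CM g a u0) (xi *m 'd K u0 p) q + bform (cmx CM g a u0) p (xi *m 'd K u0 q) = 0.
Proof.
move=> oU Ux Uinv rg ginv xi p q; set g_ := cmx CM g a.
have sg : sm g_ u0 by exact: (sm_cmx rg oU Ux aa ax).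
have sgp : sm (fun w => g_ (phi w)) e.
  apply: (@sm_comp _ _ _ _ _ phi g_); first exact: fdim_rV.
    exact: sm_orbit_chart.
  by rewrite orbit_chart_id.
have inv : \forall w \near e, P w *m g_ (phi w) *m (P w)^T = g_ u0.
  near=> w.
  have [kw aw pw] : [/\ ccod kap w, cdom a (act (cinv kap w) x) & phi w = cmap a (act (cinv kap w) x)] by near: w.
  have dw : differentiable ac (w, u0) by near: w; exact: (near_pairr acD).
  set h := cinv kap w in aw pw *.
  have Eh v : push CM a (cmap a (act h x)) (v *m P w) = mdiff CM CM (act h) x (push CM a u0 v).
    rewrite (mdiff_push v hM hM (smat_act hM hact h x) aa aa ax aw); congr (push _ _ _ _).
    by rewrite PE -(diff_fixl _ dw).
  apply: bform_inj => v v'; rewrite -bform_mul pw.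
  have E1 := comp_cmx (v *m P w) (v' *m P w) rg (Uinv h x Ux) aw.
  have E2 := comp_cmx v v' rg Ux ax.
  apply: etrans (esym E1) (etrans _ E2).
  rewrite /Defs.comp !Eh (cmapK aw) (cmapK ax).
  exact: (ginv h x Ux).
have D0 : 'd (fun w => P w *m g_ (phi w) *m (P w)^T) e xi = 0.
  rewrite -(diff_cst0 (g_ u0) e xi); apply: diff_near_eq; last exact: differentiable_cst.
  by apply: filterS inv => w ->.
have Dg : 'd (fun w => g_ (phi w)) e xi = 'd g_ u0 (xi *m K u0).
  by apply: (@diff_orbit_comp _ g_); exact: sm_differentiable.
have D2 := etrans (esym (diff_conj xi sP sgp Pe)) D0.
have key (c D D' H H' : 'M[R]_n) (r s : 'rV[R]_n) : c *m H + D + H *m c^T = 0 ->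
    D = D' -> H = H' -> p *m c = r -> q *m c = s ->
    bform D' p q + bform H' r q + bform H' p s = 0.
  move=> E <- <- <- <-; rewrite /bform trmx_mul !mulmxA.
  have : (p *m (c *m H + D + H *m c^T) *m q^T) 0 0 = 0 by rewrite E mulmx0 mul0mx mxE.
  rewrite !mulmxDr !mulmxDl !mxE !mulmxA => E2; apply: etrans E2.
  by rewrite [X in X + _ = _]addrC.
exact: key D2 Dg (congr1 g_ orbit_chart_id) (dP xi p) (dP xi q).
Unshelve. all: by end_near. Qed.

(** By [(q w) x = q (w x)], the action field of [eta] at [phi w] is the image under ['d phi w] of
    the right-invariant field [L]. Differentiating [L w *m jac phi w] along [xi] gives the second
    derivative of [phi] plus the image of ['d L e xi], which is tangent. *)
Lemma hess_orbit xi eta : exists t : 'rV[R]_d,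
  eta *m 'd K u0 (xi *m K u0) = 'd (fun w => 'd phi w eta) e xi + t *m K u0.
Proof.
have sK : sm K u0 by exact: (sm_Kc hact aa ax).
have spk : sm (fun w => K (phi w)) e.
  apply: (@sm_comp _ _ _ _ _ phi K); first exact: fdim_rV.
    exact: sm_orbit_chart.
  by rewrite orbit_chart_id.
have sm1 := sm_mulc hG.
pose L w := 'd (mulc CG) (e, w) (eta, 0).
have sL : sm L e.
  apply: (@sm_comp _ _ _ _ _ (fun w => (e, w)) (fun z => 'd (mulc CG) z (eta, 0))).
  - by apply: fdim_prod; exact: fdim_rV.
  - by apply: sm_pair; [exact: sm_cst|exact: sm_id].
  - by apply: sm_diff; exact: sm1.
have sj : sm (jac phi) e by apply: sm_jac; exact: sm_orbit_chart.
have Le : L e = eta.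
  rewrite /L -(diff_fixr _ (sm_differentiable sm1)).
  rewrite (@diff_near_eq _ _ _ id); last exact: ex_diff.
    by rewrite (@diff_lin _ _ _ idfun)// => y; exact: cvg_id.
  have : \forall u \near e, ccod kap u by apply: ccod_nbhs; apply: cmap_ccod; exact: chart_at_cdom.
  by apply: filterS => u ku; rewrite /mulc /= pe mulg1 cinvK.
have cphi : {for e, continuous phi} by exact: sm_continuous sm_orbit_chart.
have nK : \forall w \near e, eta *m K (phi w) = L w *m jac phi w.
  have n1 : \forall w \near e, \forall q \near e, phi (mulc CG (q, w)) = ac (q, phi w).
    have := near_join (mulc_dom hG) => /near_pairl; apply: filterS2 phiD => w [kw aw pw] /near_pairr.
    apply: filterS => q /= [kq _ qw].
    rewrite /phi /ac /actc /mulc /= !cmapK//.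
    by rewrite (actM hact).
  have nKc : \forall u \near phi e, (forall xi, xi *m K u = 'd ac (e, u) (xi, 0)) /\
      differentiable ac (e, u).
    rewrite orbit_chart_id; apply: filterI; first exact: (Kc_near hact aa ax).
    exact: near_pairl acD.
  have n2 := cphi _ nKc.
  have n3 := near_pairl (sm_near_differentiable sm1).
  have n4 := sm_near_differentiable sm_orbit_chart.
  near=> w.
  have [Kw dw] : (forall xi, xi *m K (phi w) = 'd ac (e, phi w) (xi, 0)) /\
      differentiable ac (e, phi w) by near: w; exact: n2.
  have dm : differentiable (mulc CG) (e, w) by near: w; exact: n3.
  have dp : differentiable phi w by near: w; exact: n4.
  have [kw _ _] : [/\ ccod kap w, cdom a (act (cinv kap w) x) & phi w = cmap a (act (cinv kap w) x)] by near: w.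
  have nq : \forall q \near e, phi (mulc CG (q, w)) = ac (q, phi w) by near: w; exact: n1.
  have mw : mulc CG (e, w) = w by rewrite /mulc /= pe mul1g cinvK.
  have dmf : differentiable (fun q => mulc CG (q, w)) e.
    by apply: (@differentiable_comp _ _ _ _ (fun q => (q, w)) (mulc CG)).
  have dpm : differentiable phi (mulc CG (e, w)) by rewrite mw.
  rewrite Kw -(diff_fixr _ dw).
  rewrite (@diff_near_eq _ _ _ (phi \o (fun q => mulc CG (q, w))))//; last exact: differentiable_comp.
  rewrite diff_comp//= (diff_fixr _ dm) mw.
  exact: jacE.
exists ('d L e xi).
have sc : sm (fun _ : 'rV[R]_d => eta) e by exact: sm_cst.
have E1 : eta *m 'd K u0 (xi *m K u0) = 'd (fun w => eta *m K (phi w)) e xi.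
  apply/esym; apply: etrans (diff_mulmx xi sc spk) _.
  rewrite diff_cst0 mul0mx add0r; congr (_ *m _).
  by apply: (@diff_orbit_comp _ K); exact: sm_differentiable.
have sLj : sm (fun w => L w *m jac phi w) e by exact: sm_mul.
have E2 : 'd (fun w => eta *m K (phi w)) e xi = 'd (fun w => L w *m jac phi w) e xi.
  by apply: diff_near_eq (sm_differentiable sLj); apply: filterS nK => w ->.
have E3 : 'd (fun w => 'd phi w eta) e xi = eta *m 'd (jac phi) e xi.
  have -> : (fun w => 'd phi w eta) = (fun w => eta *m jac phi w).
    by apply/funext => w; rewrite jacE.
  by apply: etrans (diff_mulmx xi sc sj) _; rewrite diff_cst0 mul0mx add0r.
apply: etrans E1 (etrans E2 (etrans (diff_mulmx xi sL sj) _)).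
rewrite addrC; congr (_ + _); first by rewrite E3; congr (_ *m _).
by apply: etrans (esym (jacE _ _ _)) _; exact: diff_orbit_chart.
Unshelve. all: by end_near. Qed.

End OrbitMap.

(** Here [k], [h] are the action fields of [xi], [eta] at the point; [Z], [W] are their derivatives
    along [p]; [X] is the derivative of the first along [h], and [Y] that of the second along [k];
    [C] is the Christoffel term and [D] the derivative of the metric along [p]. The last three
    hypotheses polarize to [A(Z, h) + A(W, k) + D(k, h) = 0]; with the two Killing equations this
    eliminates everything but [X] and [Y] from the Koszul formula. *)
Lemma polarize_killing {R : realFieldType} n (A D : 'M[R]_n) (k h X Y Z W C p : 'rV[R]_n) (a1 a2 : R) :
  A^T = A -> D^T = D -> bform A C p = 2^-1 * (a1 + a2 - bform D k h) ->
  a1 + bform A X p + bform A h Z = 0 -> a2 + bform A Y p + bform A k W = 0 ->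
  2 * bform A Z k + bform D k k = 0 -> 2 * bform A W h + bform D h h = 0 ->
  2 * bform A (Z + W) (k + h) + bform D (k + h) (k + h) = 0 ->
  bform A (C + 2^-1 *: (Y + X)) p = 0.
Proof.
move=> sA sD; rewrite !(bformDl, bformDr, bformZl) (bformC h Z sA) (bformC k W sA) (bformC h k sD).
lra.
Qed.

Section TotallyGeodesic.
Context {R : realType} (d n : nat) (G : topGroupType) (M : topologicalType).
Context (CG : charted G 'rV[R]_d) (CM : charted M 'rV[R]_n) (act : G -> M -> M).
Hypotheses (hG : lie_group CG) (hM : smooth_manifold CM) (hact : smooth_action CG CM act).
Context (b : tensor G 'rV[R]_d) (hb : bi_invariant_metric CG b).
Context (gM : tensor M 'rV[R]_n) (hgM : riemannian_metric CM setT gM)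
  (isom : invariant_metric CM act setT gM).
Context (U : set M) (oU : open U) (Uinv : forall h y, U y -> U (act h y)).
Hypothesis rk : forall y, U y -> rank_const CG CM act y.
Context (a : chart M 'rV[R]_n) (x : M).
Hypotheses (aa : atlas CM a) (ax : cdom a x) (Ux : U x).

Let e := idG CG.
Let u0 := cmap a x.
Let K := Kc CG act a.
Let gt := deformed CG CM act b gM 0.
Let g_ := cmx CM gt a.
Let B := gmxG b.

Let rgt : riemannian_metric CM U gt.
Proof. exact (deformed_metric hG hM hact hb hgM oU rk (lexx 0)). Qed.

Let sg : sm g_ u0. Proof. exact (sm_cmx rgt oU Ux aa ax). Qed.
Let sK : sm K u0. Proof. exact (sm_Kc hact aa ax). Qed.
Let spdg : spd (g_ u0). Proof. exact (spd_cmx hM rgt Ux aa ax). Qed.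

Let nearU : \forall u \near u0, [/\ ccod a u, cdom a (cinv a u), cmap a (cinv a u) = u & U (cinv a u)].
Proof. by apply: near_chart => //; exact: open_nbhs_nbhs. Qed.

Let dg_sym p : ('d g_ u0 p)^T = 'd g_ u0 p.
Proof.
rewrite -(diff_trmx p sg); apply: diff_near_eq (sm_differentiable sg).
apply: filterS nearU => u [_ adu cu Uu].
by have [E _] := spd_cmx hM rgt Uu aa adu; rewrite cu in E; exact: esym E.
Qed.

(** Orthogonality to the isotropy algebra at the single point [x]; nearby, [xi] is kept constant and
    need not satisfy the condition. *)
Let horiz (xi : 'rV[R]_d) := forall zeta, zeta *m K u0 = 0 -> bform B xi zeta = 0.

(** The left side is, up to sign, the bracket of two action fields; by [hess_orbit] its
    non-tangential part is the antisymmetrized second derivative of the orbit map, which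
    vanishes. *)
Lemma bracket_tangent xi eta : exists t : 'rV[R]_d,
  eta *m 'd K u0 (xi *m K u0) - xi *m 'd K u0 (eta *m K u0) = t *m K u0.
Proof.
have [t1 E1] := hess_orbit hG hact aa ax xi eta.
have [t2 E2] := hess_orbit hG hact aa ax eta xi.
exists (t1 - t2).
have key (X Y C D : 'rV[R]_n) : X = C + t1 *m K u0 -> Y = D + t2 *m K u0 -> C = D ->
    X - Y = (t1 - t2) *m K u0.
  by move=> -> -> ->; rewrite mulmxBl opprD addrACA subrr add0r.
exact: key E1 E2 (diff_sym_mx eta xi (sm_orbit_chart hact aa ax)).
Qed.

(* [zeta] orthogonal to the isotropy maximizes the length of its action field at [x]. *)
Lemma length_stationary zeta p : horiz zeta ->
  2 * bform (g_ u0) (zeta *m 'd K u0 p) (zeta *m K u0)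
  + bform ('d g_ u0 p) (zeta *m K u0) (zeta *m K u0) = 0.
Proof.
move=> hz; pose k u := zeta *m K u.
have sc : sm (fun _ : 'rV[R]_n => zeta) u0 by exact: sm_cst.
have sk : sm k u0 by exact: sm_mul.
have dk : 'd k u0 p = zeta *m 'd K u0 p.
  by apply: etrans (diff_mulmx p sc sK) _; rewrite diff_cst0 mul0mx add0r.
have skg : sm (fun u => k u *m g_ u) u0 by exact: sm_mul.
pose F u := k u *m g_ u *m (k u)^T.
have sF : sm F u0 by apply: sm_mul => //; exact: sm_tr.
have nF : \forall u \near u0, F u 0 0 = bform (deform (cmx CM gM a u) B (K u) 0) (k u) (k u) /\
    spd (cmx CM gM a u).
  apply: filterS nearU => u [_ adu cu Uu]; rewrite -cu; split.
    rewrite /F -/(bform _ _ _); congr (bform _ _ _); apply/matrixP => i j.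
    by rewrite mxE; exact: (gij_deformed hG hM hact hb hgM i j (lexx 0) aa adu).
  exact: (spd_cmx hM hgM I aa adu).
have [F0 s0] := nbhs_singleton nF.
have max : \forall u \near u0, F u 0 0 <= F u0 0 0.
  have key (r1 r2 r3 r4 : R) : r1 = r2 -> r4 = r3 -> r2 <= r3 -> r1 <= r4.
    by move=> -> ->.
  have E0 := etrans F0 (deform0_perp s0 (spd_gmxG hb) zeta hz).
  apply: filterS nF => u [Fu su].
  have L := deform0_le (K u) su (spd_gmxG hb) zeta.
  exact: key Fu E0 L.
have dF : \forall u \near u0, differentiable (fun u => F u 0 0) u.
  by apply: sm_near_differentiable; exact: (sm_coord 0 0 sF).
have := diff_max p dF max; rewrite (diff_coord p 0 0 (sm_differentiable sF)).
have key (D X Y : 'rV[R]_n) (Z : 'M[R]_1) : Z = Y *m (k u0)^T + k u0 *m g_ u0 *m X^T ->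
   Y = X *m g_ u0 + k u0 *m 'd g_ u0 p -> X = D -> Z 0 0 = 0 ->
   2 * bform (g_ u0) D (k u0) + bform ('d g_ u0 p) (k u0) (k u0) = 0.
  move=> -> -> ->; rewrite mulmxDl !mxE => E.
  have := bformC D (k u0) spdg.1; rewrite /bform !mxE => E2.
  lra.
apply: key dk.
  by apply: etrans (diff_mulmx p skg (sm_tr sk)) _; rewrite (diff_trmx p sk).
exact: diff_mulmx.
Qed.

Let horizD xi eta : horiz xi -> horiz eta -> horiz (xi + eta).
Proof. by move=> h1 h2 zeta z0; rewrite bformDl h1// h2// addr0. Qed.

(** Equivalently, the covariant derivatives of the two action fields along each other have sum zero
    at [x]. *)
Lemma christoffel_orbit xi eta : horiz xi -> horiz eta ->
  christoffel CM gt a u0 (xi *m K u0) (eta *m K u0) =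
  - (2^-1 *: (eta *m 'd K u0 (xi *m K u0) + xi *m 'd K u0 (eta *m K u0))).
Proof.
move=> hxi heta; apply/eqP; rewrite -subr_eq0 opprK; apply/eqP.
(* By definiteness it suffices that [v] pairs to zero with an arbitrary [p], so one of the two
   occurrences of [v] is generalized. *)
apply: (spd_eq0 spdg); set v := _ + _; move: {2}v => p.
have ginv : invariant_metric CM act U gt.
  exact (deformed_invariant hG hM hact hb hgM isom (lexx 0)).
have CF := christoffel_form sg spdg.1 (spd_unit spdg) (xi *m K u0) (eta *m K u0) p.
have K1 := killing hM hact aa ax oU Ux Uinv rgt ginv xi (eta *m K u0) p.
have K2 := killing hM hact aa ax oU Ux Uinv rgt ginv eta (xi *m K u0) p.
have L1 := length_stationary p hxi.
have L2 := length_stationary p heta.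
have L3 := length_stationary p (horizD hxi heta).
rewrite !(mulmxDl xi eta) in L3.
exact: polarize_killing spdg.1 (dg_sym p) CF K1 K2 L1 L2 L3.
Qed.

Lemma horiz_rep v : (v <= K u0)%MS -> exists2 xi : 'rV[R]_d, horiz xi & v = xi *m K u0.
Proof.
have sA := spd_cmx hM hgM I aa ax; have sB := spd_gmxG hb.
have fT := row_base_free (K u0); have TK := eq_row_base (K u0).
move=> /submxP[xi ->]; exists (horiz_lift (cmx CM gM a u0) B (K u0) (row_base (K u0)) xi).
  by move=> zeta zK; exact: horiz_lift_perp.
by rewrite (horiz_lift_act sA sB fT TK).
Qed.

(** Turns membership in the moving subspace tangent to the orbits into a smooth linear equation that
    can be differentiated; [N u] is the complement of the Euclidean orthogonal projection in the
    chart. *)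
Lemma local_projection : exists N : 'rV[R]_n -> 'M[R]_n, sm N u0 /\
  \forall u \near u0, forall v : 'rV[R]_n, (v <= K u)%MS <-> v *m N u = 0.
Proof.
have [r [E HE]] := local_frame hG hM hact hgM aa ax (rk Ux).
pose T u := E *m K u.
have sT : sm T u0 by apply: sm_mul => //; exact: sm_cst.
have [fT0 _] := nbhs_singleton HE.
pose S u := gramT 1%:M (T u).
have sS : sm S u0.
  by apply: sm_mul; [apply: sm_mul => //; exact: sm_cst|exact: sm_tr].
have uS u : row_free (T u) -> S u \in unitmx.
  by move=> fT; apply: spd_unit; exact: (spd_gram (@spd1 R n) fT).
exists (fun u => 1%:M - projT 1%:M (T u)); split.
  apply: smB; first exact: sm_cst.
  apply: sm_mul => //; apply: sm_mul; first by apply: sm_mul; [exact: sm_cst|exact: sm_tr].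
  by apply: sm_inv => //; exact: uS.
apply: filterS HE => u [fT TK] v; rewrite mulmxBr mulmx1; split.
  have TP : T u *m projT 1%:M (T u) = T u.
    by rewrite /projT !mulmxA -/(gramT 1%:M (T u)) mulmxV ?mul1mx//; exact: uS.
  rewrite -TK => /submxP[c ->]; apply/eqP; rewrite subr_eq0; apply/eqP.
  exact: esym (etrans (esym (mulmxA c (T u) _)) (congr1 (mulmx c) TP)).
by move=> /eqP; rewrite subr_eq0 => /eqP ->; exact: projT_sub.
Qed.

Lemma tangent_chart y v : cdom a y ->
  orbit_tangent CG CM act y (push CM a (cmap a y) v) <-> (v <= K (cmap a y))%MS.
Proof.
move=> ay; have E := KcE hG hM hact aa ay.
have fP : row_free (pushM CM a y) by rewrite row_free_unit (pushM_unit hM).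
have -> : (v <= K (cmap a y))%MS = (v *m pushM CM a y <= Kmx CG CM act y)%MS.
  by rewrite E (submxMfree _ _ fP).
by rewrite -(push_mx CM v ay); exact: orbit_tangentE.
Qed.

(** [Z], the difference of [Y] and the action field of [eta], vanishes at [x] and is tangent along
    the orbit. Differentiating [Z *m N = 0] along the orbit map shows that the derivative of [Z] in
    the direction of [X] is tangent, which reduces the claim to action fields. *)
Lemma covariant_tangent (S : set M) (W : set 'rV[R]_n) (X Y : 'rV[R]_n -> 'rV[R]_n) :
  open W -> W u0 -> smooth W Y -> S x -> (forall h y, S y -> S (act h y)) ->
  (X u0 <= K u0)%MS ->
  (forall u, W u -> S (cinv a u) -> orbit_tangent CG CM act (cinv a u) (push CM a u (Y u))) ->
  (nabla CM gt a X Y u0 <= K u0)%MS.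
Proof.
move=> oW Wu sY Sx Sinv TX TY.
have aau : ccod a u0 by exact: cmap_ccod.
have sYu : sm Y u0 by exact: smooth_sm oW Wu sY.
have TY0 : (Y u0 <= K u0)%MS.
  apply/(tangent_chart (Y u0) ax).
  have := TY u0 Wu; rewrite (cmapK ax); exact.
have [xi hxi XE] := horiz_rep TX; have [eta heta YE] := horiz_rep TY0.
have [N [sN HN]] := local_projection.
pose phi w := actc CG act a (w, u0).
have phie : phi e = u0 by exact: (orbit_chart_id hact ax).
have sphi : sm phi e by exact: (sm_orbit_chart hact aa ax).
pose Z u := Y u - eta *m K u.
have sc : sm (fun _ : 'rV[R]_n => eta) u0 by exact: sm_cst.
have sk : sm (fun u => eta *m K u) u0 by exact: sm_mul.
have sZ : sm Z u0 by exact: smB.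
have Z0 : Z u0 = 0 by rewrite /Z -YE subrr.
have sZN : sm (fun u => Z u *m N u) u0 by exact: sm_mul.
have nZ : \forall w \near e, Z (phi w) *m N (phi w) = 0.
  have cphi := sm_continuous sphi.
  have n1 : \forall u \near phi e, W u /\ forall v : 'rV[R]_n, (v <= K u)%MS <-> v *m N u = 0.
    rewrite phie; apply: filterI; first exact: open_nbhs_nbhs.
    exact: HN.
  have n2 := cphi _ n1.
  have n3 := near_pairr (actc_dom hact ax).
  near=> w.
  have [Wp Np] : W (phi w) /\ forall v : 'rV[R]_n, (v <= K (phi w))%MS <-> v *m N (phi w) = 0.
    by near: w; exact: n2.
  have [/= kw _ aw] : [/\ ccod (chart_at CG 1%g) (w, cmap a x).1, ccod a (w, cmap a x).2 &
    cdom a (act (cinv (chart_at CG 1%g) (w, cmap a x).1) (cinv a (w, cmap a x).2))].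
    by near: w; exact: n3.
  rewrite cmapK// in aw.
  have pE : phi w = cmap a (act (cinv (chart_at CG 1%g) w) x) by rewrite /phi /actc /= cmapK.
  have Sp : S (cinv a (phi w)) by rewrite pE cmapK//; exact: Sinv.
  have cE : cinv a (phi w) = act (cinv (chart_at CG 1%g) w) x by rewrite pE cmapK.
  have TYw := TY _ Wp Sp.
  have T := tangent_chart (Y (phi w)) aw.
  rewrite -pE in T; rewrite cE in TYw.
  have YK := T.1 TYw.
  have KK : (- (eta *m K (phi w)) <= K (phi w))%MS by rewrite eqmx_opp submxMl.
  exact: (Np _).1 (addmx_sub YK KK).
have E0 : 'd Z u0 (xi *m K u0) *m N u0 = 0.
  have E1 := diff_mulmx (xi *m K u0) sZ sN.
  have E2 := diff_orbit_comp hact aa ax xi (sm_differentiable sZN).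
  have E3 : 'd (fun w => Z (phi w) *m N (phi w)) e xi = 0.
    rewrite -(diff_cst0 (0 : 'rV[R]_n) e xi); apply: diff_near_eq; last exact: differentiable_cst.
    by apply: filterS nZ => w ->.
  have key (T Q : 'rV[R]_n) : T = Q + Z u0 *m 'd N u0 (xi *m K u0) -> T = 0 -> Q = 0.
    by rewrite Z0 mul0mx addr0 => <-.
  exact: key E1 (etrans (esym E2) E3).
have dZK : ('d Z u0 (xi *m K u0) <= K u0)%MS by apply/(nbhs_singleton HN).
have dZE : 'd Z u0 (xi *m K u0) = 'd Y u0 (xi *m K u0) - eta *m 'd K u0 (xi *m K u0).
  have D1 : 'd (fun u => eta *m K u) u0 (xi *m K u0) = eta *m 'd K u0 (xi *m K u0).
    by apply: etrans (diff_mulmx _ sc sK) _; rewrite diff_cst0 mul0mx add0r.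
  apply: etrans (congr1 (fun v => 'd Y u0 (xi *m K u0) - v) D1).
  have /= D2 := congr1 (fun f : 'rV[R]_n -> 'rV[R]_n => f (xi *m K u0))
    (diffB (sm_differentiable sYu) (sm_differentiable sk)).
  exact: D2.
have [t tE] := bracket_tangent xi eta.
rewrite /nabla XE YE (deriveE _ (sm_differentiable sYu)).
have key (DY Q1 Q2 C : 'rV[R]_n) : ((DY - Q1)%R <= K u0)%MS -> C = - (2^-1 *: (Q1 + Q2)) ->
    Q1 - Q2 = t *m K u0 -> ((DY + C)%R <= K u0)%MS.
  (* By [christoffel_orbit] the covariant derivative of the action field of [eta] along that of [xi]
     is half the tangential difference [Q1 - Q2]. *)
  move=> D1 -> D2; have -> : DY - 2^-1 *: (Q1 + Q2) = (DY - Q1) + 2^-1 *: (Q1 - Q2).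
    by apply/rowP => i; rewrite !mxE; field.
  by apply: addmx_sub => //; apply: scalemx_sub; rewrite D2 submxMl.
apply: key _ (christoffel_orbit hxi heta) tE.
by rewrite -dZE.
Unshelve. all: by end_near. Qed.

End TotallyGeodesic.

Lemma deformed_totally_geodesic {R : realType} (d n : nat) (G : topGroupType) (M : topologicalType)
    (CG : charted G 'rV[R]_d) (CM : charted M 'rV[R]_n) (act : G -> M -> M)
    (b : tensor G 'rV[R]_d) (gM : tensor M 'rV[R]_n) (U : set M) x :
  lie_group CG -> smooth_manifold CM -> smooth_action CG CM act ->
  bi_invariant_metric CG b -> riemannian_metric CM setT gM ->
  invariant_metric CM act setT gM -> open U -> (forall h y, U y -> U (act h y)) ->
  (forall y, U y -> rank_const CG CM act y) ->
  totally_geodesic CM U (deformed CG CM act b gM 0) (act_orbit act x) (orbit_tangent CG CM act).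
Proof.
move=> hG hM hact hb hgM isom oU Uinv rk a aa W oW WU X Y sX sY TX TY u Wu Su.
have [au Uu] := WU u Wu; have ax := cinv_cdom au.
have uE : cmap a (cinv a u) = u by exact: cinvK.
have T := tangent_chart hG hM hact aa _ ax; rewrite uE in T.
apply/T; rewrite -uE.
apply: (covariant_tangent hG hM hact hb hgM isom oU Uinv rk aa ax Uu oW _ sY Su) => //.
- by rewrite uE.
- by move=> h y [k _ <-]; exists (h * k)%g => //; rewrite (actM hact).
- by rewrite uE; apply/T; exact: TX.
Qed.

Theorem theoremA (R : realType) (d n : nat)
  (G : topGroupType) (CG : charted G 'rV[R]_d)
  (hG : lie_group CG) (cG : compact [set: G])
  (M : topologicalType) (CM : charted M 'rV[R]_n) (hM : smooth_manifold CM)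
  (gM : tensor M 'rV[R]_n) (hgM : riemannian_metric CM setT gM)
  (cM : complete_metric CM gM)
  (act : G -> M -> M) (hact : smooth_action CG CM act)
  (isom : invariant_metric CM act setT gM)
  (gbi : tensor G 'rV[R]_d) (hgbi : bi_invariant_metric CG gbi)
  (gl : R -> tensor M 'rV[R]_n)
  (hgl : forall l : R, 0 < l -> cheeger_metric CG CM act l gbi gM (gl l))
  (p : nat) (U : set M) (oU : open U) (UMreg : U `<=` Mreg act)
  (Uinv : forall (h : G) (x : M), U x -> U (act h x))
  (Ucpt : compact (closure U `&` Mreg act)) :
  let gtl := fun l : R => rescaled_metric CG CM act l (gl l) in
  (forall l : R, 0 < l -> riemannian_metric CM U (gtl l)) /\
  exists gt : tensor M 'rV[R]_n,
    [/\ riemannian_metric CM U gt,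
        invariant_metric CM act U gt,
        Cp_converges CM p U gtl gt,
        forall (m : nat) (B : topologicalType) (CB : charted B 'rV[R]_m)
          (pi : M -> B), smooth_orbit_space CM act U CB pi ->
          exists gB : tensor B 'rV[R]_m,
            riemannian_metric CB setT gB /\
            riemannian_submersion CM CB U gt pi gB &
        forall x : M, U x ->
          totally_geodesic CM U gt (act_orbit act x) (orbit_tangent CG CM act) /\
          normal_homogeneous_orbit CG CM act gt x].
Proof.
move=> gtl.
have rk y : U y -> rank_const CG CM act y.
  by move=> /UMreg; exact: (rank_const_Mreg hG hM hact hgbi hgM).
have gtlE l : 0 < l -> gtl l = deformed CG CM act gbi gM (l ^+ 2).
  exact: (rescaled_eq hG hM hact hgbi hgM hgl).
have rgt : riemannian_metric CM U (deformed CG CM act gbi gM 0).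
  exact: (deformed_metric hG hM hact hgbi hgM oU rk (lexx 0)).
have igt : invariant_metric CM act U (deformed CG CM act gbi gM 0).
  exact: (deformed_invariant hG hM hact hgbi hgM isom (lexx 0)).
split.
  move=> l l0; apply: (eq_ind_r (riemannian_metric CM U) _ (gtlE l l0)).
  exact: (deformed_metric hG hM hact hgbi hgM oU rk (sqr_ge0 l)).
exists (deformed CG CM act gbi gM 0); split.
- exact: rgt.
- exact: igt.
- exact: (Cp_limit hG hM hact hgbi hgM hgl UMreg Ucpt).
- by move=> m B CB pi; exact: (orbit_space_metric hM hact oU Uinv rgt igt).
- move=> x Ux; split.
    exact (deformed_totally_geodesic (x := x) hG hM hact hgbi hgM isom oU Uinv rk).
  exact: (deformed_normal_homogeneous hG hM hact hgbi hgM x).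
Qed.
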